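(* Let $s \in (\frac12,1)$ and let $u \in L_s(\mathbb{R})$ be a solution of $$(-\Delta)^s u = e^u \ \text{ in } \mathbb{R} \quad\text{with}\quad \int_{\mathbb{R}} e^u\,dx < +\infty .$$ Then $u$ is smooth, bounded from above, and satisfies $u(x) = O(|x|^{2s-1})$ as $|x|\to+\infty$. Moreover, $u$ is even and strictly monotone-decreasing around some point $x_0\in\mathbb{R}$, i.e., there are $x_0 \in \mathbb{R}$ and a function $u_0:[0,\infty)\to\mathbb{R}$ with $u_0(r) < u_0(t)$ whenever $r > t \ge 0$ such that $u(x) = u_0(|x-x_0|)$ for all $x\in\mathbb{R}$.
   Context: For $s\in(0,1)$ and $\varphi\in C_c^\infty(\mathbb{R})$, $(-\Delta)^s\varphi(x) = C_s\,\mathrm{PV}\int_{\mathbb{R}}\frac{\varphi(x)-\varphi(y)}{|x-y|^{1+2s}}\,dy$ with $C_s = \frac{4^s}{\sqrt{\pi}}\frac{\Gamma(\frac12+s)}{|\Gamma(-s)|}$. The space $L_s(\mathbb{R})$ consists of all real-valued $u\in L^1_{\mathrm{loc}}(\mathbb{R})$ with $\int_{\mathbb{R}}\frac{|u(x)|}{1+|x|^{1+2s}}\,dx<+\infty$. A function $u\in L_s(\mathbb{R})$ with $e^u\in L^1_{\mathrm{loc}}(\mathbb{R})$ is a solution of $(-\Delta)^s u = e^u$ if $\int_{\mathbb{R}} u\,(-\Delta)^s\varphi\,dx = \int_{\mathbb{R}} e^u\varphi\,dx$ for all $\varphi\in C_c^\infty(\mathbb{R})$. As usual, $u$ is identified with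 its continuous representative. *)

(* Defs.v *)
From HB Require Import structures.
From mathcomp Require Import all_boot all_order all_algebra.
From mathcomp Require Import all_classical all_reals all_analysis.

Set Implicit Arguments.
Unset Strict Implicit.
Unset Printing Implicit Defensive.

Import Order.TTheory GRing.Theory Num.Theory.
Import numFieldNormedType.Exports.

Local Open Scope classical_set_scope.
Local Open Scope ring_scope.

Section Definitions.
Context {R : realType}.
Implicit Types (s x z : R) (u f phi : R -> R).

Local Notation mu := (@lebesgue_measure R).

Definition smooth f := forall (n : nat) (x : R), derivable (derive1n n f) x 1.

Definition test_function phi :=
  smooth phi /\ compact (closure [set x | phi x != 0]).

Definition euler_gamma z : R :=
  \int[mu]_(t in `]0, +oo[) (t `^ (z - 1) * expR (- t)).

(* Gamma on R minus the non-positive integers: Euler's integral for z > 0,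
   extended by Gamma z = Gamma (z + n) / (z (z + 1) ... (z + n - 1)); for a
   non-integer z < 0, n = - floor z puts z + n in ]0, 1[. *)
Definition Gamma z : R :=
  let n := if 0 < z then 0%N else `|Num.floor z|%N in
  euler_gamma (z + n%:R) / \prod_(i < n) (z + i%:R).

Definition fracLap_const s : R :=
  4 `^ s / Num.sqrt pi * (Gamma (2^-1 + s) / `|Gamma (- s)|).

Definition fracLap s phi x : R :=
  fracLap_const s *
  lim ((fun eps : R => \int[mu]_(y in [set y : R | eps < `|x - y|])
          ((phi x - phi y) / `|x - y| `^ (1 + 2 * s))) @ 0^'+).

Definition Ls_space s u :=
  locally_integrable setT u /\
  (\int[mu]_x (`|u x| / (1 + `|x| `^ (1 + 2 * s)))%:E < +oo)%E.

Definition liouville_solution s u :=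
  [/\ Ls_space s u,
      locally_integrable setT (fun x => expR (u x)) &
      forall phi, test_function phi ->
        (\int[mu]_x (u x * fracLap s phi x)%:E =
         \int[mu]_x (expR (u x) * phi x)%:E)%E].

End Definitions.

(* Main.v *)
(** Put [a = 2 s - 1]. The kernel [|x|^a] is, up to a constant, a fundamental
    solution of the fractional Laplacian: by Fubini and scaling, the latter
    maps [|.|^a * eta''] to a constant multiple of [eta'']. Cut off outside a
    ball of radius [r], this kernel yields admissible test functions, with an
    error [O (r^(a - 1) (1 + |x|)^(-1 - 2 s))]; letting [r] tend to infinity,
    the weak equation says that [c u - V] has vanishing second derivative, where
    [V z] is the integral of [(|x - z|^a - |x|^a) e^(u x)]. Hence [c u - V] is
    affine, and since [V z] grows exactly like [|z|^a], integrability of [e^u]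
    forces [c < 0] and excludes a linear term: [u = p - k V] with [k > 0].

    The upper bound, the growth and the decay of [e^u] follow. The derivative of
    [V] is a weakly singular integral of [e^u], and differentiating it again and
    again under the integral sign gives smoothness. For the symmetry, comparing
    [u] with its reflection [u_l] about [l] gives
    [u - u_l = k/2 \int (|2 l - x - y|^a - |x - y|^a) (e^u - e^(u_l)) dy], whose
    kernel is positive for [x, y > l]. If [u - u_l <= c] on [(l, +oo)] then also
    [u - u_l <= theta c] there, where [theta] is an integral over the set
    [u > u_l] only. It is smaller than 1 for large [l], and for [l] slightly
    below the critical position unless [u] is symmetric about the latter. *)

Require Import Defs.
From HB Require Import structures.
From mathcomp Require Import all_boot all_order all_algebra.
From mathcomp Require Import all_classical all_reals all_analysis.
From mathcomp Require Import ring lra.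
From mathcomp Require Import measurable_realfun real_interval.

Set Implicit Arguments.
Unset Strict Implicit.
Unset Printing Implicit Defensive.
Import Order.TTheory GRing.Theory Num.Theory.
Import numFieldNormedType.Exports.
Local Open Scope classical_set_scope.
Local Open Scope ring_scope.

(** * Integration on the real line *)

(** Neither [fracLap_const] nor [riesz_constant] is ever evaluated: their product is just a number
    [c], whose sign is read off from the integrability of [e^u]. The main obstacle is that the weak
    equation admits compactly supported test functions only, while [|x|^a] grows, and that nothing
    is known about [u] beyond its membership in [L_s]. The truncation error therefore has to decay
    at the exact rate of the [L_s] weight, with a factor that vanishes as the radius grows. Working
    with [eta''] instead of [eta] serves twice: both derivatives can be thrown onto the cut-off
    kernel, where they produce the factor [r^(a - 1)], and the vanishing integral of [eta''] allows
    [|x|^a] to be subtracted in [V], which then converges for a merely integrable [e^u]. The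
    principal value is rewritten as an absolutely convergent integral of second differences, to
    which Fubini and dominated convergence apply. The moving planes act on the integral equation: a
    contraction, iterated from an upper bound on [u - u_l] uniform in [x], takes the place of a
    maximum principle. *)

Section lebesgue_integral_on_the_line.
Context {R : realType}.
Notation mu := (@lebesgue_measure R).
Implicit Types (a b c r x y z t : R) (f g h : R -> R).

Lemma ae_imply (P Q : R -> Prop) : (forall x, P x -> Q x) ->
  {ae mu, forall x, P x} -> {ae mu, forall x, Q x}.
Proof.
by move=> PQ; apply: filterS => //; exact: (ae_filter_ringOfSetsType mu).
Qed.

Definition summable f := mu.-integrable setT (EFin \o f).

(** An infinite integral gets the value 0, since [fine] sends both infinities there; equalities
    between totals therefore rest on summability. *)
Definition total f : R := \int[mu]_x f x.

Lemma summable_measurable f : summable f -> measurable_fun setT f.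
Proof. by move=> /integrableP[/measurable_EFinP]. Qed.

Lemma summable_le f g : measurable_fun setT f -> summable g ->
  (forall x, `|f x| <= g x) -> summable f.
Proof.
move=> mf ig fg; apply: le_integrable ig => //; first exact/measurable_EFinP.
by move=> x _ /=; rewrite lee_fin (le_trans (fg x))// ler_norm.
Qed.

Lemma summable_le_norm f g : measurable_fun setT f -> summable g ->
  (forall x, `|f x| <= `|g x|) -> summable f.
Proof.
move=> mf ig fg; apply: le_integrable ig => //; first exact/measurable_EFinP.
by move=> x _ /=; rewrite lee_fin fg.
Qed.

Lemma summable_norm f : summable f -> summable (fun x => `|f x|).
Proof. by move=> sf; exact: integrable_norm. Qed.

Lemma summableD f g : summable f -> summable g -> summable (fun x => f x + g x).
Proof. by move=> sf sg; exact: (integrableD measurableT sf sg). Qed.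

Lemma summableB f g : summable f -> summable g -> summable (fun x => f x - g x).
Proof. by move=> sf sg; exact: (integrableB measurableT sf sg). Qed.

Lemma summableZ c f : summable f -> summable (fun x => c * f x).
Proof. by move=> sf; exact: (integrableZl measurableT c sf). Qed.

Lemma summable_ext f g : f =1 g -> summable f -> summable g.
Proof. by move=> /funext ->. Qed.

Lemma summableN f : summable f -> summable (fun x => - f x).
Proof. by move=> /(summableZ (-1)); apply: summable_ext => x; rewrite mulN1r. Qed.

Lemma summable0 : summable (fun=> 0).
Proof. exact: integrable0. Qed.

Lemma total_ext f g : f =1 g -> total f = total g.
Proof. by move=> /funext ->. Qed.

Lemma totalD f g : summable f -> summable g ->
  total (fun x => f x + g x) = total f + total g.
Proof. by move=> sf sg; exact: RintegralD. Qed.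

Lemma totalB f g : summable f -> summable g ->
  total (fun x => f x - g x) = total f - total g.
Proof. by move=> sf sg; exact: RintegralB. Qed.

Lemma totalZ c f : summable f -> total (fun x => c * f x) = c * total f.
Proof. by move=> sf; exact: RintegralZl. Qed.

Lemma totalN f : summable f -> total (fun x => - f x) = - total f.
Proof.
move=> sf; rewrite -[RHS]mulN1r -totalZ//.
by apply: total_ext => x; rewrite mulN1r.
Qed.

Lemma total0 : total (fun=> 0) = 0.
Proof. by rewrite /total Rintegral_cst// mul0r. Qed.

Lemma total_ge0 f : (forall x, 0 <= f x) -> 0 <= total f.
Proof. by move=> f0; exact: Rintegral_ge0. Qed.

Lemma total_le f g : summable f -> summable g -> (forall x, f x <= g x) ->
  total f <= total g.
Proof. by move=> sf sg fg; exact: le_Rintegral. Qed.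

Lemma total_norm_le f : summable f -> `|total f| <= total (fun x => `|f x|).
Proof. by move=> sf; exact: le_normr_Rintegral. Qed.

Lemma total_norm_le_dom f g : measurable_fun setT f -> summable g ->
  (forall x, `|f x| <= g x) -> `|total f| <= total g.
Proof.
move=> mf sg fg; have sf := summable_le mf sg fg.
by rewrite (le_trans (total_norm_le sf))// total_le//; exact: summable_norm.
Qed.

Lemma EFin_total f : summable f -> (total f)%:E = (\int[mu]_x (f x)%:E)%E.
Proof. by move=> sf; rewrite /total /Rintegral fineK//; exact: integrable_fin_num. Qed.

Lemma total_ae f g : measurable_fun setT f -> measurable_fun setT g ->
  {ae mu, forall x, f x = g x} -> total f = total g.
Proof.
move=> mf mg fg; congr fine; apply: ae_eq_integral => //;
  [exact/measurable_EFinP|exact/measurable_EFinP|].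
by move: fg; apply: ae_imply => x + _ /= => ->.
Qed.

Lemma summable_ae f g : measurable_fun setT g ->
  {ae mu, forall x, f x = g x} -> summable f -> summable g.
Proof.
move=> mg fg sf; have mf := summable_measurable sf.
apply/integrableP; split; first exact/measurable_EFinP.
have /integrableP[_] := sf; congr (_ < _)%E.
apply: ae_eq_integral => //.
- by apply: measurableT_comp => //; exact/measurable_EFinP.
- by apply: measurableT_comp => //; exact/measurable_EFinP.
- by move: fg; apply: ae_imply => x + _ /= => ->.
Qed.

Lemma summable_ge0P f : measurable_fun setT f -> (forall x, 0 <= f x) ->
  (\int[mu]_x (f x)%:E < +oo)%E -> summable f.
Proof.
move=> mf f0 fi; apply/integrableP; split; first exact/measurable_EFinP.
rewrite (_ : (fun x => _) = (fun x => (f x)%:E))//.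
by apply/funext => x /=; rewrite ger0_norm.
Qed.

Lemma dominated_total (f_ : nat -> R -> R) f g :
  (forall n, measurable_fun setT (f_ n)) -> summable g ->
  (forall n x, `|f_ n x| <= g x) ->
  {ae mu, forall x, f_ n x @[n --> \oo] --> f x} -> measurable_fun setT f ->
  total (f_ n) @[n --> \oo] --> total f.
Proof.
move=> mf_ sg dom cv mf.
have mEf_ n : measurable_fun setT (EFin \o f_ n) by exact/measurable_EFinP.
have mEf : measurable_fun setT (EFin \o f) by exact/measurable_EFinP.
have [] := @dominated_convergence _ _ R mu setT measurableT
   (fun n => EFin \o f_ n) (EFin \o f) (EFin \o g).
- exact: mEf_.
- exact: mEf.
- by move: cv; apply: ae_imply => x cvx _; apply: cvg_EFin => //; exact: nearW.
- exact: sg.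
- by apply: aeW => x n _ /=; rewrite lee_fin.
move=> sf _ cvi; apply: fine_cvg.
rewrite /Rintegral fineK; first exact: cvi.
exact: integrable_fin_num.
Qed.

Lemma measurable_affine a b : measurable_fun setT (fun x => a * x + b).
Proof. by apply: measurable_funD => //; exact: measurable_funM. Qed.

(** The pushforward scaled by [|a|] agrees with Lebesgue measure on half-open intervals, which
    determines it; the sign of [a] only decides which end of the preimage is closed. *)
Lemma lebesgue_measure_affine a b (A : set R) : a != 0 -> measurable A ->
  mu A = (`|a|%:E * mu ((fun x => a * x + b)%R @^-1` A))%E.
Proof.
move=> a0 mA.
pose phi : measurableTypeR R -> measurableTypeR R := fun x => a * x + b.
have mphi : measurable_fun setT phi by exact: measurable_affine.
pose m : {measure set (measurableTypeR R) -> \bar R} := mscale (NngNum (normr_ge0 a))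
  (measure_function_pushforward__canonical__measure_function_Measure mu mphi).
rewrite (@lebesgue_measure_unique _ m)// => X /ocitvP[->|[[c d] /= cd ->]].
  by rewrite !measure0.
rewrite lebesgue_measure_itv/= lte_fin cd.
rewrite /m /mscale/= /pushforward /phi.
have [a_gt0|a_lt0|/eqP] := ltgtP 0 a; last by rewrite eq_sym (negbTE a0).
  rewrite (_ : _ @^-1` _ = `](c - b) / a, (d - b) / a]%classic); last first.
    apply/seteqP; split=> x /=; rewrite !in_itv/= ltr_pdivrMr// ler_pdivlMr//;
      by rewrite ltrBlDr lerBrDr mulrC.
  rewrite lebesgue_measure_itv/= lte_fin ltr_pM2r ?invr_gt0// ltrD2r cd.
  rewrite -!EFinD -EFinM gtr0_norm//; congr EFin; by field.
rewrite (_ : _ @^-1` _ = `[(d - b) / a, (c - b) / a[%classic); last first.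
  apply/seteqP; split=> x /=; rewrite !in_itv/= ltr_ndivlMr// ler_ndivrMr// andbC;
    by rewrite ltrBlDr lerBrDr mulrC.
rewrite lebesgue_measure_itv/= lte_fin ltr_nM2r ?invr_lt0// ltrD2r cd.
rewrite -!EFinD -EFinM ltr0_norm//; congr EFin; by field.
Qed.

Lemma ge0_integral_affine a b (f : R -> \bar R) : a != 0 ->
  measurable_fun setT f -> (forall x, 0 <= f x)%E ->
  (\int[mu]_x f x = `|a|%:E * \int[mu]_x f (a * x + b)%R)%E.
Proof.
move=> a0 mf f0.
pose phi : measurableTypeR R -> measurableTypeR R := fun x => a * x + b.
have mphi : measurable_fun setT phi by exact: measurable_affine.
have := @ge0_integral_pushforward _ _ (measurableTypeR R) (measurableTypeR R) R phi mphi mu setT f measurableT mf.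
rewrite preimage_setT => /(_ (fun y _ => f0 y)) <-.
pose m1 : {measure set (measurableTypeR R) -> \bar R} :=
  measure_function_pushforward__canonical__measure_function_Measure mu mphi.
rewrite -[X in (_ * X)%E]/(\int[m1]_x f x)%E.
rewrite -[`|a|]/((NngNum (normr_ge0 a))%:num) -ge0_integral_mscale//.
apply: eq_measure_integral => A mA _.
exact: (lebesgue_measure_affine b a0 mA).
Qed.

Lemma summable_affine a b f : a != 0 -> summable f ->
  summable (fun x => f (a * x + b)).
Proof.
move=> a0 sf; have mf := summable_measurable sf.
have mfa : measurable_fun setT (fun x => f (a * x + b)).
  exact: (measurableT_comp mf (measurable_affine a b)).
apply/integrableP; split; first exact/measurable_EFinP.
have /integrableP[_] := sf.
rewrite (@ge0_integral_affine a b (fun x => `|f x|%:E))//; last first.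
  by apply/measurable_EFinP; exact: measurableT_comp.
rewrite muleC -lte_pdivlMr ?normr_gt0//.
by move=> /lt_le_trans; apply; rewrite leey.
Qed.

Lemma total_affine a b f : a != 0 -> summable f ->
  total (fun x => f (a * x + b)) = `|a|^-1 * total f.
Proof.
move=> a0 sf; have sfa := summable_affine b a0 sf.
have mf := summable_measurable sf.
have mfa := summable_measurable sfa.
apply: (@mulfI _ `|a|); first by rewrite normr_eq0.
rewrite mulVKf ?normr_eq0//.
apply: EFin_inj; rewrite EFinM (EFin_total sf) (EFin_total sfa).
rewrite [in LHS]integralE [in RHS]integralE.
rewrite [in RHS](@ge0_integral_affine a b)//; last first.
  by apply: measurable_funepos; exact/measurable_EFinP.
rewrite [X in _ = (_ - X)%E](@ge0_integral_affine a b)//; last first.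
  by apply: measurable_funeneg; exact/measurable_EFinP.
rewrite muleBr//.
  by congr (_ * _ - _ * _)%E; apply: eq_integral => x _; rewrite ?funeposE ?funenegE.
apply: fin_num_adde_defl; rewrite fin_numN.
exact: (integrable_neg_fin_num measurableT sfa).
Qed.

Lemma summable_shift b f : summable f -> summable (fun x => f (x + b)).
Proof.
move=> /(summable_affine b (oner_neq0 R)); apply: summable_ext => x.
by rewrite mul1r.
Qed.

Lemma total_shift b f : summable f -> total (fun x => f (x + b)) = total f.
Proof.
move=> sf; rewrite -[RHS]mul1r -[X in X * _]invr1 -[in RHS](normr1 R).
rewrite -(total_affine b (oner_neq0 R) sf).
by apply: total_ext => x; rewrite mul1r.
Qed.

Lemma summable_reflect b f : summable f -> summable (fun x => f (b - x)).
Proof.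
move=> sf.
have /(_ b) := @summable_affine (-1) _ f _ sf.
by rewrite oppr_eq0 oner_eq0 => /(_ isT); apply: summable_ext => x; rewrite mulN1r addrC.
Qed.

Lemma total_reflect b f : summable f -> total (fun x => f (b - x)) = total f.
Proof.
move=> sf; rewrite -[RHS]mul1r -[X in X * _]invr1 -[in RHS](normr1 R) -normrN.
rewrite -(total_affine b _ sf) ?oppr_eq0 ?oner_eq0//.
by apply: total_ext => x; rewrite mulN1r addrC.
Qed.

End lebesgue_integral_on_the_line.

(** * Fubini's theorem and integrability of power weights *)

Section fubini_and_power_weights.
Context {R : realType}.
Notation mu := (@lebesgue_measure R).
Implicit Types (a b c q r x y z t : R) (f g h F : R -> R).

(** The majorant [G] makes [F] integrable on the plane by Tonelli. In the other variable the slices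
    are summable only almost everywhere, and [total] may take its default value on the remaining
    ones, hence the comparison with [fubini_G] up to a null set. *)
Lemma fubini_total (F : R -> R -> R) (G : R -> R) :
  measurable_fun setT (fun p : R * R => F p.1 p.2) ->
  (forall x, summable (F x)) ->
  (forall x, total (fun y => `|F x y|) <= G x) -> summable G ->
  [/\ total (fun x => total (F x)) = total (fun y => total (F ^~ y)),
      summable (fun x => total (F x)),
      {ae mu, forall y, summable (F ^~ y)},
      summable (fun y => total (F ^~ y)) &
      measurable_fun setT (fun y => total (F ^~ y))].
Proof.
move=> mF sF FG sG.
pose f (p : R * R) := (F p.1 p.2)%:E.
have mf : measurable_fun setT f by exact/measurable_EFinP.
have intf : (mu \x mu)%E.-integrable setT f.
  apply/integrable12ltyP => //.
  rewrite (_ : (fun x => _) = fun x => (total (fun y => `|F x y|))%:E); last first.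
    by apply/funext => x; rewrite (EFin_total (summable_norm (sF x))).
  have /integrableP[_] := sG; apply: le_lt_trans.
  apply: ge0_le_integral => //=.
  - by move=> x _; rewrite lee_fin; exact: total_ge0.
  - rewrite (_ : (fun x => _) = fubini_F mu (abse \o f)); last first.
      by apply/funext => x; rewrite (EFin_total (summable_norm (sF x))).
    apply: measurable_fun_fubini_tonelli_F => //.
    have m' : measurable_fun setT (abse \o f) by exact: measurableT_comp.
      exact: m'.
    by move=> p; rewrite /= lee_fin.
  - have m' : measurable_fun setT (EFin \o (fun x => `|G x|)).
      by apply/measurable_EFinP/measurableT_comp => //; exact: summable_measurable sG.
    exact: m'.
  - by move=> x _; rewrite lee_fin (le_trans (FG x))// ler_norm.
have FE : fubini_F mu f = EFin \o (fun x => total (F x)).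
  by apply/funext => x; rewrite /fubini_F /f/= (EFin_total (sF x)).
have s1 : summable (fun x => total (F x)).
  by rewrite /summable -FE; exact: (integrable_fubini_F intf).
have ae2 : {ae mu, forall y, summable (F ^~ y)} by exact: ae_integrable2 intf.
have s2 : mu.-integrable setT (fubini_G mu f).
  pose f' (p : R * R) := (F p.2 p.1)%:E.
  have mf' : measurable_fun setT f' by exact: (measurableT_comp mf (@measurable_swap _ _ _ _)).
  have intf' : (mu \x mu)%E.-integrable setT f'.
    by apply/integrable21ltyP => //; move/integrable12ltyP : intf; exact.
  exact: (integrable_fubini_F intf').
have m2 : measurable_fun setT (fun y => total (F ^~ y)).
  have -> : (fun y => total (F ^~ y)) = fine \o fubini_G mu f by [].
  by apply: measurableT_comp => //; exact: measurable_int s2.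
have aeG : {ae mu, forall y, fubini_G mu f y = (total (F ^~ y))%:E}.
  by move: ae2; apply: ae_imply => y sy; rewrite (EFin_total sy).
have s2' : summable (fun y => total (F ^~ y)).
  apply/integrableP; split; first exact/measurable_EFinP.
  have /integrableP[m3] := s2; congr (_ < _)%E.
  apply: ae_eq_integral => //.
  - exact: measurableT_comp.
  - by apply: measurableT_comp => //; exact/measurable_EFinP.
  - by move: aeG; apply: ae_imply => y + _ /= => ->.
split; [|exact: s1|exact: ae2|exact: s2'|exact: m2].
apply: EFin_inj; rewrite (EFin_total s1) (EFin_total s2').
have -> : (\int[mu]_x (total (F x))%:E = \int[mu]_x fubini_F mu f x)%E by rewrite FE.
apply: (etrans (etrans (integral12_prod_meas1 intf) (esym (integral21_prod_meas1 intf)))).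
apply: ae_eq_integral => //; first exact: measurable_int s2.
  exact/measurable_EFinP.
by move: aeG; apply: ae_imply => y + _.
Qed.

Lemma summable_bigcup (D : nat -> set R) f c : nondecreasing_seq D ->
  (forall n, measurable (D n)) -> measurable_fun setT f -> (forall x, 0 <= f x) ->
  (forall n, (\int[mu]_(x in D n) (f x)%:E <= c%:E)%E) ->
  summable (f \_ (\bigcup_n D n)).
Proof.
move=> ndD mD mf f0 fc.
have mU : measurable (\bigcup_n D n) by exact: bigcup_measurable.
apply: summable_ge0P.
- by apply/(measurable_restrictT _ _).1 => //; exact: measurable_funTS.
- by move=> x; rewrite patchE; case: ifP.
rewrite (_ : (fun x => _) = (EFin \o f) \_ (\bigcup_n D n)); last first.
  by rewrite restrict_EFin.
rewrite -integral_mkcond.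
have cv : (\int[mu]_(x in D n) (f x)%:E)%E @[n --> \oo] -->
    (\int[mu]_(x in \bigcup_n D n) (f x)%:E)%E.
  apply: ge0_nondecreasing_set_cvg_integral => //.
  - by move=> n; apply/measurable_EFinP; exact: measurable_funTS.
  - by move=> n x _; rewrite lee_fin.
rewrite -(cvg_lim _ cv)//; apply: (@le_lt_trans _ _ c%:E); last exact: ltry.
by apply: lime_le; [apply/cvg_ex; eexists; exact: cv|exact: nearW].
Qed.

Lemma is_derive_continuous x f c : is_derive x 1 f c -> {for x, continuous f}.
Proof. by case=> d _; exact/differentiable_continuous/derivable1_diffP. Qed.

Lemma integral_segment_derivative a b f F : a < b ->
  (forall x, x \in `[a, b] -> is_derive x 1 F (f x)) ->
  (forall x, x \in `[a, b] -> {for x, continuous f}) ->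
  (\int[mu]_(x in `[a, b]) (f x)%:E = (F b - F a)%:E)%E.
Proof.
move=> ab dF cf.
have cF x : x \in `[a, b] -> {for x, continuous F}.
  by move=> /dF; exact: is_derive_continuous.
rewrite EFinB; apply: continuous_FTC2 => //.
- by apply: continuous_in_subspaceT => x; rewrite inE; exact: cf.
- split.
  + by move=> x xab; have [] := dF x (subset_itv_oo_cc xab).
  + by apply: cvg_at_right_filter; apply: cF; rewrite in_itv/= lexx ltW.
  + by apply: cvg_at_left_filter; apply: cF; rewrite in_itv/= lexx ltW.
- move=> x xab; rewrite derive1E.
  by have := dF x (subset_itv_oo_cc xab) => ?; rewrite derive_val.
Qed.

(** The power weights below have explicit antiderivatives on a half-line; evenness transports
    summability to the other half. *)
Lemma summable_even_half (D : set R) f : measurable_fun setT f ->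
  (forall x, 0 <= f x) -> f =1 f \o -%R ->
  summable (f \_ D) -> summable (fun x => if (x \in D) || (- x \in D) then f x else 0).
Proof.
move=> mf f0 ef sf.
have pE x : (f \_ D) x = if x \in D then f x else 0 by rewrite patchE.
have s2 : summable (fun x => (f \_ D) x + (f \_ D) (0 - x)).
  by apply: summableD => //; exact: summable_reflect.
apply: (summable_le_norm _ s2); last first.
  move=> x; rewrite !pE sub0r -[f (- x)]/((f \o -%R) x) -ef.
  have f1 : 0 <= if - x \in D then f x else 0 by case: ifP.
  have f2 : 0 <= if x \in D then f x else 0 by case: ifP.
  rewrite (ger0_norm (addr_ge0 f2 f1)).
  case: ifPn => [|_]; last by rewrite normr0 addr_ge0.
  by rewrite ger0_norm// => /orP[] xD; rewrite [in leRHS]xD ?lerDl ?lerDr.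
pose g x := Num.max ((f \_ D) x) ((f \_ D) (0 - x)).
have -> : (fun x => if (x \in D) || (- x \in D) then f x else 0) = g.
  apply/funext => x; rewrite /g !pE sub0r -[f (- x)]/((f \o -%R) x) -ef.
  by case: (x \in D); case: (- x \in D) => /=; rewrite ?maxxx ?(max_idPl (f0 x)) ?(max_idPr (f0 x)).
apply: measurable_maxr; first exact: summable_measurable sf.
exact: summable_measurable (summable_reflect 0 sf).
Qed.

Lemma measurable_powR_norm q : measurable_fun setT (fun x : R => `|x| `^ q).
Proof.
by apply: (measurableT_comp (measurable_powR q)); exact: normr_measurable.
Qed.

Lemma measurable_weight q : measurable_fun setT (fun x : R => (1 + `|x|) `^ q).
Proof.
apply: (measurableT_comp (measurable_powR q)).
by apply: measurable_funD => //; exact: normr_measurable.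
Qed.

Lemma summable_weight q : 1 < q -> summable (fun x => (1 + `|x|) `^ (- q)).
Proof.
move=> q1.
pose f x := (1 + `|x|) `^ (- q).
pose D n := `[0, n%:R]%classic : set R.
have mf : measurable_fun setT f by exact: measurable_weight.
have s : summable (f \_ (\bigcup_n D n)).
  apply: (@summable_bigcup _ _ (q - 1)^-1) => //.
  - move=> m n mn; apply/subsetPset => x; rewrite /D/= !in_itv/= => /andP[-> xm]/=.
    by rewrite (le_trans xm)// ler_nat.
  - by move=> n; exact: measurable_itv.
  - by move=> x; exact: powR_ge0.
  case=> [|n].
    rewrite /D set_itv1 integral_set1 lee_fin invr_ge0 subr_ge0; exact: ltW.
  rewrite (_ : \int[mu]_(x in D n.+1) (f x)%:E =
     \int[mu]_(x in `[0%R, n.+1%:R]) ((1 + x) `^ (- q))%:E)%E; last first.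
    apply: eq_integral => x; rewrite inE /D/= in_itv/= => /andP[x0 _].
    by rewrite /f ger0_norm.
  pose F x : R := (1 + x) `^ (1 - q) / (1 - q).
  have -> : (\int[mu]_(x in `[0%R, n.+1%:R]) ((1 + x) `^ (- q))%:E =
      (F n.+1%:R - F 0)%:E)%E.
    apply: integral_segment_derivative.
  - by rewrite ltr0n.
  - move=> x; rewrite in_itv/= => /andP[x0 _].
    have x1 : 0 < 1 + x by rewrite ltr_wpDr.
    have -> : (1 + x) `^ (- q) = (1 - q) * (1 + x) `^ (1 - q - 1) * 1 * (1 - q)^-1.
      rewrite (_ : 1 - q - 1 = - q); last by ring.
      by field; rewrite subr_eq0 lt_eqF.
    have d1 : is_derive x 1 (fun x => 1 + x) 1 by apply: is_derive_eq; ring.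
    have d2 := is_derive1_comp (is_derive1_powR (1 - q) x1) d1.
    have -> : F =
       (1 - q)^-1 \*: ((powR (R:=R))^~ (1 - q) \o (fun x => 1 + x)).
      by apply/funext => y /=; rewrite [LHS]mulrC.
    by apply: is_derive_eq; rewrite [LHS]mulrC.
  - move=> x; rewrite in_itv/= => /andP[x0 _].
    have x1 : 0 < 1 + x by rewrite ltr_wpDr.
    have d1 : is_derive x 1 (fun x => 1 + x) 1 by apply: is_derive_eq; ring.
    exact: (is_derive_continuous (is_derive1_comp (is_derive1_powR (- q) x1) d1)).
  rewrite /F lee_fin addr0 powR1 mul1r lerBlDl.
  have -> : (q - 1)^-1 = - (1 - q)^-1 by rewrite -[1 - q]opprB invrN opprK.
  by rewrite subrr mulr_ge0_le0 ?powR_ge0// invr_le0 subr_le0 ltW.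
have := @summable_even_half _ f mf _ _ s.
move=> /(_ (fun x => powR_ge0 _ _)) /(_ _)/summable_ext.
apply; last by move=> x; rewrite /f/= normrN.
move=> x /=; case: ifPn => //; rewrite negb_or => /andP[]; rewrite !notin_setE => n1 n2.
exfalso; have [x0|x0] := leP 0 x.
- apply: n1; exists (Num.truncn x).+1 => //; rewrite /D/= in_itv/= x0/=.
  by rewrite ltW// truncnS_gt.
- apply: n2; exists (Num.truncn (- x)).+1 => //; rewrite /D/= in_itv/=.
  by rewrite oppr_ge0 (ltW x0)/= ltW// truncnS_gt.
Qed.

Lemma summable_singularity b : 0 < b -> b < 1 ->
  summable (fun x => if `|x| <= 1 then `|x| `^ (- b) else 0).
Proof.
move=> b0 b1.
pose f x := `|x| `^ (- b).
(* Starting from [n.+2] keeps every interval nondegenerate, as integrating a derivative over it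
   requires. *)
pose D n := `[n.+2%:R^-1, 1]%classic : set R.
have mf : measurable_fun setT f by exact: measurable_powR_norm.
have s : summable (f \_ (\bigcup_n D n)).
  apply: (@summable_bigcup _ _ (1 - b)^-1) => //.
  - move=> m n mn; apply/subsetPset => x; rewrite /D/= !in_itv/= => /andP[xm ->].
    by rewrite (le_trans _ xm)// lef_pV2 ?posrE// ler_nat !ltnS.
  - by move=> n; exact: measurable_itv.
  - by move=> x; exact: powR_ge0.
  move=> n.
  have n0 : 0 < n.+2%:R^-1 :> R by rewrite invr_gt0.
  rewrite (_ : \int[mu]_(x in D n) (f x)%:E =
     \int[mu]_(x in `[n.+2%:R^-1%R, 1%R]) (x `^ (- b))%:E)%E; last first.
    apply: eq_integral => x; rewrite inE /D/= in_itv/= => /andP[x0 _].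
    by rewrite /f ger0_norm// (le_trans _ x0)// ltW.
  pose F x : R := x `^ (1 - b) / (1 - b).
  have -> : (\int[mu]_(x in `[n.+2%:R^-1%R, 1%R]) (x `^ (- b))%:E =
      (F 1 - F n.+2%:R^-1)%:E)%E.
    apply: integral_segment_derivative.
  - by rewrite invf_lt1// ltr1n.
  - move=> x; rewrite in_itv/= => /andP[x0 _].
    have x1 : 0 < x by exact: lt_le_trans x0.
    have d2 := is_derive1_powR (1 - b) x1.
    have -> : F =
       (1 - b)^-1 \*: ((powR (R:=R))^~ (1 - b)).
      by apply/funext => y /=; rewrite [LHS]mulrC.
    apply: is_derive_eq.
    rewrite (_ : 1 - b - 1 = - b); last by ring.
    by rewrite /GRing.scale/= mulKf// subr_eq0 gt_eqF.
  - move=> x; rewrite in_itv/= => /andP[x0 _].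
    have x1 : 0 < x by exact: lt_le_trans x0.
    exact: (is_derive_continuous (is_derive1_powR (- b) x1)).
  by rewrite /F lee_fin powR1 mul1r gerBl divr_ge0 ?powR_ge0// subr_ge0 ltW.
have := @summable_even_half _ f mf _ _ s.
move=> /(_ (fun x => powR_ge0 _ _)) /(_ _)/summable_ext.
apply; last by move=> x; rewrite /f/= normrN.
have DE x : 0 < x -> x <= 1 -> (\bigcup_n D n) x.
  move=> x0 x1; exists (Num.truncn x^-1) => //; rewrite /D/= in_itv/= x1 andbT.
  rewrite invf_ple ?posrE// ltW// (lt_le_trans (truncnS_gt _))//.
  by rewrite ler_nat.
have DE' x : (\bigcup_n D n) x -> 0 < x /\ x <= 1.
  move=> [n _]; rewrite /D/= in_itv/= => /andP[nx x1]; split => //.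
  by rewrite (lt_le_trans _ nx)// invr_gt0.
move=> x /=; case: ifPn => [/orP[|]|].
- by rewrite inE => /DE'[x0 x1]; rewrite gtr0_norm// x1 /f gtr0_norm.
- rewrite inE => /DE'[]; rewrite oppr_gt0 => x0 x1.
  by rewrite ltr0_norm// x1 /f ltr0_norm.
rewrite negb_or => /andP[]; rewrite !notin_setE => n1 n2; case: ifPn => // x1.
have [x0|x0|<-] := ltgtP 0 x.
- by exfalso; apply: n1; apply: DE => //; rewrite -(gtr0_norm x0).
- exfalso; apply: n2; apply: DE; first by rewrite oppr_gt0.
  by rewrite -ltr0_norm.
(* At the origin both sides vanish: 0 raised to a nonzero power is 0 by convention, even for a
   negative exponent. *)
- by rewrite normr0 powR0// oppr_eq0 gt_eqF.
Qed.

End fubini_and_power_weights.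

(** * Power kernels and fractional differences *)

Section power_kernels.
Context {R : realType}.
Implicit Types (a b c q r x y z t h : R) (f g F : R -> R).

Lemma is_derive_near f g x c : (\forall y \near x, f y = g y) ->
  is_derive x 1 f c -> is_derive x 1 g c.
Proof.
move=> fg [df dfE].
split; first exact: near_eq_derivable fg df.
by rewrite -(near_eq_derive _ fg).
Qed.

Lemma is_derive_quotient f x c :
  h^-1 * (f (h + x) - f x) @[h --> 0^'] --> c -> is_derive x 1 f c.
Proof.
move=> fc.
have E : (fun h : R => h^-1 *: (f (h *: (1 : R) + x) - f x)) =
    (fun h => h^-1 * (f (h + x) - f x)).
  by apply/funext => h; rewrite /GRing.scale/= mulr1.
apply: DeriveDef; first by apply/cvg_ex; exists c; rewrite /= E.
by rewrite /derive E; exact: cvg_lim fc.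
Qed.

Lemma powRD_gt0 x a b : 0 < x -> x `^ (a + b) = x `^ a * x `^ b.
Proof. by move=> x0; rewrite powRD// (gt_eqF x0) implybT. Qed.

(** A number [t] in []0, 1]] satisfies [t <= t^a]; this is applied to the shares [x / (x + y)] and
    [y / (x + y)], which add up to 1. *)
Lemma powR_subadditive a x y : 0 < a -> a <= 1 -> 0 <= x -> 0 <= y ->
  (x + y) `^ a <= x `^ a + y `^ a.
Proof.
move=> a0 a1; rewrite le_eqVlt => /predU1P[<- y0|x0].
  by rewrite add0r powR0 ?gt_eqF// add0r.
rewrite le_eqVlt => /predU1P[<-|y0].
  by rewrite addr0 powR0 ?gt_eqF// addr0.
have xy0 : 0 < x + y by exact: addr_gt0.
have part z : 0 < z -> z <= x + y -> z / (x + y) * (x + y) `^ a <= z `^ a.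
  move=> z0 zxy; have zq : 0 < z / (x + y) <= 1.
    by rewrite divr_gt0//= ler_pdivrMr// mul1r.
  rewrite -[in leRHS](divfK (lt0r_neq0 xy0) z) (@powRM _ (z / (x + y))); [|by case/andP: zq => /ltW|exact: ltW].
  by rewrite ler_wpM2r ?powR_ge0// ger1_powR.
rewrite -[leLHS]mul1r -(divff (lt0r_neq0 xy0)) mulrDl mulrDl.
by apply: lerD; apply: part => //; rewrite ?lerDl ?lerDr ltW.
Qed.

Lemma holder_powR_norm a x y : 0 < a -> a <= 1 ->
  `| `|x| `^ a - `|y| `^ a | <= `|x - y| `^ a.
Proof.
move=> a0 a1; have half (u v : R) : `|u| `^ a - `|v| `^ a <= `|u - v| `^ a.
  rewrite lerBlDr (le_trans _ (powR_subadditive a0 a1 (normr_ge0 _) (normr_ge0 _)))//.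
  rewrite ge0_ler_powR ?nnegrE ?addr_ge0//; first exact: ltW.
  by rewrite -{1}(subrK v u) ler_normD.
by rewrite ler_norml half andbT lerNl opprB distrC half.
Qed.

(** By homogeneity this is [|q^a - 1| <= |q - 1|] for [q = |z + h| / |z|], and [q^a] lies between
    [q] and 1. Since [h] is arbitrary, the singularity may lie between [z] and [z + h]; the estimate
    thus dominates difference quotients of any step. *)
Lemma lipschitz_powR_norm a z h : 0 < a -> a <= 1 -> z != 0 ->
  `| `|z + h| `^ a - `|z| `^ a | <= `|h| * `|z| `^ (a - 1).
Proof.
move=> a0 a1 z0; have nz : 0 < `|z| by rewrite normr_gt0.
have key q : 0 <= q -> `|q `^ a - 1| <= `|q - 1|.
  rewrite le_eqVlt => /predU1P[<-|q0].
    by rewrite powR0 ?gt_eqF// lexx.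
  have [q1|/ltW q1] := leP q 1.
    rewrite !ler0_norm ?subr_le0// ?opprB ?lerB// ?ger1_powR ?q0//.
    by rewrite -(powRr0 q) ger_powR ?q0//= ltW.
  rewrite !ger0_norm ?subr_ge0// ?lerB ?ler1_powR//.
  by rewrite -(powRr0 q) ler_powR// ltW.
pose q := `|z + h| / `|z|.
have zhE : `|z + h| = q * `|z| by rewrite divfK ?gt_eqF.
have q0 : 0 <= q by rewrite divr_ge0.
rewrite zhE powRM// -[X in _ - X]mul1r -mulrBl normrM (ger0_norm (powR_ge0 _ _)).
have -> : `|z| `^ a = `|z| * `|z| `^ (a - 1).
  by rewrite mulrC -[X in _ * X](powRr1 (ltW nz)) -powRD ?subrK// gt_eqF ?implybT.
rewrite mulrA ler_wpM2r ?powR_ge0//.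
rewrite (le_trans (ler_wpM2r (ltW nz) (key _ q0)))//.
rewrite -[X in _ * X](ger0_norm (ltW nz)) -normrM mulrBl mul1r -zhE.
by rewrite (le_trans (ler_dist_dist _ _))// addrC addKr.
Qed.

Lemma is_derive_powR_norm b x : x != 0 ->
  is_derive x 1 (fun y => `|y| `^ b) (b * (x * `|x| `^ (b - 2))).
Proof.
move=> x0; have [xn|xp|/eqP] := ltgtP x 0; last by rewrite (negbTE x0).
- have dN : is_derive x 1 (fun y => - y) (-1 : R) by apply: is_derive_eq.
  have nx : 0 < - x by rewrite oppr_gt0.
  have := is_derive1_comp (is_derive1_powR b nx) dN.
  have -> : b * (- x) `^ (b - 1) * -1 = b * (x * `|x| `^ (b - 2)).
    rewrite ltr0_norm// (_ : b - 1 = 1 + (b - 2)); last by ring.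
    by rewrite (powRD_gt0 1 (b - 2) nx) powRr1 ?(ltW nx)//; ring.
  apply: is_derive_near; near=> y; rewrite /= ltr0_norm//.
  by near: y; exact: lt_nbhsl.
- have := is_derive1_powR b xp.
  have -> : b * x `^ (b - 1) = b * (x * `|x| `^ (b - 2)).
    rewrite gtr0_norm// (_ : b - 1 = 1 + (b - 2)); last by ring.
    by rewrite (powRD_gt0 1 (b - 2) xp) powRr1 ?(ltW xp)//; ring.
  apply: is_derive_near; near=> y; rewrite /= gtr0_norm//.
  by near: y; exact: lt_nbhsr.
Unshelve. all: end_near. Qed.

Lemma continuous_powR_norm a : 0 < a -> continuous (fun y => `|y| `^ a).
Proof.
move=> a0 x; have [->|x0] := eqVneq x 0; last first.
  exact: (is_derive_continuous (is_derive_powR_norm a x0)).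
apply/cvgrPdist_lt => e e0; rewrite normr0 powR0 ?gt_eqF//.
near=> y; rewrite sub0r normrN ger0_norm ?powR_ge0//.
have -> : e = (e `^ a^-1) `^ a by rewrite -powRrM mulVf ?gt_eqF// powRr1// ltW.
rewrite gt0_ltr_powR ?nnegrE ?powR_ge0//.
near: y; exact: (@nbhs0_lt _ R^o _ (powR_gt0 _ e0)).
Unshelve. all: end_near. Qed.

(** The primitive is preferred to [|x|^a] itself, whose weighted second difference at 0 is
    [-2 |t|^(-2)]: the cusp makes the fractional difference diverge there. *)
Definition primitive_power a x := x * `|x| `^ a / (1 + a).

Lemma is_derive_primitive_power a x : 0 < a ->
  is_derive x 1 (primitive_power a) (`|x| `^ a).
Proof.
move=> a0; have a1 : 1 + a != 0 by rewrite gt_eqF// addr_gt0.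
have [->|x0] := eqVneq x 0; last first.
  have d := is_derive_powR_norm a x0.
  have -> : primitive_power a = (1 + a)^-1 \*: (id * (fun y : R => `|y| `^ a)).
    by apply/funext => y; rewrite /primitive_power mulrC.
  have nx : 0 < `|x| by rewrite normr_gt0.
  have e : `|x| `^ a = `|x| ^+ 2 * `|x| `^ (a - 2).
    by rewrite mulrC -powR_mulrn ?ltW// -powRD ?subrK// gt_eqF ?implybT.
  apply: is_derive_eq; rewrite /GRing.scale/=.
  have -> : x * (a * (x * `|x| `^ (a - 2))) = a * (`|x| ^+ 2 * `|x| `^ (a - 2)).
    by rewrite real_normK ?num_real//; ring.
  by rewrite -e; field.
apply: is_derive_quotient; rewrite normr0 powR0 ?gt_eqF//.
have c : (fun h : R => (1 + a)^-1 * `|h| `^ a) @ 0 --> (1 + a)^-1 * `|0 : R| `^ a.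
  by apply: cvgM; [exact: cvg_cst|exact: continuous_powR_norm].
rewrite normr0 powR0 ?gt_eqF// mulr0 in c.
have {}c : (fun h : R => (1 + a)^-1 * `|h| `^ a) @ (0 : R)^' --> (0 : R).
  exact: cvg_within_filter c.
apply: cvg_trans c; apply: near_eq_cvg; near=> h.
have h0 : h != 0 by near: h; exact: nbhs_dnbhs_neq.
by rewrite /primitive_power addr0 mul0r mul0r subr0 -mulrA mulKf// mulrC.
Unshelve. all: end_near. Qed.

Lemma primitive_power_odd a x : primitive_power a (- x) = - primitive_power a x.
Proof. by rewrite /primitive_power normrN !mulNr. Qed.

Lemma primitive_power_scale a x y : primitive_power a (x * y) =
  x * `|x| `^ a * primitive_power a y.
Proof. by rewrite /primitive_power normrM powRM// ; ring. Qed.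

(** The sign is opposite to that of the usual second difference, in accordance with the sign of the
    fractional Laplacian. *)
Definition diff2 f x t := 2 * f x - f (x + t) - f (x - t).

Lemma diff2_even f x t : diff2 f x (- t) = diff2 f x t.
Proof. by rewrite /diff2 opprK addrAC. Qed.

Lemma diff2_bound f F x t c :
  (forall y, `|y - x| <= `|t| -> is_derive y 1 f (F y)) ->
  (forall y, `|y - x| <= `|t| -> `|F y - F (2 * x - y)| <= c * `|y - x|) ->
  `|diff2 f x t| <= c * t ^+ 2.
Proof.
wlog t0 : t / 0 <= t => [hw|].
  have [t0|/ltW t0] := leP 0 t; first exact: hw.
  by move=> h1 h2; rewrite -diff2_even -sqrrN; apply: hw; rewrite ?oppr_ge0 ?normrN.
rewrite (ger0_norm t0) => dF cF.
move: t0; rewrite le_eqVlt => /predU1P[<-|t0].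
  by rewrite /diff2 addr0 subr0 expr0n/= mulr0 (_ : 2 * f x - f x - f x = 0) ?normr0//; ring.
pose g t := diff2 f x t.
have dg u : u \in `[0, t] -> is_derive u 1 g (- (F (x + u) - F (x - u))).
  rewrite in_itv/= => /andP[u0 ut].
  have d1 : is_derive (x + u) 1 f (F (x + u)).
    by apply: dF; rewrite addrC addKr ger0_norm.
  have d2 : is_derive (x - u) 1 f (F (x - u)).
    by apply: dF; rewrite addrC addKr normrN ger0_norm.
  have e1 : is_derive u 1 (fun v => x + v) (1 : R) by apply: is_derive_eq; ring.
  have e2 : is_derive u 1 (fun v => x - v) (-1 : R) by apply: is_derive_eq; rewrite /GRing.scale/=; ring.
  have c1 := is_derive1_comp (g := fun v => x + v) d1 e1.
  have c2 := is_derive1_comp (g := fun v => x - v) d2 e2.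
  have -> : g = (fun v => 2 * f x - (f \o (fun v => x + v)) v - (f \o (fun v => x - v)) v) by [].
  by apply: is_derive_eq; ring.
have cg : {within `[0, t], continuous g}.
  apply: continuous_in_subspaceT => u; rewrite inE => ut.
  exact: is_derive_continuous (dg _ ut).
have [u ut] := MVT t0 (fun u ut => dg u (subset_itv_oo_cc ut)) cg.
have -> : g 0 = 0 by rewrite /g /diff2 addr0 subr0; ring.
rewrite subr0 /g => ->; move: ut; rewrite in_itv/= => /andP[u0 ut].
rewrite subr0 normrM normrN (gtr0_norm t0).
have := cF (x + u); rewrite addrC addKr gtr0_norm// => /(_ (ltW ut)).
have -> : 2 * x - (x + u) = x - u by ring.
move=> h.
have c0 : 0 <= c * u by exact: le_trans h.
have {c0} c0 : 0 <= c by rewrite pmulr_lge0 in c0.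
rewrite expr2 mulrA ler_wpM2r ?(ltW t0)// (le_trans h)//.
by apply: ler_wpM2l => //; exact: ltW.
Qed.

(** The primitive grows like [|t|^(1 + a)], too fast for the weight [|t|^(-(2 + a))]. Being odd, it
    contributes [J (t + 1) - J (t - 1)], which the mean value theorem bounds by [4 t^a] for [t > 1];
    the remaining [2 J 1 <= 2 <= 2 t^a] brings the constant to 6. *)
Lemma diff2_primitive_power a t : 0 < a -> a <= 1 ->
  `|diff2 (primitive_power a) 1 t| <= if `|t| <= 1 then 2 * t ^+ 2 else 6 * `|t| `^ a.
Proof.
move=> a0 a1.
have dJ x := is_derive_primitive_power x a0.
case: ifPn => t1.
  apply: (diff2_bound (F := fun x => `|x| `^ a)) => y _.
  have e : `|(`|1 + (y - 1)| `^ a - `|1 : R| `^ a)| <= `|y - 1| * `|1| `^ (a - 1).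
    by apply: lipschitz_powR_norm => //; exact: oner_neq0.
  have e' : `|(`|1 + (1 - y)| `^ a - `|1 : R| `^ a)| <= `|1 - y| * `|1| `^ (a - 1).
    by apply: lipschitz_powR_norm => //; exact: oner_neq0.
  rewrite normr1 !powR1 !mulr1 (addrC 1) subrK in e.
  rewrite normr1 !powR1 !mulr1 (_ : 1 + (1 - y) = 2 * 1 - y) in e'; last by ring.
  have -> : `|y| `^ a - `|2 * 1 - y| `^ a = (`|y| `^ a - 1) - (`|2 * 1 - y| `^ a - 1) by ring.
  rewrite (le_trans (ler_normB _ _))// (le_trans (lerD e e'))//.
  by rewrite [`|1 - y|]distrC mulr_natl mulr2n.
rewrite -ltNge in t1.
wlog t0 : t t1 / 0 <= t => [hw|].
  have [t0|/ltW t0] := leP 0 t; first exact: hw.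
  by rewrite -diff2_even -[`|t|]normrN; apply: hw; rewrite ?normrN ?oppr_ge0.
move: t1; rewrite (ger0_norm t0) => t1.
have -> : diff2 (primitive_power a) 1 t = 2 * primitive_power a 1 -
    (primitive_power a (t + 1) - primitive_power a (t - 1)).
  by rewrite /diff2 -[1 - t]opprB primitive_power_odd [1 + t]addrC; ring.
have cJ : {within `[(t - 1), (t + 1)], continuous (primitive_power a)}.
  apply: continuous_in_subspaceT => u _; exact: is_derive_continuous (dJ u).
have tt : t - 1 < t + 1 by rewrite ltrBlDr -addrA ltrDl.
have [u ut ->] := MVT tt (fun u _ => dJ u) cJ.
move: ut; rewrite in_itv/= => /andP[u1 u2].
have u0 : 0 < u by rewrite (le_lt_trans _ u1)// subr_ge0 ltW.
have ua : u `^ a <= 2 * t `^ a.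
  rewrite (@le_trans _ _ ((t + 1) `^ a))//.
    by rewrite ge0_ler_powR ?nnegrE ?(ltW a0) ?(ltW u0) ?(ltW u2)// addr_ge0// ltW.
  rewrite (le_trans (powR_subadditive a0 a1 t0 ler01))// powR1 mulr_natl mulr2n lerD2l.
  by rewrite -(powRr0 t) ler_powR ?(ltW t1) ?(ltW a0).
have ta : 1 <= t `^ a by rewrite -(powRr0 t) ler_powR ?(ltW t1) ?(ltW a0).
have J1 : 0 <= primitive_power a 1 <= 1.
  rewrite /primitive_power normr1 powR1 !mul1r invr_ge0 addr_ge0 ?(ltW a0)//=.
  by rewrite invf_le1 ?addr_gt0// lerDl ltW.
move: J1 => /andP[J0 J1].
rewrite (gtr0_norm u0) (_ : t + 1 - (t - 1) = 2); last by ring.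
have := powR_ge0 u a.
rewrite ler_norml; lra.
Qed.

End power_kernels.

(** * Continuity and differentiation under the integral sign *)

Section parameter_integrals.
Context {R : realType}.
Notation mu := (@lebesgue_measure R).
Implicit Types (a b c q r x y z t h : R) (f g : R -> R) (F dF : R -> R -> R).

Let in_ball_itv x y : y \in `](x - 1), (x + 1)[ -> `|y - x| < 1.
Proof. by rewrite in_itv/= ltr_distl. Qed.

Let mem_ball_itv x : x \in `](x - 1), (x + 1)[.
Proof. by rewrite in_itv/= ltrBlDr !ltrDl ltr01. Qed.

Lemma continuous_total F : (forall x, measurable_fun setT (F x)) ->
  (forall y, continuous (F ^~ y)) ->
  (forall x, exists2 g, summable g &
     forall z y, `|z - x| < 1 -> `|F z y| <= g y) ->
  continuous (fun x => total (F x)).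
Proof.
move=> mF cF dom x; have [g sg Fg] := dom x.
have := @continuity_under_integral R _ _ mu F setT measurableT (x - 1) (x + 1).
apply; [| | exact: sg| |by rewrite inE; exact: mem_ball_itv].
- move=> z /= /in_ball_itv zx; apply: (summable_le (mF z) sg) => y; exact: Fg.
- by apply: aeW => y _ z _; exact: cF.
- by move=> z /in_ball_itv zx; apply: aeW => y _; exact: Fg.
Qed.

Lemma is_derive_total F dF x : (forall x, summable (F x)) ->
  (forall x y, is_derive x 1 (F ^~ y) (dF x y)) ->
  (exists2 g, summable g & forall z y, `|z - x| < 1 -> `|dF z y| <= g y) ->
  is_derive x 1 (fun x => total (F x)) (total (dF x)).
Proof.
move=> sF dF' [g sg dFg].
have dE z y : partial1of2 F z y = dF z y.
  by rewrite partial1of2E; have := dF' z y => ?; rewrite derive_val.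
have g0 y : 0 <= g y by rewrite (le_trans _ (dFg x y _))// subrr normr0.
have P := @derivable_under_integral R _ _ mu F setT measurableT x (x - 1) (x + 1)
  (mem_ball_itv x) (fun z _ => sF z).
have Q := @differentiation_under_integral R _ _ mu F setT measurableT x (x - 1) (x + 1)
  (mem_ball_itv x) (fun z _ => sF z).
have H1 : forall z y, [set` `](x - 1), (x + 1)[] z -> setT y -> derivable (F ^~ y) z 1.
  by move=> z y _ _; have [] := dF' z y.
have H2 : forall z y, [set` `](x - 1), (x + 1)[] z -> setT y -> `|partial1of2 F z y| <= g y.
  by move=> z y /= /in_ball_itv zx _; rewrite dE; exact: dFg.
apply: DeriveDef; first exact: (P H1 g g0 sg H2).
rewrite -derive1E (Q H1 g g0 sg H2).
by apply: eq_Rintegral => y _; exact: dE.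
Qed.

End parameter_integrals.

(** * The principal value as an integral of second differences *)

Section fractional_difference.
Context {R : realType}.
Notation mu := (@lebesgue_measure R).
Implicit Types (a b c p q r x y z t h : R) (f g : R -> R).

(** Common integrable majorant. The exponent -2 at infinity, instead of [-(2 + a)], leaves room for
    second differences growing like [|t|^a]. *)
Definition singular_weight a t := if `|t| <= 1 then `|t| `^ (- a) else `|t| `^ (- 2).

Lemma singular_weight_ge0 a t : 0 <= singular_weight a t.
Proof. by rewrite /singular_weight; case: ifP => _; exact: powR_ge0. Qed.

Lemma summable_singular_weight a : 0 < a -> a < 1 -> summable (singular_weight a).
Proof.
move=> a0 a1.
have s := summableD (summable_singularity a0 a1)
  (summableZ 4 (@summable_weight R 2 (ltr1n _ 2))).
apply: (summable_le_norm _ s).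
  apply: measurable_fun_ifT; [|exact: measurable_powR_norm..].
  by apply: measurable_fun_ler => //; exact: normr_measurable.
move=> t; rewrite ger0_norm ?singular_weight_ge0// [leRHS]ger0_norm; last first.
  by rewrite addr_ge0 ?mulr_ge0 ?powR_ge0//; case: ifP => // _; exact: powR_ge0.
rewrite /singular_weight; case: ifPn => t1; first by rewrite lerDl mulr_ge0// powR_ge0.
rewrite -ltNge in t1; rewrite add0r.
have t0 : 0 < `|t| by rewrite (lt_trans _ t1).
rewrite !powRN !powR_mulrn ?addr_ge0// ler_pdivlMr ?exprn_gt0 ?addr_gt0//.
rewrite mulrC ler_pdivrMr ?exprn_gt0//.
rewrite (_ : 4 * _ = (2 * `|t|) ^+ 2); last by ring.
by rewrite lerXn2r ?nnegrE ?addr_ge0 ?mulr_ge0// mulr_natl mulr2n lerD2r ltW.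
Qed.

Lemma min_sqr_singular_weight a t : 0 < a ->
  Num.min 1 (t ^+ 2) * `|t| `^ (- (2 + a)) <= singular_weight a t.
Proof.
move=> a0; rewrite /singular_weight.
have [->|t0] := eqVneq t 0.
  by rewrite normr0 [X in _ * X]powR0 ?mulr0 ?ler01 ?powR_ge0// oppr_eq0 gt_eqF// addr_gt0.
have nt : 0 < `|t| by rewrite normr_gt0.
case: ifPn => t1.
  rewrite (_ : - (2 + a) = - 2 + - a); last by ring.
  rewrite powRD_gt0// mulrA -[leRHS]mul1r ler_wpM2r ?powR_ge0//.
  rewrite powRN powR_mulrn// real_normK ?num_real//.
  rewrite ler_pdivrMr; first by rewrite mul1r ge_min lexx orbT.
  by rewrite exprn_even_gt0.
rewrite -ltNge in t1.
rewrite -[leRHS]mul1r ler_pM ?powR_ge0 ?ge_min ?lexx//.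
  by rewrite le_min ler01 sqr_ge0.
by rewrite ler_powR ?(ltW t1)// lerN2 lerDl ltW.
Qed.

(* Twice the principal value integral, symmetrised so that it converges absolutely. *)
Definition frac_diff p f x := total (fun t => diff2 f x t * `|t| `^ (- p)).

Lemma measurable_diff2 f x : measurable_fun setT f -> measurable_fun setT (diff2 f x).
Proof.
move=> mf; apply: measurable_funB.
  apply: measurable_funB => //.
  by apply: (measurableT_comp mf); apply: measurable_funD.
by apply: (measurableT_comp mf); apply: measurable_funB.
Qed.

Lemma measurable_frac_diff_integrand p f x : measurable_fun setT f ->
  measurable_fun setT (fun t => diff2 f x t * `|t| `^ (- p)).
Proof.
move=> mf; apply: measurable_funM; first exact: measurable_diff2.
exact: measurable_powR_norm.
Qed.

Lemma frac_diff_integrand_le a f x t c : 0 < a -> 0 <= c ->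
  `|diff2 f x t| <= c * Num.min 1 (t ^+ 2) ->
  `|diff2 f x t * `|t| `^ (- (2 + a))| <= c * singular_weight a t.
Proof.
move=> a0 c0 fc; rewrite normrM (ger0_norm (powR_ge0 _ _)).
rewrite (le_trans (ler_wpM2r (powR_ge0 _ _) fc))// -mulrA ler_wpM2l//.
exact: min_sqr_singular_weight.
Qed.

Section dominated.
Variables (a c : R) (f : R -> R).
Hypotheses (a0 : 0 < a) (a1 : a < 1) (c0 : 0 <= c) (cf : continuous f).
Hypothesis fc : forall x t, `|diff2 f x t| <= c * Num.min 1 (t ^+ 2).

Let mf : measurable_fun setT f := continuous_measurable_fun cf.

Lemma summable_frac_diff x : summable (fun t => diff2 f x t * `|t| `^ (- (2 + a))).
Proof.
apply: (summable_le (measurable_frac_diff_integrand _ _ mf)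
  (summableZ c (summable_singular_weight a0 a1))) => t.
exact: frac_diff_integrand_le.
Qed.

Lemma continuous_frac_diff : continuous (frac_diff (2 + a) f).
Proof.
apply: continuous_total.
- by move=> x; exact: measurable_frac_diff_integrand.
- move=> t x; apply: cvgM; last exact: cvg_cst.
  apply: cvgB; first apply: cvgB.
  + by apply: cvgM; [exact: cvg_cst|exact: cf].
  + apply: continuous_comp; last exact: cf.
    by apply: cvgD; [exact: cvg_id|exact: cvg_cst].
  + apply: continuous_comp; last exact: cf.
    by apply: cvgD; [exact: cvg_id|exact: cvg_cst].
- move=> x; exists (fun t => c * singular_weight a t).
    exact: summableZ (summable_singular_weight a0 a1).
  by move=> z t _; exact: frac_diff_integrand_le.
Qed.

Hypothesis bf : exists b, forall x, `|f x| <= b.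

Let trunc x (e : R) t := if e < `|t| then diff2 f x t * `|t| `^ (- (2 + a)) else 0.

Let one_sided x e t := if e < `|t| then (f x - f (x - t)) * `|t| `^ (- (2 + a)) else 0.

Let summable_one_sided x e : 0 < e -> summable (one_sided x e).
Proof.
move=> e0; have [b fb] := bf.
have b0 : 0 <= b by rewrite (le_trans _ (fb 0)).
have m0 : 0 < Num.min 1 (e ^+ 2) by rewrite lt_min ltr01 exprn_gt0.
have ms : measurable_fun setT (one_sided x e).
  apply: measurable_fun_ifT => //.
    by apply: measurable_fun_ltr => //; exact: normr_measurable.
  apply: measurable_funM; last exact: measurable_powR_norm.
  apply: measurable_funB => //.
  by apply: (measurableT_comp mf); apply: measurable_funB.
(* For [|t| > e] one has [min 1 (t^2) >= min 1 (e^2)], so dividing by the latter turns the crude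
   bound [2 b] into a multiple of the weight. *)
apply: (summable_le ms (summableZ (2 * b / Num.min 1 (e ^+ 2))
  (summable_singular_weight a0 a1))) => t.
rewrite /one_sided; case: ifPn => et; last first.
  by rewrite normr0 !mulr_ge0 ?invr_ge0 ?singular_weight_ge0// ltW.
rewrite normrM (ger0_norm (powR_ge0 _ _)) -!mulrA.
have fb2 : `|f x - f (x - t)| <= 2 * b.
  by rewrite (le_trans (ler_normB _ _))// mulr_natl mulr2n lerD.
rewrite (le_trans (ler_wpM2r (powR_ge0 _ _) fb2))// -mulrA !ler_wpM2l//.
rewrite mulrC ler_pdivlMr//.
rewrite (le_trans _ (min_sqr_singular_weight t a0))// mulrC ler_wpM2r ?powR_ge0//.
rewrite le_min ge_min lexx/= ge_min orbC.
by rewrite -(real_normK (num_real t)) lerXn2r ?nnegrE ?(ltW e0) ?(ltW et).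
Qed.

(** Averaging over the reflection [t -> -t], under which the truncation is invariant. *)
Let total_one_sided x e : 0 < e -> total (one_sided x e) = 2^-1 * total (trunc x e).
Proof.
move=> e0; have s := summable_one_sided x e0.
have s' := summable_reflect 0 s.
apply: (@mulfI _ 2); first by rewrite pnatr_eq0.
rewrite mulrA mulfV ?pnatr_eq0// mul1r mulr_natl mulr2n.
rewrite -{2}(total_reflect 0 s) -totalD//; apply: total_ext => t.
rewrite /one_sided /trunc sub0r normrN; case: ifP => _; rewrite ?addr0//.
by rewrite -mulrDl opprK /diff2; congr (_ * _); ring.
Qed.

(** Away from the diagonal the unsymmetrised integrand is summable because [f] is bounded, and each
    truncated integral equals half of its symmetrised form. The latter integrands are dominated
    uniformly in the cut-off, so the limit exists and is the untruncated integral. *)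
Lemma fracLap_frac_diff s x : 1 + 2 * s = 2 + a ->
  fracLap s f x = fracLap_const s * (2^-1 * frac_diff (2 + a) f x).
Proof.
move=> sa; rewrite /fracLap; congr (_ * _); apply: cvg_lim => //.
apply/cvg_at_rightP => e [e0 ecv].
have E n : \int[mu]_(y in [set y : R | e n < `|x - y|])
    ((f x - f y) / `|x - y| `^ (1 + 2 * s)) = 2^-1 * total (trunc x (e n)).
  rewrite Rintegral_mkcond -total_one_sided// -[RHS](total_reflect x (summable_one_sided x (e0 n))).
  apply: total_ext => y; rewrite patchE /one_sided.
  rewrite mem_setE/= subKr -powRN sa.
  by case: ifPn.
under eq_fun do rewrite E.
apply: cvgMr; apply: (dominated_total (g := fun t => c * singular_weight a t)).
- move=> n; apply: measurable_fun_ifT => //.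
    by apply: measurable_fun_ltr => //; exact: normr_measurable.
  exact: measurable_frac_diff_integrand.
- exact: summableZ (summable_singular_weight a0 a1).
- move=> n t; rewrite /trunc; case: ifP => _; first exact: frac_diff_integrand_le.
  by rewrite normr0 mulr_ge0// singular_weight_ge0.
- apply: aeW => t; have [->|t0] := eqVneq t 0.
    rewrite normr0 powR0; last by rewrite oppr_eq0 gt_eqF// addr_gt0.
    rewrite mulr0; apply: cvg_near_cst; apply: nearW => n.
    by rewrite /trunc normr0 ltNge (ltW (e0 n)).
  apply: cvg_near_cst; near=> n; rewrite /trunc ifT//.
  near: n; apply: (cvgr_lt _ ecv); by rewrite normr_gt0.
- exact: measurable_frac_diff_integrand.
Unshelve. all: end_near. Qed.

End dominated.

End fractional_difference.

(** * Test functions and convolution *)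

Section iterated_derivatives.
Context {R : realType}.
Implicit Types (f g : R -> R) (P : (R -> R) -> Prop) (n : nat).

(** The class [P] is required of the function and of all its derivatives up to order [n]. With [P]
    the bounded continuous functions this is strong enough an induction hypothesis for
    differentiating integrals repeatedly. *)
Fixpoint iter_derivable P n f : Prop :=
  P f /\ if n is m.+1 then (forall x, derivable f x 1) /\ iter_derivable P m (derive1 f)
         else True.

Lemma iter_derivable_base P n f : iter_derivable P n f -> P f.
Proof. by case: n => [|n] []. Qed.

Lemma iter_derivableW P n f : iter_derivable P n.+1 f -> iter_derivable P n f.
Proof.
elim: n f => [|n IH] f; first by case.
by move=> [Pf [df /IH If]]; split.
Qed.

Section closure.
Variable P : (R -> R) -> Prop.
Hypothesis PD : forall f g, P f -> P g -> P (f + g).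
Hypothesis PM : forall f g, P f -> P g -> P (f * g).

Lemma iter_derivableD n f g :
  iter_derivable P n f -> iter_derivable P n g -> iter_derivable P n (f + g).
Proof.
elim: n f g => [|n IH] f g /=; first by move=> [Pf _] [Pg _]; split => //; exact: PD.
move=> [Pf [df If]] [Pg [dg Ig]]; split; [exact: PD|split].
  by move=> x; exact: derivableD.
have -> : derive1 (f + g) = (derive1 f) + (derive1 g).
  by apply/funext => x; rewrite derive1E deriveD// -!derive1E.
exact: IH.
Qed.

Lemma iter_derivableM n f g :
  iter_derivable P n f -> iter_derivable P n g -> iter_derivable P n (f * g).
Proof.
elim: n f g => [|n IH] f g; first by move=> [Pf _] [Pg _]; split => //; exact: PM.
move=> If Ig; have If' := iter_derivableW If; have Ig' := iter_derivableW Ig.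
move: If Ig => [Pf [df If]] [Pg [dg Ig]].
split; [exact: PM|split].
  by move=> x; exact: derivableM.
have -> : derive1 (f * g) = f * (derive1 g) + (derive1 f) * g.
  apply/funext => x; rewrite derive1E deriveM// -!derive1E.
  by rewrite /GRing.scale/= [g x * _]mulrC.
by apply: iter_derivableD; apply: IH.
Qed.

End closure.

Lemma iter_derivable_sub P Q n f : (forall g, P g -> Q g) ->
  iter_derivable P n f -> iter_derivable Q n f.
Proof.
move=> PQ; elim: n f => [|n IH] f /=; first by move=> [/PQ].
by move=> [/PQ Qf [df /IH]].
Qed.

Lemma iter_derivable_cst P n (c : R) : (forall c, P (fun=> c)) ->
  iter_derivable P n (fun=> c).
Proof.
move=> Pc; elim: n c => [|n IH] c; split => //; split.
  by move=> x; exact: derivable_cst.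
rewrite (_ : derive1 _ = fun=> 0)//; apply/funext => x.
by rewrite derive1E derive_cst.
Qed.

Lemma smooth_iter_derivable P f : (forall n, iter_derivable P n f) -> smooth f.
Proof.
move=> If n; elim: n f If => [|n IH] f If; first by have [_ []] := If 1%N.
rewrite derive1Sn; apply: IH => m.
by have [_ [_]] := If m.+1.
Qed.

Lemma smooth_is_derive f (x : R) : smooth f -> is_derive x 1 f (derive1 f x).
Proof. by move=> sf; apply: DeriveDef; [exact: (sf 0%N)|rewrite derive1E]. Qed.

Lemma smooth_derive f : smooth f -> smooth (derive1 f).
Proof. by move=> sf n; rewrite -derive1Sn; exact: sf. Qed.

Lemma smooth_continuous f : smooth f -> continuous f.
Proof. by move=> sf x; exact: is_derive_continuous (smooth_is_derive x sf). Qed.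

End iterated_derivatives.

Section test_functions.
Context {R : realType}.
Implicit Types (f g phi psi : R -> R) (b c x y : R).

Definition vanishes_outside b f := forall x, b < `|x| -> f x = 0.

Lemma test_functionP f : test_function f <->
  smooth f /\ exists2 b, 0 < b & vanishes_outside b f.
Proof.
rewrite /test_function; split=> -[sf h]; split => //.
  have [M [_ bM]] := compact_bounded h.
  exists (Num.max 1 (M + 1)); first by rewrite lt_max ltr01.
  move=> x; rewrite gt_max => /andP[_ Mx]; apply/eqP/negPn/negP => fx0.
  have M1 : M < M + 1 by rewrite ltrDl.
  have /(_ x) := bM (M + 1) M1.
  move=> /(_ (subset_closure _)) /= /(_ fx0).
  by rewrite leNgt Mx.
have [b b0 fb] := h.
apply: (@subclosed_compact _ _ `[- b, b]%classic).
- exact: closed_closure.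
- exact: segment_compact.
- rewrite [X in _ `<=` X](_ : _ = closure `[- b, b]%classic); last first.
    by apply/closure_id; exact: interval_closed.
  apply: closureS => x /= fx0; rewrite in_itv/= -ler_norml leNgt.
  by apply: contra fx0 => /fb ->.
Qed.

Lemma vanishes_outside_derive b f : vanishes_outside b f -> vanishes_outside b (derive1 f).
Proof.
move=> fb x bx; rewrite derive1E.
have d0 : is_derive x 1 (cst 0 : R -> R) (0 : R) by exact: is_derive_cst.
have h : is_derive x 1 f 0.
  apply: is_derive_near d0; near=> y; rewrite fb//.
  near: y; apply: (@cvgr_gt _ _ _ _ (fun y : R => `|y|) `|x|) => //.
  exact: norm_continuous.
by rewrite derive_val.
Unshelve. all: end_near. Qed.

Lemma test_function_derive f : test_function f -> test_function (derive1 f).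
Proof.
move=> /test_functionP[sf [b b0 fb]]; apply/test_functionP; split.
  exact: smooth_derive.
by exists b => //; exact: vanishes_outside_derive.
Qed.

Lemma vanishing_bounded b f : continuous f -> vanishes_outside b f ->
  exists2 c, 0 <= c & forall x, `|f x| <= c.
Proof.
move=> cf fb; have [b0|b0] := leP 0 b; last first.
  exists 0 => // x; rewrite fb ?normr0//; exact: lt_le_trans b0 _.
have bb : - b <= b by rewrite -subr_ge0 opprK addr_ge0.
have cn : {within `[- b, b], continuous (fun x => `|f x|)}.
  apply: continuous_subspaceT => x.
  by apply: continuous_comp; [exact: cf|exact: norm_continuous].
have [m _ hm] := EVT_max bb cn.
exists `|f m| => // x; have [xb|xb] := leP `|x| b.
  by apply: hm; rewrite in_itv/= -ler_norml.
by rewrite fb// normr0.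
Qed.

Lemma test_function_bounded f : test_function f ->
  exists2 c, 0 <= c & forall x, `|f x| <= c.
Proof.
move=> /test_functionP[sf [b b0 fb]].
exact: vanishing_bounded (smooth_continuous sf) fb.
Qed.

Lemma summable_ball b : summable (fun x : R => if `|x| <= b then 1 else 0 : R).
Proof.
have [b0|b0] := ltP b 0.
  apply: summable_ext (@summable0 R) => x.
  by rewrite ifF//; apply/negbTE; rewrite -ltNge (lt_le_trans b0).
have s := summableZ ((1 + b) ^+ 2) (@summable_weight R 2 (ltr1n _ 2)).
apply: (summable_le _ s).
  apply: measurable_fun_ifT => //.
  by apply: measurable_fun_ler => //; exact: normr_measurable.
move=> x; case: ifPn => xb; last first.
  by rewrite normr0 mulr_ge0 ?powR_ge0// sqr_ge0.
rewrite normr1 powRN powR_mulrn ?addr_ge0// ler_pdivlMr ?exprn_gt0 ?ltr_pwDl//.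
by rewrite mul1r lerXn2r ?nnegrE ?addr_ge0// lerD2l.
Qed.

Lemma summable_vanishing b f : measurable_fun setT f -> vanishes_outside b f ->
  (exists c, forall x, `|f x| <= c) -> summable f.
Proof.
move=> mf fb [c fc]; apply: (summable_le mf (summableZ c (summable_ball b))) => x.
case: ifPn => xb; first by rewrite mulr1.
by rewrite fb ?normr0 ?mulr0// ltNge.
Qed.

Lemma summable_continuous_vanishing b f : continuous f -> vanishes_outside b f ->
  summable f.
Proof.
move=> cf fb; apply: (summable_vanishing (continuous_measurable_fun cf) fb).
by have [c _ fc] := vanishing_bounded cf fb; exists c.
Qed.

Lemma measurable_patch f (D : set R) : measurable D -> measurable_fun setT f ->
  measurable_fun setT (f \_ D).
Proof.
by move=> mD mf; apply/(measurable_restrictT _ _).1 => //; exact: measurable_funTS.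
Qed.

Lemma total_segment a b f F : a < b -> (forall x, is_derive x 1 F (f x)) ->
  continuous f -> total (f \_ `[a, b]) = F b - F a.
Proof.
move=> ab dF cf; rewrite /total -Rintegral_mkcond /Rintegral.
by rewrite (integral_segment_derivative ab (fun x _ => dF x) (fun x _ => cf x)).
Qed.

(** The integral over the half-line is what integration against the sign function calls for. *)
Lemma total_derivative b f F : (forall x, is_derive x 1 F (f x)) ->
  continuous f -> vanishes_outside b F -> vanishes_outside b f ->
  total f = 0 /\ total (fun x => if 0 < x then f x else 0) = - F 0.
Proof.
move=> dF cf Fb fb; pose m := Num.max 1 b + 1.
have m0 : 0 < m by rewrite addr_gt0// lt_max ltr01.
have bm : b < m by rewrite /m ltr_pwDr// le_max lexx orbT.
have Fm : F m = 0 by apply: Fb; rewrite gtr0_norm.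
have FNm : F (- m) = 0 by apply: Fb; rewrite normrN gtr0_norm.
have fm x : m < `|x| -> f x = 0 by move=> mx; apply: fb; exact: lt_trans mx.
split.
  have := @total_segment (- m) m f F _ dF cf.
  rewrite Fm FNm subr0 => <-; last by rewrite -subr_gt0 opprK addr_gt0.
  apply: total_ext => x; rewrite patchE mem_setE/= in_itv/= -ler_norml.
  by case: ifPn => //; rewrite -ltNge => /fm.
have := @total_segment 0 m f F m0 dF cf; rewrite Fm sub0r => <-.
apply: total_ae.
- apply: measurable_fun_ifT => //; first exact: measurable_fun_ltr.
  exact: continuous_measurable_fun.
- apply: measurable_patch; first exact: measurable_itv.
  exact: continuous_measurable_fun.
have : {ae (@lebesgue_measure R), forall x, x != 0}.
  exists [set 0]; split => //; first exact: lebesgue_measure_set1.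
  by move=> x /= /negP/negPn/eqP.
apply: ae_imply => x x0; rewrite patchE mem_setE/= in_itv/= le_eqVlt eq_sym (negbTE x0)/=.
have [x1|//] := ltP 0 x; case: ifPn => //; rewrite -ltNge => mx.
by apply: fm; rewrite gtr0_norm.
Qed.

End test_functions.

(** * A smooth bump function *)

Section bump.
Context {R : realType}.
Implicit Types (p : {poly R}) (x y h s : R).

(** The functions [p(1/x) e^(-1/x)], extended by 0, form a family closed under differentiation: the
    derivative replaces [p] by [X^2 (p - p')]. Smoothness is then an induction over the whole
    family. *)
Definition flat p x : R := if 0 < x then p.[x^-1] * expR (- x^-1) else 0.

Lemma polynomial_growth p : exists n, exists2 c, 0 <= c &
  forall y, 1 <= y -> `|p.[y]| <= c * y ^+ n.
Proof.
elim/poly_ind: p => [|p c [n [k k0 IH]]].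
  by exists 0%N, 0 => // y _; rewrite horner0 normr0 mul0r.
exists n.+1, (k + `|c|); first by rewrite addr_ge0.
move=> y y1; rewrite hornerMXaddC (le_trans (ler_normD _ _))// mulrDl lerD//.
  have y0 : 0 <= y by rewrite (le_trans _ y1).
  by rewrite normrM (ger0_norm y0) exprSr mulrA ler_wpM2r// IH.
by rewrite -{1}[`|c|]mulr1 ler_wpM2l// exprn_ege1.
Qed.

(** The term of order [n + 2] in the series of [e^(1/x)] beats growth of order [n] with [x^2] to
    spare; a quadratic bound yields derivative 0 at the origin. *)
Lemma flat_le_sqr p : exists2 c, 0 <= c &
  forall x, x <= 1 -> `|flat p x| <= c * x ^+ 2.
Proof.
have [n [c c0 pc]] := polynomial_growth p.
exists (c * (n.+2)`!%:R); first by rewrite mulr_ge0.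
move=> x x1; rewrite /flat; case: ifPn => [x0|_]; last first.
  by rewrite normr0 mulr_ge0 ?sqr_ge0// mulr_ge0.
have y1 : 1 <= x^-1 by rewrite invf_ge1.
have y0 : 0 < x^-1 by rewrite invr_gt0.
rewrite normrM (ger0_norm (expR_ge0 _)) expRN ler_pdivrMr ?expR_gt0//.
rewrite (le_trans (pc _ y1))//.
have := expR_ge1Dxn n.+1 (ltW y0) => h.
have {h} h : x^-1 ^+ n.+2 / (n.+2)`!%:R <= expR x^-1.
  by rewrite (le_trans _ h)// lerDr.
rewrite ler_pdivrMr ?ltr0n ?fact_gt0// in h.
have -> : x^-1 ^+ n = x ^+ 2 * x^-1 ^+ n.+2.
  rewrite !exprS; set z := x^-1 ^+ n; by field; rewrite gt_eqF.
rewrite [leRHS](_ : _ = c * (x ^+ 2 * (expR x^-1 * (n.+2)`!%:R))); last by ring.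
by rewrite ler_wpM2l// ler_wpM2l// sqr_ge0.
Qed.

Lemma is_derive_flat p x : is_derive x 1 (flat p) (flat ('X^2 * (p - p^`())) x).
Proof.
have [x0|x0|<-] := ltgtP 0 x.
- have xn0 : x != 0 by rewrite gt_eqF.
  have di : is_derive x 1 (fun y : R => y^-1) (- x ^- 2).
    have := @is_deriveV R id x 1 1 xn0 (is_derive_id _ _).
    by rewrite /GRing.scale/= mulr1.
  have dp := is_derive1_comp (is_derive_poly p x^-1) di.
  have dN : is_derive x 1 (fun y : R => - y^-1) (x ^- 2).
    by apply: is_derive_eq; rewrite opprK.
  have de := is_derive1_comp (g := fun y => - y^-1) (is_derive_expR (- x^-1)) dN.
  have -> : flat ('X^2 * (p - p^`())) x =
      x ^- 2 * (p.[x^-1] - p^`().[x^-1]) * expR (- x^-1).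
    by rewrite /flat x0 !hornerE exprVn.
  have d : is_derive x 1 ((horner p \o (fun y : R => y^-1)) * (expR \o (fun y : R => - y^-1)))
      (x ^- 2 * (p.[x^-1] - p^`().[x^-1]) * expR (- x^-1)).
    by apply: is_derive_eq; rewrite /GRing.scale/=; ring.
  apply: is_derive_near d; near=> y; rewrite /flat ifT//.
  by near: y; exact: lt_nbhsr.
- have d : is_derive x 1 (cst 0 : R -> R) (0 : R) by exact: is_derive_cst.
  rewrite /flat ltNge (ltW x0)/=.
  apply: is_derive_near d; near=> y; rewrite ifF//.
  apply/negbTE; rewrite -leNgt ltW//; near: y; exact: lt_nbhsl.
- rewrite {2}/flat ltxx; apply: is_derive_quotient.
  have [c c0 fc] := flat_le_sqr p.
  have c1 : 0 < c + 1 by rewrite ltr_wpDl.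
  apply/cvgrPdist_le => e e0; near=> h.
  have h1 : `|h| <= 1.
    by near: h; apply: dnbhs0_le.
  have h2 : `|h| <= e / (c + 1).
    by near: h; apply: dnbhs0_le; rewrite divr_gt0.
  have h0 : h != 0 by near: h; exact: nbhs_dnbhs_neq.
  rewrite addr0 [flat p 0]/flat ltxx subr0 sub0r normrN normrM normfV.
  rewrite mulrC ler_pdivrMr ?normr_gt0//.
  rewrite (le_trans (fc _ (le_trans (ler_norm _) h1)))//.
  rewrite -(real_normK (num_real h)) expr2 mulrA ler_wpM2r//.
  rewrite ler_pdivlMr// in h2; rewrite (le_trans _ h2)// mulrC ler_wpM2l// lerDl//.
Unshelve. all: end_near. Qed.

Lemma iter_derivable_flat n p s :
  iter_derivable (fun=> True) n (fun x => flat p (1 + s * x)).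
Proof.
elim: n p => [|n IH] p; first by [].
have d x : is_derive x 1 (fun x => flat p (1 + s * x)) (flat (s *: ('X^2 * (p - p^`()))) (1 + s * x)).
  have d1 : is_derive x 1 (fun x : R => 1 + s * x) s.
    by apply: is_derive_eq; rewrite /GRing.scale/=; ring.
  have := is_derive1_comp (g := fun x => 1 + s * x) (is_derive_flat p (1 + s * x)) d1.
  by rewrite /flat; case: ifP => _; rewrite ?mul0r// hornerZ mulrC mulrA.
split => //; split; first by move=> x; have [] := d x.
have -> : derive1 (fun x => flat p (1 + s * x)) =
    (fun x => flat (s *: ('X^2 * (p - p^`()))) (1 + s * x)).
  by apply/funext => x; rewrite derive1E; have := d x => ?; rewrite derive_val.
exact: IH.
Qed.

Lemma exists_bump : exists rho : R -> R, [/\ test_function rho,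
  forall x, 0 <= rho x, vanishes_outside 1 rho & 0 < total rho].
Proof.
pose rho := (fun x : R => flat 1 (1 + 1 * x)) * (fun x : R => flat 1 (1 + (-1) * x)).
have rhoE x : rho x = flat 1 (1 + x) * flat 1 (1 - x).
  by rewrite -[rho x]/(flat 1 (1 + 1 * x) * flat 1 (1 + -1 * x)) mul1r mulN1r.
have f0 x : 0 <= flat 1 x.
  by rewrite /flat; case: ifP => // _; rewrite hornerC mul1r expR_ge0.
have f1 x : 0 < x -> 0 < flat 1 x.
  by move=> x0; rewrite /flat x0 hornerC mul1r expR_gt0.
have smooth_rho : smooth rho.
  apply: (@smooth_iter_derivable _ (fun=> True)) => n.
  by apply: iter_derivableM => //; exact: iter_derivable_flat.
have rho1 : vanishes_outside 1 rho.
  move=> x; rewrite ltNge ler_norml negb_and -!ltNge rhoE => /orP[] h.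
    by rewrite [flat 1 (1 + x)]/flat ifF ?mul0r//; apply/negbTE; rewrite -leNgt; lra.
  by rewrite [flat 1 (1 - x)]/flat ifF ?mulr0//; apply/negbTE; rewrite -leNgt; lra.
have crho := smooth_continuous smooth_rho.
have srho := summable_continuous_vanishing crho rho1.
exists rho; split => //.
- by apply/test_functionP; split => //; exists 1.
- by move=> x; rewrite rhoE mulr_ge0.
rewrite lt_neqAle total_ge0 ?andbT; last by move=> x; rewrite rhoE mulr_ge0.
have r0 : 0 < rho 0 by rewrite rhoE mulr_gt0// f1// ?addr0 ?subr0.
have /cvgrPdist_lt := crho 0 => /(_ (rho 0 / 2)).
rewrite divr_gt0// => /(_ isT)/nbhs_ballP[e /= e0 He].
pose q x := if `|x| <= e / 2 then rho 0 / 2 else 0.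
have sq : summable q.
  apply: summable_ext (summableZ (rho 0 / 2) (summable_ball (e / 2))) => x.
  by rewrite /q; case: ifP => _; rewrite ?mulr1 ?mulr0.
have qr : total q <= total rho.
  apply: total_le => // x; rewrite /q; case: ifPn => xe; last by rewrite rhoE mulr_ge0.
  have := He x; rewrite /ball/= sub0r normrN => /(_ _)/ltW.
  rewrite (le_lt_trans xe) ?ltr_pdivrMr ?ltr_pMr ?ltr1n// => /(_ isT).
  by rewrite ler_norml => /andP[_]; lra.
have : 0 < total q.
  have -> : q = (fun x : R => rho 0 / 2) \_ `[- (e / 2), e / 2].
    by apply/funext => x; rewrite patchE mem_setE/= in_itv/= -ler_norml /q; case: ifP.
  have e2 : 0 < e / 2 by rewrite divr_gt0.
  have d x : is_derive x 1 (fun x => rho 0 / 2 * x) (rho 0 / 2).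
    by apply: is_derive_eq; rewrite /GRing.scale/=; ring.
  have ee : - (e / 2) < e / 2 by rewrite -subr_gt0 opprK addr_gt0.
  rewrite (total_segment ee d); last by move=> x; exact: cvg_cst.
  by rewrite -mulrBr opprK mulr_gt0 ?divr_gt0// addr_gt0.
by move=> q0; rewrite eq_sym gt_eqF// (lt_le_trans q0).
Qed.

End bump.

(** * Convolution with test functions *)

Section convolution.
Context {R : realType}.
Implicit Types (a b c p x y z t h : R) (f g k psi eta : R -> R).

Definition locally_summable k := measurable_fun setT k /\
  forall b, summable (fun y => if `|y| <= b then k y else 0).

Definition convolve k psi x := total (fun y => k y * psi (x - y)).

Lemma locally_summable_continuous k : continuous k -> locally_summable k.
Proof.
move=> ck; have mk := continuous_measurable_fun ck; split => // b.
have [b0|b0] := ltP b 0.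
  apply: summable_ext (@summable0 R) => x.
  by rewrite ifF//; apply/negbTE; rewrite -ltNge (lt_le_trans b0).
have bb : - b <= b by rewrite -subr_ge0 opprK addr_ge0.
have cn : {within `[- b, b], continuous (fun x => `|k x|)}.
  apply: continuous_subspaceT => x.
  by apply: continuous_comp; [exact: ck|exact: norm_continuous].
have [m _ hm] := EVT_max bb cn.
have mi : measurable_fun setT (fun y => if `|y| <= b then k y else 0).
  apply: measurable_fun_ifT => //.
  by apply: measurable_fun_ler => //; exact: normr_measurable.
apply: (summable_le mi (summableZ `|k m| (summable_ball b))) => x.
case: ifPn => xb; last by rewrite normr0 mulr0.
by rewrite mulr1; apply: hm; rewrite in_itv/= -ler_norml.
Qed.

Lemma locally_summableB f g : locally_summable f -> locally_summable g ->
  locally_summable (fun x => f x - g x).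
Proof.
move=> [mf lf] [mg lg]; split; first exact: measurable_funB.
move=> b; apply: summable_ext (summableB (lf b) (lg b)) => x.
by case: ifP; rewrite ?subr0.
Qed.

Lemma locally_summableZ c f : locally_summable f -> locally_summable (fun x => c * f x).
Proof.
move=> [mf lf]; split; first exact: measurable_funM.
move=> b; apply: summable_ext (summableZ c (lf b)) => x.
by case: ifP; rewrite ?mulr0.
Qed.

Lemma measurable_sub_comp f x : measurable_fun setT f ->
  measurable_fun setT (fun y => f (x - y)).
Proof. by move=> mf; apply: (measurableT_comp mf); exact: measurable_funB. Qed.

Lemma convolve_dominated k psi b c x y z : (forall y, `|psi y| <= c) ->
  vanishes_outside b psi -> `|z - x| < 1 ->
  `|k y * psi (z - y)| <= c * `|if `|y| <= `|x| + 1 + b then k y else 0|.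
Proof.
move=> psic psib zx; have c0 : 0 <= c by rewrite (le_trans _ (psic 0)).
case: ifPn => yb; first by rewrite normrM mulrC ler_wpM2r.
rewrite psib ?mulr0 ?normr0 ?mulr0//.
rewrite -ltNge in yb.
have h1 := ler_distD x z y; have h2 := ler_dist_dist x y.
have h3 : `|y| - `|x| <= `|x - y|.
  by rewrite (le_trans _ h2)// distrC ler_norm.
have h4 : `|x - y| <= `|z - x| + `|z - y| by rewrite (distrC z x) ler_distD.
lra.
Qed.

Lemma summable_convolve k psi b x : locally_summable k -> continuous psi ->
  vanishes_outside b psi -> summable (fun y => k y * psi (x - y)).
Proof.
move=> [mk lk] cpsi psib; have [c _ psic] := vanishing_bounded cpsi psib.
have mi : measurable_fun setT (fun y => k y * psi (x - y)).
  by apply: measurable_funM => //; exact: measurable_sub_comp (continuous_measurable_fun cpsi).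
apply: (summable_le mi (summableZ c (summable_norm (lk (`|x| + 1 + b))))) => y.
by apply: convolve_dominated => //; rewrite subrr normr0.
Qed.

Lemma is_derive_convolve k psi x : locally_summable k -> test_function psi ->
  is_derive x 1 (convolve k psi) (convolve k (derive1 psi) x).
Proof.
move=> lk tpsi; have /test_functionP[spsi [b b0 psib]] := tpsi.
have tpsi' := test_function_derive tpsi.
have [c _ psic] := test_function_bounded tpsi'.
apply: (@is_derive_total _ (fun x y => k y * psi (x - y))
  (fun x y => k y * derive1 psi (x - y))).
- by move=> z; apply: (summable_convolve _ lk (smooth_continuous spsi) psib).
- move=> z y.
  have d1 : is_derive z 1 (fun z => z - y) 1 by apply: is_derive_eq; ring.
  have d2 := is_derive1_comp (g := fun z => z - y) (smooth_is_derive (z - y) spsi) d1.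
  have -> : (fun z => k y * psi (z - y)) = k y \*: (psi \o (fun z => z - y)) by [].
  by apply: is_derive_eq; rewrite mulr1.
- exists (fun y => c * `|if `|y| <= `|x| + 1 + b then k y else 0|).
    by have [_ lk'] := lk; exact: summableZ (summable_norm (lk' _)).
  by move=> z y; apply: convolve_dominated => //; exact: vanishes_outside_derive.
Qed.

Lemma derive1_convolve k psi : locally_summable k -> test_function psi ->
  derive1 (convolve k psi) = convolve k (derive1 psi).
Proof.
move=> lk tpsi; apply/funext => x; rewrite derive1E.
by have := is_derive_convolve x lk tpsi => ?; rewrite derive_val.
Qed.

Lemma smooth_convolve k psi : locally_summable k -> test_function psi ->
  smooth (convolve k psi).
Proof.
move=> lk tpsi n; elim: n psi tpsi => [|n IH] psi tpsi x.
  by have [] := is_derive_convolve x lk tpsi.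
by rewrite derive1Sn derive1_convolve//; apply: IH; exact: test_function_derive.
Qed.

Lemma test_function_convolve k psi r : locally_summable k -> test_function psi ->
  0 < r -> vanishes_outside r k -> test_function (convolve k psi).
Proof.
move=> lk tpsi r0 kr; apply/test_functionP; split; first exact: smooth_convolve.
have /test_functionP[_ [b b0 psib]] := tpsi.
exists (r + b); first exact: addr_gt0.
move=> x rbx; rewrite /convolve -[RHS](@total0 R); apply: total_ext => y.
have [yr|yr] := ltP r `|y|; first by rewrite kr// mul0r.
rewrite psib ?mulr0//.
have := ler_normD (x - y) y; rewrite subrK; lra.
Qed.

Lemma convolveB f g psi b x : locally_summable f -> locally_summable g ->
  continuous psi -> vanishes_outside b psi ->
  convolve (fun x => f x - g x) psi x = convolve f psi x - convolve g psi x.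
Proof.
move=> lf lg cpsi psib; rewrite /convolve -totalB; [|exact: summable_convolve psib..].
by apply: total_ext => y; rewrite mulrBl.
Qed.

Lemma convolve_by_parts k K psi x : (forall y, is_derive y 1 K (k y)) ->
  continuous k -> test_function psi -> convolve k psi x = convolve K (derive1 psi) x.
Proof.
move=> dK ck tpsi; have /test_functionP[spsi [b b0 psib]] := tpsi.
have tpsi' := test_function_derive tpsi.
have /test_functionP[spsi' _] := tpsi'.
have psib' := vanishes_outside_derive psib.
have cK : continuous K by move=> y; exact: is_derive_continuous (dK y).
have lk := locally_summable_continuous ck.
have lK := locally_summable_continuous cK.
have cpsi := smooth_continuous spsi; have cpsi' := smooth_continuous spsi'.
apply/eqP; rewrite -subr_eq0 -totalB; [|exact: summable_convolve psib..|exact: summable_convolve psib'].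
have csub (q : R -> R) : continuous q -> continuous (fun y => q (x - y)).
  move=> cq y; apply: continuous_comp; last exact: cq.
  by apply: cvgB; [exact: cvg_cst|exact: cvg_id].
have vsub (q r : R -> R) : vanishes_outside b q ->
    vanishes_outside (`|x| + b) (fun y => r y * q (x - y)).
  move=> qb y yb; rewrite qb ?mulr0//.
  by have := ler_dist_dist x y; rewrite ler_norml => /andP[]; lra.
apply/eqP; have [] := @total_derivative R (`|x| + b)
  (fun y => k y * psi (x - y) - K y * derive1 psi (x - y)) (fun y => K y * psi (x - y)).
- move=> y; have d1 : is_derive y 1 (fun z => x - z) (-1).
    by apply: is_derive_eq; rewrite /GRing.scale/=; ring.
  have d2 := is_derive1_comp (g := fun z => x - z) (smooth_is_derive (x - y) spsi) d1.
  have -> : (fun y => K y * psi (x - y)) = K * (psi \o (fun z => x - z)) by [].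
  have := dK y => ?.
  by apply: is_derive_eq; rewrite /GRing.scale/=; ring.
- move=> y; apply: cvgB.
    by apply: cvgM; [exact: ck|exact: csub].
  by apply: cvgM; [exact: cK|exact: csub].
- exact: vsub.
- by move=> y yb; rewrite (vsub _ k psib y yb) (vsub _ K psib' y yb) subrr.
- by [].
Qed.

Lemma continuous_diff2 f t : continuous f -> continuous (diff2 f ^~ t).
Proof.
move=> cf x; apply: cvgB; first apply: cvgB.
- by apply: cvgM; [exact: cvg_cst|exact: cf].
- apply: continuous_comp; last exact: cf.
  by apply: cvgD; [exact: cvg_id|exact: cvg_cst].
- apply: continuous_comp; last exact: cf.
  by apply: cvgD; [exact: cvg_id|exact: cvg_cst].
Qed.

Lemma diff2_convolve k psi b x t : continuous k -> continuous psi ->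
  vanishes_outside b psi ->
  diff2 (convolve k psi) x t = convolve (diff2 k ^~ t) psi x.
Proof.
move=> ck cpsi psib; have lk := locally_summable_continuous ck.
have s z : summable (fun y => k y * psi (z - y)) by exact: summable_convolve psib.
rewrite /diff2 /convolve.
rewrite -(total_shift t (s (x + t))) -(total_shift (- t) (s (x - t))).
have s1 := summable_shift t (s (x + t)); have s2 := summable_shift (- t) (s (x - t)).
rewrite -totalZ// -totalB//; last exact: summableZ.
rewrite -totalB//; last by apply: summableB => //; exact: summableZ.
apply: total_ext => y.
have -> : x + t - (y + t) = x - y by ring.
have -> : x - t - (y - t) = x - y by ring.
by ring.
Qed.

(** Second differences commute with convolution, and Fubini exchanges the two integrals: the
    absolute inner integrals are bounded uniformly in [y], and [psi] is summable. *)
Lemma frac_diff_convolve p k psi b c x : continuous k -> continuous psi ->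
  vanishes_outside b psi ->
  (forall y, summable (fun t => diff2 k y t * `|t| `^ (- p))) ->
  (forall y, total (fun t => `|diff2 k y t * `|t| `^ (- p)|) <= c) ->
  summable (fun t => diff2 (convolve k psi) x t * `|t| `^ (- p)) /\
  frac_diff p (convolve k psi) x = convolve (frac_diff p k) psi x.
Proof.
move=> ck cpsi psib sk kc; have lk := locally_summable_continuous ck.
have mk := continuous_measurable_fun ck.
pose F y t := diff2 k y t * `|t| `^ (- p) * psi (x - y).
have spsi : summable (fun y => c * `|psi (x - y)|).
  apply: summableZ; apply: summable_norm; apply: summable_reflect.
  exact: summable_continuous_vanishing psib.
have mF : measurable_fun setT (fun q : R * R => F q.1 q.2).
  apply: measurable_funM.
    apply: measurable_funM; last exact: (measurableT_comp (measurable_powR_norm _)).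
    apply: measurable_funB.
      apply: measurable_funB.
        by apply: measurable_funM => //; exact: (measurableT_comp mk).
      by apply: (measurableT_comp mk); exact: measurable_funD.
    by apply: (measurableT_comp mk); exact: measurable_funB.
  apply: (measurableT_comp (continuous_measurable_fun cpsi)).
  exact: measurable_funB.
have sF y : summable (F y).
  apply: summable_ext (summableZ (psi (x - y)) (sk y)) => t.
  by rewrite /F mulrC.
have bF y : total (fun t => `|F y t|) <= c * `|psi (x - y)|.
  rewrite (_ : total _ = `|psi (x - y)| * total (fun t => `|diff2 k y t * `|t| `^ (- p)|)).
    by rewrite mulrC ler_wpM2r.
  rewrite -(totalZ _ (summable_norm (sk y))).
  by apply: total_ext => t; rewrite /F normrM mulrC.
have [E _ _ S _] := fubini_total mF sF bF spsi.
have FE t : total (F ^~ t) = diff2 (convolve k psi) x t * `|t| `^ (- p).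
  rewrite (diff2_convolve _ _ ck cpsi psib) mulrC /convolve -totalZ.
    by apply: total_ext => y; rewrite /F; ring.
  apply: (summable_convolve _ _ cpsi psib).
  by apply: locally_summable_continuous; exact: continuous_diff2.
split; first by apply: summable_ext S => t; rewrite FE.
rewrite /frac_diff -(total_ext FE) -E; apply: total_ext => y.
rewrite mulrC -(totalZ _ (sk y)); apply: total_ext => t.
by rewrite /F mulrC.
Qed.

End convolution.

(** * The fractional difference of the power kernel *)

Section fundamental_solution.
Context {R : realType}.
Variable a : R.
Hypotheses (a0 : 0 < a) (a1 : a < 1).
Implicit Types (x y t : R) (eta : R -> R).

Notation J := (primitive_power a).
Notation K := (fun x : R => `|x| `^ a).

(* [J' = K], so [K * eta'' = J * eta''']; as [J] is odd and homogeneous, its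
   fractional difference is [riesz_constant] times the sign function. *)
Definition riesz_constant := frac_diff (2 + a) J 1.

Let dJ x : is_derive x 1 J (K x) := is_derive_primitive_power x a0.
Let cJ : continuous J. Proof. by move=> x; exact: is_derive_continuous (dJ x). Qed.

Let summable_J1 : summable (fun t => diff2 J 1 t * `|t| `^ (- (2 + a))) /\
  forall t, `|diff2 J 1 t * `|t| `^ (- (2 + a))| <= 6 * singular_weight a t.
Proof.
have h t : `|diff2 J 1 t * `|t| `^ (- (2 + a))| <= 6 * singular_weight a t.
  have [->|t0] := eqVneq t 0.
    rewrite normr0 [X in _ * X]powR0; last by rewrite oppr_eq0 gt_eqF// addr_gt0.
    by rewrite mulr0 normr0 mulr_ge0// singular_weight_ge0.
  have nt : 0 < `|t| by rewrite normr_gt0.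
  rewrite normrM (ger0_norm (powR_ge0 _ _)).
  rewrite (le_trans (ler_wpM2r (powR_ge0 _ _) (diff2_primitive_power t a0 (ltW a1))))//.
  rewrite /singular_weight; case: ifPn => t1.
    have -> : `|t| `^ (- a) = t ^+ 2 * `|t| `^ (- (2 + a)).
      rewrite -(real_normK (num_real t)) -powR_mulrn// -powRD_gt0//.
      by congr (_ `^ _); ring.
    rewrite mulrA ler_wpM2r ?powR_ge0// ler_wpM2r ?sqr_ge0//; lra.
  rewrite -mulrA -powRD_gt0// (_ : a + - (2 + a) = - 2)//; ring.
split => //; apply: (summable_le _ (summableZ 6 (summable_singular_weight a0 a1))) => //.
exact: measurable_frac_diff_integrand (continuous_measurable_fun cJ).
Qed.

(** Degree [1 + a] of the primitive and degree [-(2 + a)] of the weight add up to -1, which the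
    Jacobian [|y|] of the substitution cancels; only the sign of [y] survives. *)
Let diff2_J y t : y != 0 -> diff2 J y t * `|t| `^ (- (2 + a)) =
  y * `|y| `^ (- 2) * (diff2 J 1 (y^-1 * t + 0) * `|y^-1 * t + 0| `^ (- (2 + a))).
Proof.
move=> y0; have ny : 0 < `|y| by rewrite normr_gt0.
rewrite addr0; have -> : diff2 J y t = y * `|y| `^ a * diff2 J 1 (y^-1 * t).
  rewrite /diff2.
  have -> : J y = y * `|y| `^ a * J 1 by rewrite -primitive_power_scale mulr1.
  have -> : J (y + t) = y * `|y| `^ a * J (1 + y^-1 * t).
    by rewrite -primitive_power_scale mulrDr mulr1 mulrA mulfV// mul1r.
  have -> : J (y - t) = y * `|y| `^ a * J (1 - y^-1 * t).
    by rewrite -primitive_power_scale mulrBr mulr1 mulrA mulfV// mul1r.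
  by ring.
rewrite normrM powRM// normfV.
have -> : `|y| `^ (- 2) = `|y| `^ a * `|y| `^ (- (2 + a)).
  by rewrite -powRD_gt0//; congr (_ `^ _); ring.
have -> : `|y|^-1 `^ (- (2 + a)) = (`|y| `^ (- (2 + a)))^-1.
  by rewrite -powR_inv1// powRAC powR_inv1// powR_ge0.
by field; rewrite gt_eqF// powR_gt0.
Qed.

(** Rescaling gives the same absolute integral for every [y != 0], hence the uniform bound demanded
    by [frac_diff_convolve]. At [y = 0] the second difference of an odd function vanishes. *)
Let summable_J y : summable (fun t => diff2 J y t * `|t| `^ (- (2 + a))) /\
  frac_diff (2 + a) J y = Num.sg y * riesz_constant /\
  total (fun t => `|diff2 J y t * `|t| `^ (- (2 + a))|) <= 6 * total (singular_weight a).
Proof.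
have [s1 d1] := summable_J1.
have w0 : 0 <= 6 * total (singular_weight a).
  by rewrite mulr_ge0// total_ge0// => t; exact: singular_weight_ge0.
have [->|y0] := eqVneq y 0.
  have E t : diff2 J 0 t * `|t| `^ (- (2 + a)) = 0.
    rewrite /diff2 add0r sub0r primitive_power_odd /primitive_power !mul0r mulr0.
    by rewrite sub0r opprK addNr mul0r.
  rewrite sgr0 mul0r; split; first by apply: summable_ext (@summable0 R) => t.
  split; first by rewrite /frac_diff (total_ext E) total0.
  by rewrite (total_ext (g := fun=> 0)) ?total0// => t; rewrite E normr0.
have yi0 : y^-1 != 0 by rewrite invr_eq0.
have ny : 0 < `|y| by rewrite normr_gt0.
have s2 := summable_affine 0 yi0 s1.
have cst : y * `|y| `^ (- 2) * `|y| = Num.sg y.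
  rewrite {1}(numEsg y) powRN powR_mulrn//.
  by field; rewrite gt_eqF.
split; [|split].
- by apply: summable_ext (summableZ (y * `|y| `^ (- 2)) s2) => t; rewrite -diff2_J.
- rewrite /frac_diff (total_ext (fun t => diff2_J t y0)) (totalZ _ s2).
  by rewrite (total_affine 0 yi0 s1) normfV invrK mulrA cst.
rewrite (total_ext (g := fun t => `|y * `|y| `^ (- 2)| *
    `|diff2 J 1 (y^-1 * t + 0) * `|y^-1 * t + 0| `^ (- (2 + a))|)); last first.
  by move=> t; rewrite diff2_J// normrM.
rewrite totalZ; last exact: (summable_affine 0 yi0 (summable_norm s1)).
rewrite (total_affine 0 yi0 (summable_norm s1)) normfV invrK mulrA.
have -> : `|y * `|y| `^ (- 2)| * `|y| = 1.
  by rewrite -{2}(normr_id y) -normrM cst normr_sg y0.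
rewrite mul1r -totalZ; last exact: summable_singular_weight.
by apply: total_le => //; [exact: summable_norm|exact: summableZ (summable_singular_weight a0 a1)].
Qed.

Lemma frac_diff_riesz eta x : test_function eta ->
  summable (fun t => diff2 (convolve K (derive1 (derive1 eta))) x t * `|t| `^ (- (2 + a))) /\
  frac_diff (2 + a) (convolve K (derive1 (derive1 eta))) x =
    2 * riesz_constant * derive1 (derive1 eta) x.
Proof.
move=> teta; have t2 := test_function_derive (test_function_derive teta).
set psi := derive1 (derive1 eta) in t2 *.
have t3 := test_function_derive t2.
have /test_functionP[s2 [b b0 psib]] := t2.
have /test_functionP[s3 _] := t3.
have c3 := smooth_continuous s3; have psib' := vanishes_outside_derive psib.
have -> : convolve K psi = convolve J (derive1 psi).
  apply/funext => z; apply: convolve_by_parts => //; exact: continuous_powR_norm.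
have [S ->] := frac_diff_convolve x cJ c3 psib' (fun y => (summable_J y).1)
  (fun y => (summable_J y).2.2).
split => //; rewrite /convolve.
have d y : is_derive y 1 (fun z => - psi (x - z)) (derive1 psi (x - y)).
  have d1 : is_derive y 1 (fun z => x - z) (-1).
    by apply: is_derive_eq; rewrite /GRing.scale/=; ring.
  have d2 := is_derive1_comp (g := fun z => x - z) (smooth_is_derive (x - y) s2) d1.
  have -> : (fun z => - psi (x - z)) = - (psi \o (fun z => x - z)) by [].
  by apply: is_derive_eq; ring.
have cs : continuous (fun y => derive1 psi (x - y)).
  move=> y; apply: continuous_comp; last exact: c3.
  by apply: cvgB; [exact: cvg_cst|exact: cvg_id].
have vs (q : R -> R) : vanishes_outside b q -> vanishes_outside (`|x| + b) (fun y => q (x - y)).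
  move=> qb y yb; rewrite qb//.
  by have := ler_dist_dist x y; rewrite ler_norml => /andP[]; lra.
have vs' : vanishes_outside (`|x| + b) (fun y => - psi (x - y)).
  by move=> y yb; rewrite (vs _ psib y yb) oppr0.
have [T0 Th] := total_derivative d cs vs' (vs _ psib').
have sp := summable_continuous_vanishing cs (vs _ psib').
have sh : summable (fun y => if 0 < y then derive1 psi (x - y) else 0).
  apply: (summable_le_norm _ sp).
    apply: measurable_fun_ifT => //; first exact: measurable_fun_ltr.
    exact: continuous_measurable_fun.
  by move=> y; case: ifP => // _; rewrite normr0.
(* Off the origin the sign function is twice the indicator of the positive half-line minus 1. The
   indicator integrates the derivative to [psi x], and the constant contributes 0. *)
rewrite (total_ae (g := fun y => riesz_constant *
  (2 * (if 0 < y then derive1 psi (x - y) else 0) - derive1 psi (x - y)))).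
- rewrite (totalZ _ (summableB (summableZ 2 sh) sp)) (totalB (summableZ 2 sh) sp).
  by rewrite (totalZ 2 sh) T0 Th opprK !subr0 mulrA [2 * _]mulrC.
- have -> : frac_diff (2 + a) J = fun y => Num.sg y * riesz_constant.
    by apply/funext => y; exact: (summable_J y).2.1.
  apply: measurable_funM; last exact: continuous_measurable_fun.
  apply: measurable_funM => //.
  have -> : @Num.sg R = fun y => if 0 < y then 1 else if y < 0 then -1 else 0.
    by apply/funext => y; case: sgrP.
  by apply: measurable_fun_ifT => //; [|apply: measurable_fun_ifT => //]; exact: measurable_fun_ltr.
- apply: measurable_funM => //; apply: measurable_funB; last exact: continuous_measurable_fun.
  by apply: measurable_funM => //; exact: summable_measurable sh.
have : {ae (@lebesgue_measure R), forall x, x != 0}.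
  exists [set 0]; split => //; first exact: lebesgue_measure_set1.
  by move=> y /= /negP/negPn/eqP.
apply: ae_imply => y y0; rewrite (summable_J y).2.1.
have [yp|yn|/eqP] := ltgtP 0 y; last by rewrite eq_sym (negbTE y0).
  by rewrite gtr0_sg//; ring.
by rewrite ltr0_sg//; ring.
Qed.

End fundamental_solution.

(** * The truncated fundamental solution *)

Section second_differences.
Context {R : realType}.
Implicit Types (a b c r x y z t h : R) (f g : R -> R).

Lemma powR_invl x a : 0 < x -> x^-1 `^ a = (x `^ a)^-1.
Proof. by move=> x0; rewrite -powRN -(powR_inv1 (ltW x0)) -powRrM mulN1r. Qed.

(** The points [y] and [2 x - y] are at distance [2 |y - x|], whence the factor 2. The second
    derivative is bounded only near [x], which allows the bound to depend on the location. *)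
Lemma diff2_derive2_bound f f1 f2 x t c :
  (forall y, is_derive y 1 f (f1 y)) -> (forall y, is_derive y 1 f1 (f2 y)) ->
  (forall y, `|y - x| <= `|t| -> `|f2 y| <= c) ->
  `|diff2 f x t| <= 2 * c * t ^+ 2.
Proof.
move=> df df1 f2c; apply: (diff2_bound (F := f1)) => y yx.
have key u v : u <= v -> `|u - x| <= `|t| -> `|v - x| <= `|t| ->
    `|f1 v - f1 u| <= c * (v - u).
  rewrite le_eqVlt => /predU1P[->|uv]; first by rewrite !subrr normr0 mulr0.
  move=> ux vx; have cf1 : {within `[u, v], continuous f1}.
    by apply: continuous_subspaceT => w; exact: is_derive_continuous (df1 w).
  have [w /andP[] wuv _ ->] : exists2 w, (w \in `]u, v[) && true & f1 v - f1 u = f2 w * (v - u).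
    by have [w wuv E] := MVT uv (fun w _ => df1 w) cf1; exists w; rewrite ?wuv.
  rewrite normrM (gtr0_norm (_ : 0 < v - u)) ?subr_gt0// ler_wpM2r ?subr_ge0 ?(ltW uv)//.
  apply: f2c; move: wuv ux vx; rewrite in_itv/= !ler_norml => /andP[? ?] /andP[? ?] /andP[? ?].
  by apply/andP; split; lra.
have [yx'|/ltW yx'] := leP y (2 * x - y).
  rewrite distrC (le_trans (key _ _ yx' yx _))//.
    by rewrite (_ : 2 * x - y - x = - (y - x)) ?normrN//; ring.
  by rewrite ler0_norm; lra.
rewrite (le_trans (key _ _ yx' _ yx))//.
  by rewrite (_ : 2 * x - y - x = - (y - x)) ?normrN//; ring.
by rewrite ger0_norm; lra.
Qed.

Lemma diff2_min_bound f f1 f2 b c x t :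
  (forall y, is_derive y 1 f (f1 y)) -> (forall y, is_derive y 1 f1 (f2 y)) ->
  (forall y, `|f y| <= b) -> (forall y, `|f2 y| <= c) ->
  `|diff2 f x t| <= (4 * b + 2 * c) * Num.min 1 (t ^+ 2).
Proof.
move=> df df1 fb f2c.
have b0 : 0 <= b by rewrite (le_trans _ (fb 0)).
have c0 : 0 <= c by rewrite (le_trans _ (f2c 0)).
have h1 := diff2_derive2_bound (t := t) df df1 (fun y (_ : `|y - x| <= `|t|) => f2c y).
have h2 : `|diff2 f x t| <= 4 * b.
  rewrite /diff2 (le_trans (ler_normB _ _))// (le_trans (lerD (ler_normB _ _) (lexx _)))//.
  by rewrite normrM ger0_norm//; have := fb x; have := fb (x + t); have := fb (x - t); lra.
have t0 := sqr_ge0 t.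
rewrite minEle; case: ifPn => _; first by rewrite mulr1; lra.
by rewrite (le_trans h1)// ler_wpM2r//; lra.
Qed.

(** The power of 4 stems from splitting the integral at the radius [(1 + |x|) / 4], the summand 2
    from the two translates [f (x + t)] and [f (x - t)]. *)
Definition decay_constant a := 4 `^ (2 + a) *
  (total (fun t : R => Num.min 1 (t ^+ 2) * `|t| `^ (- (2 + a))) + 2).

(** Let [r = (1 + |x|) / 4]. For [|t| <= r] the second derivative is [O(r^(-3))], so the second
    difference is [O((t / r)^2 / r)]. For [|t| > r] the value [f x] is [O(1 / r)], while the
    translates are integrated against a weight of size at most [r^(-(2 + a))]. After rescaling,
    every contribution has order [r^(-(2 + a))]. *)
Lemma frac_diff_decay a f f1 f2 c x : 0 < a -> a < 1 ->
  (forall y, is_derive y 1 f (f1 y)) -> (forall y, is_derive y 1 f1 (f2 y)) ->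
  (forall y, `|f y| <= c * (1 + `|y|)^-1) -> (forall y, `|f2 y| <= c * (1 + `|y|) ^- 3) ->
  summable f -> total (fun y => `|f y|) <= c ->
  `|frac_diff (2 + a) f x| <= decay_constant a * c * (1 + `|x|) `^ (- (2 + a)).
Proof.
move=> a0 a1 df df1 fc f2c sf tf.
have x1 : 0 < 1 + `|x| by rewrite ltr_pwDl.
have [r r0 xr] : exists2 r, 0 < r & 1 + `|x| = 4 * r.
  by exists ((1 + `|x|) / 4); [exact: divr_gt0|field].
have ri0 : r^-1 != 0 by rewrite gt_eqF// invr_gt0.
have c0 : 0 <= c.
  have := fc 0; rewrite normr0 addr0 invr1 mulr1; exact: le_trans.
have cf : continuous f by move=> y; exact: is_derive_continuous (df y).
have mf := continuous_measurable_fun cf.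
pose w t := Num.min 1 (t ^+ 2) * `|t| `^ (- (2 + a)).
have mw : measurable_fun setT w.
  apply: measurable_funM; last exact: measurable_powR_norm.
  by apply: measurable_minr => //; exact: exprn_measurable.
have sw : summable w.
  apply: (summable_le mw (summable_singular_weight a0 a1)) => t.
  rewrite ger0_norm; first exact: min_sqr_singular_weight.
  by rewrite mulr_ge0 ?powR_ge0// le_min ler01 sqr_ge0.
have swr := summable_affine 0 ri0 sw.
have s1 := summable_norm (summable_shift x sf).
have s2 := summable_norm (summable_reflect x sf).
pose dom t := c * r^-1 * (r `^ (- (2 + a)) * w (r^-1 * t + 0)) +
  r `^ (- (2 + a)) * (`|f (t + x)| + `|f (x - t)|).
have sd : summable dom.
  apply: summableD; first by do 2 apply: summableZ.
  by apply: summableZ; exact: summableD.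
have bound t : `|diff2 f x t * `|t| `^ (- (2 + a))| <= dom t.
  rewrite normrM (ger0_norm (powR_ge0 _ _)) /dom.
  have [->|t0] := eqVneq t 0.
    rewrite normr0 [X in _ * X]powR0; last by rewrite oppr_eq0 gt_eqF// addr_gt0.
    rewrite mulr0 addr_ge0 ?mulr_ge0 ?powR_ge0 ?addr_ge0 ?invr_ge0 ?(ltW r0)//.
    by rewrite le_min ler01 sqr_ge0.
  have nt : 0 < `|t| by rewrite normr_gt0.
  have -> : r `^ (- (2 + a)) * w (r^-1 * t + 0) =
      Num.min 1 ((t / r) ^+ 2) * `|t| `^ (- (2 + a)).
    rewrite /w addr0 [r^-1 * t]mulrC normrM normfV (gtr0_norm r0) powRM ?invr_ge0 ?(ltW r0)//.
    by rewrite powR_invl//; field; rewrite gt_eqF// powR_gt0.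
  have [tr|tr] := leP `|t| r.
    (* Here [1 + |y| >= 4 r - r = 3 r]. *)
    have f2r y : `|y - x| <= `|t| -> `|f2 y| <= c * (3 * r) ^- 3.
      move=> yx; rewrite (le_trans (f2c y))// ler_wpM2l//.
      rewrite lef_pV2 ?posrE ?exprn_gt0 ?mulr_gt0 ?ltr_pwDl//.
      rewrite lerXn2r ?nnegrE ?mulr_ge0 ?addr_ge0 ?(ltW r0)//.
      have := ler_dist_dist y x; rewrite ler_norml => /andP[]; lra.
    have := diff2_derive2_bound df df1 f2r.
    have tr2 : (t / r) ^+ 2 <= 1.
      by rewrite -real_normK ?num_real// expr_le1// normrM normfV (gtr0_norm r0) ler_pdivrMr// mul1r.
    rewrite (min_idPr tr2) => h.
    rewrite (@le_trans _ _ (c * r^-1 * ((t / r) ^+ 2 * `|t| `^ (- (2 + a)))))//; last first.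
      by rewrite lerDl mulr_ge0 ?powR_ge0 ?addr_ge0.
    rewrite mulrA ler_wpM2r ?powR_ge0// (le_trans h)//.
    have -> : 2 * (c * (3 * r) ^- 3) * t ^+ 2 = 2 / 27 * (c / r * (t / r) ^+ 2).
      by field; rewrite gt_eqF.
    have : 0 <= c / r * (t / r) ^+ 2 by rewrite mulr_ge0 ?sqr_ge0// divr_ge0// ltW.
    by move: (c / r * (t / r) ^+ 2) => X; lra.
  have tr2 : 1 <= (t / r) ^+ 2.
    by rewrite -real_normK ?num_real// exprn_ege1// normrM normfV (gtr0_norm r0) ler_pdivlMr// mul1r ltW.
  rewrite (min_idPl tr2) mul1r.
  have ptr : `|t| `^ (- (2 + a)) <= r `^ (- (2 + a)).
    rewrite !powRN lef_pV2 ?posrE ?powR_gt0// ge0_ler_powR ?nnegrE ?(ltW r0) ?(ltW nt) ?(ltW tr)//.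
    by rewrite addr_ge0// ltW.
  have fx : 2 * `|f x| <= c * r^-1.
    have := fc x; rewrite xr => h.
    have -> : c / r = 4 * (c / (4 * r)) by field; rewrite gt_eqF.
    have : 0 <= c / (4 * r) by rewrite divr_ge0// mulr_ge0// ltW.
    lra.
  rewrite /diff2 [x + t]addrC.
  have h : `|2 * f x - f (t + x) - f (x - t)| <= 2 * `|f x| + (`|f (t + x)| + `|f (x - t)|).
    rewrite (le_trans (ler_normB _ _))// addrA lerD2r (le_trans (ler_normB _ _))//.
    by rewrite normrM ger0_norm.
  rewrite (le_trans (ler_wpM2r (powR_ge0 _ _) h))// mulrDl lerD//.
    by rewrite ler_wpM2r ?powR_ge0.
  by rewrite mulrC ler_wpM2r ?addr_ge0.
rewrite (le_trans (total_norm_le_dom _ sd bound))//.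
  exact: measurable_frac_diff_integrand.
rewrite /dom totalD; [|by do 2 apply: summableZ|by apply: summableZ; exact: summableD].
rewrite (totalZ _ (summableZ _ swr)) (totalZ _ swr) (totalZ _ (summableD s1 s2)).
rewrite (totalD s1 s2) (total_affine 0 ri0 sw).
rewrite (total_shift x (summable_norm sf)) (total_reflect x (summable_norm sf)).
rewrite normfV invrK (gtr0_norm r0) xr powRM ?(ltW r0)// /decay_constant.
rewrite -/w.
have p4 : 4 `^ (2 + a) * 4 `^ (- (2 + a)) = 1 :> R.
  by rewrite -powRD_gt0// subrr powRr0.
have -> : 4 `^ (2 + a) * (total w + 2) * c * (4 `^ (- (2 + a)) * r `^ (- (2 + a))) =
   (4 `^ (2 + a) * 4 `^ (- (2 + a))) * ((total w + 2) * c * r `^ (- (2 + a))) by ring.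
rewrite p4 mul1r.
have -> : c / r * (r `^ (- (2 + a)) * (r * total w)) = c * (r `^ (- (2 + a)) * total w).
  by field; rewrite gt_eqF.
have := ler_wpM2l (powR_ge0 r (- (2 + a))) tf.
lra.
Qed.

Lemma is_derive_quotient_cvg f x c : is_derive x 1 f c ->
  (fun h => h^-1 * (f (h + x) - f x)) @ (0 : R)^' --> c.
Proof.
move=> [df <-]; have E : (fun h : R => h^-1 *: (f (h *: (1 : R) + x) - f x)) =
    (fun h => h^-1 * (f (h + x) - f x)).
  by apply/funext => h; rewrite /GRing.scale/= mulr1.
by move: df; rewrite /derivable /derive E.
Qed.

Lemma is_derive_glue f g x c : f x = g x -> is_derive x 1 f c -> is_derive x 1 g c ->
  is_derive x 1 (fun z => if x < z then f z else g z) c.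
Proof.
move=> fgx /is_derive_quotient_cvg df /is_derive_quotient_cvg dg.
apply: is_derive_quotient; apply/cvgrPdist_le => e e0; near=> h.
rewrite ltxx; case: ifPn => _.
  by rewrite -fgx; near: h; move/cvgrPdist_le : df; exact.
by near: h; move/cvgrPdist_le : dg; exact.
Unshelve. all: end_near. Qed.

Lemma is_derive_glue_all f f1 g g1 x : f x = g x -> f1 x = g1 x ->
  (forall z, x <= z -> is_derive z 1 f (f1 z)) ->
  (forall z, is_derive z 1 g (g1 z)) ->
  forall z, is_derive z 1 (fun z => if x < z then f z else g z)
    (if x < z then f1 z else g1 z).
Proof.
move=> fgx fgx1 df dg z; have [xz|zx|<-] := ltgtP x z.
- have := df z (ltW xz); apply: is_derive_near; near=> y; rewrite ifT//.
  by near: y; exact: lt_nbhsr.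
- have := dg z; apply: is_derive_near; near=> y; rewrite ifF//.
  apply/negbTE; rewrite -leNgt ltW//; near: y; exact: lt_nbhsl.
- apply: is_derive_glue => //.
  by rewrite -fgx1; exact: df.
Unshelve. all: end_near. Qed.

End second_differences.

(** * A regularised power kernel and the decay of its second derivative *)

Section truncated_kernel.
Context {R : realType}.
Variable a : R.
Hypotheses (a0 : 0 < a) (a1 : a < 1).
Implicit Types (c q r x y z : R) (f g psi : R -> R).

(** Falling factorial of [a / 2], that is, the derivative of order [k] of [z^(a / 2)] at 1. *)
Definition taylor_coef (k : nat) : R := \prod_(i < k) (a / 2 - i%:R).

Notation b := (a / 2).
Notation c1 := (taylor_coef 1).
Notation c2 := (taylor_coef 2).
Notation c3 := (taylor_coef 3).
Notation c4 := (taylor_coef 4).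

Let taylor_coefE : [/\ c1 = b, c2 = c1 * (b - 1), c3 = c2 * (b - 2) & c4 = c3 * (b - 3)].
Proof.
by rewrite /taylor_coef !big_ord_recr !big_ord0/= !mul1r subr0.
Qed.

(* [z `^ (a / 2)] for [z > 1], prolonged to [z <= 1] by its Taylor polynomial of
   degree 4 at 1; [theta1] to [theta4] are the successive derivatives. *)
Definition theta0 z := if 1 < z then z `^ b else
  1 + c1 * (z - 1) + c2 / 2 * (z - 1) ^+ 2 + c3 / 6 * (z - 1) ^+ 3 + c4 / 24 * (z - 1) ^+ 4.
Definition theta1 z := if 1 < z then c1 * z `^ (b - 1)
  else c1 + c2 * (z - 1) + c3 / 2 * (z - 1) ^+ 2 + c4 / 6 * (z - 1) ^+ 3.
Definition theta2 z := if 1 < z then c2 * z `^ (b - 2)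
  else c2 + c3 * (z - 1) + c4 / 2 * (z - 1) ^+ 2.
Definition theta3 z := if 1 < z then c3 * z `^ (b - 3) else c3 + c4 * (z - 1).
Definition theta4 z := if 1 < z then c4 * z `^ (b - 4) else c4.

Let is_derive_scaled_powR c q z : 1 <= z ->
  is_derive z 1 (fun z => c * z `^ q) (c * q * z `^ (q - 1)).
Proof.
move=> z1; have z0 : 0 < z by exact: lt_le_trans z1.
have d := is_derive1_powR q z0.
have -> : (fun z => c * z `^ q) = c \*: (fun z => z `^ q) by [].
by apply: is_derive_eq; rewrite /GRing.scale/= mulrA.
Qed.

Let is_derive_theta0 z : is_derive z 1 theta0 (theta1 z).
Proof.
have [e1 e2 e3 e4] := taylor_coefE.
apply: (@is_derive_glue_all _ (fun z => z `^ b) (fun z => c1 * z `^ (b - 1))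
  (fun z => 1 + c1 * (z - 1) + c2 / 2 * (z - 1) ^+ 2 + c3 / 6 * (z - 1) ^+ 3 + c4 / 24 * (z - 1) ^+ 4)
  (fun z => c1 + c2 * (z - 1) + c3 / 2 * (z - 1) ^+ 2 + c4 / 6 * (z - 1) ^+ 3) 1).
- by rewrite powR1 subrr; ring.
- by rewrite powR1 subrr; ring.
- by move=> y y1; rewrite e1; apply: is_derive1_powR; exact: lt_le_trans y1.
- by move=> y; apply: is_derive_eq; rewrite /GRing.scale/=; field.
Qed.

Let is_derive_theta1 z : is_derive z 1 theta1 (theta2 z).
Proof.
have [e1 e2 e3 e4] := taylor_coefE.
apply: (@is_derive_glue_all _ (fun z => c1 * z `^ (b - 1)) (fun z => c2 * z `^ (b - 2))
  (fun z => c1 + c2 * (z - 1) + c3 / 2 * (z - 1) ^+ 2 + c4 / 6 * (z - 1) ^+ 3)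
  (fun z => c2 + c3 * (z - 1) + c4 / 2 * (z - 1) ^+ 2) 1).
- by rewrite powR1 subrr; ring.
- by rewrite powR1 subrr; ring.
- move=> y y1; have := is_derive_scaled_powR c1 (b - 1) y1.
  by rewrite e2 (_ : b - 1 - 1 = b - 2)//; ring.
- by move=> y; apply: is_derive_eq; rewrite /GRing.scale/=; field.
Qed.

Let is_derive_theta2 z : is_derive z 1 theta2 (theta3 z).
Proof.
have [e1 e2 e3 e4] := taylor_coefE.
apply: (@is_derive_glue_all _ (fun z => c2 * z `^ (b - 2)) (fun z => c3 * z `^ (b - 3))
  (fun z => c2 + c3 * (z - 1) + c4 / 2 * (z - 1) ^+ 2) (fun z => c3 + c4 * (z - 1)) 1).
- by rewrite powR1 subrr; ring.
- by rewrite powR1 subrr; ring.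
- move=> y y1; have := is_derive_scaled_powR c2 (b - 2) y1.
  by rewrite e3 (_ : b - 2 - 1 = b - 3)//; ring.
- by move=> y; apply: is_derive_eq; rewrite /GRing.scale/=; field.
Qed.

Let is_derive_theta3 z : is_derive z 1 theta3 (theta4 z).
Proof.
have [e1 e2 e3 e4] := taylor_coefE.
apply: (@is_derive_glue_all _ (fun z => c3 * z `^ (b - 3)) (fun z => c4 * z `^ (b - 4))
  (fun z => c3 + c4 * (z - 1)) (fun=> c4) 1).
- by rewrite powR1 subrr; ring.
- by rewrite powR1; ring.
- move=> y y1; have := is_derive_scaled_powR c3 (b - 3) y1.
  by rewrite e4 (_ : b - 3 - 1 = b - 4)//; ring.
- by move=> y; apply: is_derive_eq; rewrite /GRing.scale/=; ring.
Qed.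

(** Composition with the square yields [|x|^a] for [|x| > 1] and a polynomial in [x^2] inside. The
    second and fourth derivatives are [G] and [G2]; degree 4 of the Taylor polynomial is what lets
    [G] be differentiated twice across [|x| = 1]. *)
Let g x := theta0 (x ^+ 2).
Let g1 x := 2 * x * theta1 (x ^+ 2).
Let G x := 2 * theta1 (x ^+ 2) + 4 * (x ^+ 2 * theta2 (x ^+ 2)).
Let G1 x := 12 * x * theta2 (x ^+ 2) + 8 * x ^+ 3 * theta3 (x ^+ 2).
Let G2 x := 12 * theta2 (x ^+ 2) + 48 * (x ^+ 2 * theta3 (x ^+ 2)) +
  16 * (x ^+ 4 * theta4 (x ^+ 2)).

Let is_derive_sqr_comp f c x : is_derive (x ^+ 2) 1 f c ->
  is_derive x 1 (fun x => f (x ^+ 2)) (2 * x * c).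
Proof.
move=> d; have d2 : is_derive x 1 (fun x => x ^+ 2) (2 * x).
  by apply: is_derive_eq; rewrite /GRing.scale/=; ring.
have := is_derive1_comp (g := fun x => x ^+ 2) d d2.
by rewrite mulrC.
Qed.

Let dg x : is_derive x 1 g (g1 x).
Proof. exact: is_derive_sqr_comp (is_derive_theta0 _). Qed.

Let dg1 x : is_derive x 1 g1 (G x).
Proof.
have d := is_derive_sqr_comp (is_derive_theta1 (x ^+ 2)).
have -> : g1 = (fun x => 2 * x) * (fun x => theta1 (x ^+ 2)) by [].
apply: is_derive_eq; rewrite /G /GRing.scale/=.
by ring.
Qed.

Let dG x : is_derive x 1 G (G1 x).
Proof.
have d1 := is_derive_sqr_comp (is_derive_theta1 (x ^+ 2)).
have d2 := is_derive_sqr_comp (is_derive_theta2 (x ^+ 2)).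
have -> : G = (2 \*: (fun x => theta1 (x ^+ 2))) +
  (4 \*: ((fun x => x ^+ 2) * (fun x => theta2 (x ^+ 2)))) by [].
by apply: is_derive_eq; rewrite /G1 /GRing.scale/=; ring.
Qed.

Let dG1 x : is_derive x 1 G1 (G2 x).
Proof.
have d1 := is_derive_sqr_comp (is_derive_theta2 (x ^+ 2)).
have d2 := is_derive_sqr_comp (is_derive_theta3 (x ^+ 2)).
have -> : G1 = ((fun x => 12 * x) * (fun x => theta2 (x ^+ 2))) +
  ((fun x => 8 * x ^+ 3) * (fun x => theta3 (x ^+ 2))) by [].
apply: is_derive_eq; rewrite /G2 /GRing.scale/=.
by ring.
Qed.

Let C : R := 1 + `|c1| + `|c2| + `|c3| + `|c4|.

Let C_ge0 : 0 <= C. Proof. by rewrite /C !addr_ge0. Qed.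

Let outer q x := if 1 < `|x| then `|x| `^ (- q) else 1.

(** Outside the unit ball a term [x^(2j)] times the derivative of [theta0] of order [k] at [x^2] is
    homogeneous of degree [a - 2 (k - j)]; inside, [P] is the polynomial branch, bounded by [C]. *)
Let glued_bound (j k : nat) c P x : `|c| <= C ->
  (forall z, 0 <= z -> z <= 1 -> `|P z| <= C) ->
  `|x ^+ (2 * j) * (if 1 < x ^+ 2 then c * (x ^+ 2) `^ (b - k%:R) else P (x ^+ 2))|
    <= C * outer (2 * k%:R - 2 * j%:R - a) x.
Proof.
move=> cC PC; rewrite /outer.
have x2 : x ^+ 2 = `|x| ^+ 2 by rewrite real_normK ?num_real.
have -> : (1 < x ^+ 2) = (1 < `|x|) by rewrite x2 expr_gt1.
have xj : `|x ^+ (2 * j)| = `|x| ^+ (2 * j) by rewrite normrX.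
rewrite normrM xj; case: ifPn => [x1|].
  have nx : 0 < `|x| by exact: lt_trans x1.
  rewrite normrM (ger0_norm (powR_ge0 _ _)) x2.
  have -> : `|x| ^+ (2 * j) * (`|c| * (`|x| ^+ 2) `^ (b - k%:R)) =
      `|c| * `|x| `^ (- (2 * k%:R - 2 * j%:R - a)).
    rewrite mulrCA -!powR_mulrn// -powRrM -powRD_gt0//; congr (_ * _ `^ _).
    by rewrite natrM mulrBr [2 * b]mulrC divfK//; ring.
  by rewrite ler_wpM2r ?powR_ge0.
rewrite -leNgt => x1; rewrite mulr1.
rewrite -[leRHS]mul1r ler_pM ?exprn_ge0//; first exact: exprn_ile1.
by apply: PC; rewrite ?sqr_ge0// x2 expr_le1.
Qed.

Let outer_le q x : 0 <= q -> outer q x <= 2 `^ q * (1 + `|x|) `^ (- q).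
Proof.
move=> q0; rewrite /outer (powRN (1 + `|x|)) -powR_invl ?ltr_pwDl// -powRM ?invr_ge0 ?addr_ge0//.
case: ifPn => [x1|].
  have nx : 0 < `|x| by exact: lt_trans x1.
  rewrite powRN -powR_invl// ge0_ler_powR ?nnegrE ?invr_ge0 ?mulr_ge0 ?invr_ge0 ?addr_ge0//.
  rewrite ler_pdivlMr ?ltr_pwDl// mulrC ler_pdivrMr//; lra.
rewrite -leNgt => x1; apply: (@le_trans _ _ (1 `^ q)); first by rewrite powR1.
rewrite ge0_ler_powR ?nnegrE ?mulr_ge0 ?invr_ge0 ?addr_ge0//.
rewrite ler_pdivlMr ?ltr_pwDl//; lra.
Qed.

Let norm_sub1 z : 0 <= z -> z <= 1 -> `|z - 1| <= 1.
Proof. by move=> z0 z1; rewrite ler_norml; apply/andP; split; lra. Qed.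

Let term_le c (k : nat) d z : 0 <= z -> z <= 1 -> 0 <= d -> d <= 1 ->
  `|c * d * (z - 1) ^+ k| <= `|c|.
Proof.
move=> z0 z1 d0 d1; rewrite !normrM (ger0_norm d0) normrX -mulrA ler_piMr//.
by rewrite mulr_ile1 ?exprn_ge0 ?exprn_ile1// norm_sub1.
Qed.

Let ler_norm_sum3 (u v w : R) : `|u + v + w| <= `|u| + `|v| + `|w|.
Proof. by rewrite (le_trans (ler_normD _ _))// lerD2r ler_normD. Qed.

Let P1_le z : 0 <= z -> z <= 1 ->
  `|c1 + c2 * (z - 1) + c3 / 2 * (z - 1) ^+ 2 + c4 / 6 * (z - 1) ^+ 3| <= C.
Proof.
move=> z0 z1; rewrite (le_trans (ler_normD _ _))//.
have h1 := ler_norm_sum3 c1 (c2 * (z - 1)) (c3 / 2 * (z - 1) ^+ 2).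
have h2 : `|c2 * (z - 1)| <= `|c2|.
  by have := @term_le c2 1 1 z z0 z1; rewrite mulr1 expr1; apply.
have h3 : `|c3 / 2 * (z - 1) ^+ 2| <= `|c3| by apply: term_le => //; lra.
have h4 : `|c4 / 6 * (z - 1) ^+ 3| <= `|c4| by apply: term_le => //; lra.
by rewrite /C; lra.
Qed.

Let P2_le z : 0 <= z -> z <= 1 -> `|c2 + c3 * (z - 1) + c4 / 2 * (z - 1) ^+ 2| <= C.
Proof.
move=> z0 z1.
have h1 := ler_norm_sum3 c2 (c3 * (z - 1)) (c4 / 2 * (z - 1) ^+ 2).
have h3 : `|c3 * (z - 1)| <= `|c3|.
  by have := @term_le c3 1 1 z z0 z1; rewrite mulr1 expr1; apply.
have h4 : `|c4 / 2 * (z - 1) ^+ 2| <= `|c4| by apply: term_le => //; lra.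
by have := normr_ge0 c1; rewrite /C; lra.
Qed.

Let P3_le z : 0 <= z -> z <= 1 -> `|c3 + c4 * (z - 1)| <= C.
Proof.
move=> z0 z1; have h1 := ler_normD c3 (c4 * (z - 1)).
have h4 : `|c4 * (z - 1)| <= `|c4|.
  by have := @term_le c4 1 1 z z0 z1; rewrite mulr1 expr1; apply.
by have := normr_ge0 c1; have := normr_ge0 c2; rewrite /C; lra.
Qed.

Let coef_le : [/\ `|c1| <= C, `|c2| <= C, `|c3| <= C & `|c4| <= C].
Proof.
by have := normr_ge0 c1; have := normr_ge0 c2; have := normr_ge0 c3; have := normr_ge0 c4;
  rewrite /C; split; lra.
Qed.

(** The factor 6 is the sum [2 + 4] of the coefficients in [G], and 4 bounds [2^(2 - a)]. In
    [G2_bound] they become [76 = 12 + 48 + 16] and [16 >= 2^(4 - a)]. *)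
Let G_bound x : `|G x| <= 6 * C * 4 * (1 + `|x|) `^ (- (2 - a)).
Proof.
have ha0 := a0; have ha1 := a1; have [e1 e2 e3 e4] := coef_le.
have h1 := @glued_bound 0 1 c1 _ x e1 P1_le.
have h2 := @glued_bound 1 2 c2 _ x e2 P2_le.
rewrite muln0 expr0 mul1r !(mulr0, mulr1, subr0) -/(theta1 _) in h1.
rewrite muln1 mulr1 -/(theta2 _) (_ : 2 * 2 - 2 - a = 2 - a) in h2; last by ring.
have h : `|G x| <= 6 * (C * outer (2 - a) x).
  rewrite /G (le_trans (ler_normD _ _))//.
  have n1 (u v : R) : 0 <= u -> `|u * v| = u * `|v| by move=> u0; rewrite normrM ger0_norm.
  by rewrite !(n1 2, n1 4)//; lra.
rewrite (le_trans h)// -!mulrA ler_wpM2l// ler_wpM2l//.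
have o : outer (2 - a) x <= 2 `^ (2 - a) * (1 + `|x|) `^ (- (2 - a)) by apply: outer_le; lra.
rewrite (le_trans o)//.
rewrite ler_wpM2r ?powR_ge0// (_ : 4 = 2 `^ 2).
  by rewrite ler_powR ?ler1n//; lra.
by rewrite powR_mulrn//; ring.
Qed.

Let G2_bound x : `|G2 x| <= 76 * C * 16 * (1 + `|x|) `^ (- (4 - a)).
Proof.
have ha0 := a0; have ha1 := a1; have [e1 e2 e3 e4] := coef_le.
have h1 := @glued_bound 0 2 c2 _ x e2 P2_le.
have h2 := @glued_bound 1 3 c3 _ x e3 P3_le.
have h3 := @glued_bound 2 4 c4 (fun=> c4) x e4 (fun _ _ _ => e4).
rewrite muln0 expr0 mul1r !(mulr0, subr0) -/(theta2 _) (_ : 2 * 2 - a = 4 - a) in h1; last by ring.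
rewrite muln1 mulr1 -/(theta3 _) (_ : 2 * 3 - 2 - a = 4 - a) in h2; last by ring.
rewrite -/(theta4 _) (_ : 2 * 4 - 2 * 2 - a = 4 - a) in h3; last by ring.
have h : `|G2 x| <= 76 * (C * outer (4 - a) x).
  rewrite /G2 (le_trans (ler_norm_sum3 _ _ _))//.
  have n1 (u v : R) : 0 <= u -> `|u * v| = u * `|v| by move=> u0; rewrite normrM ger0_norm.
  by rewrite !(n1 12, n1 48, n1 16)//; rewrite (_ : x ^+ (2 * 2) = x ^+ 4)// in h3; lra.
rewrite (le_trans h)// -!mulrA ler_wpM2l// ler_wpM2l//.
have o : outer (4 - a) x <= 2 `^ (4 - a) * (1 + `|x|) `^ (- (4 - a)) by apply: outer_le; lra.
rewrite (le_trans o)//.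
rewrite ler_wpM2r ?powR_ge0// (_ : 16 = 2 `^ 4).
  by rewrite ler_powR ?ler1n//; lra.
by rewrite powR_mulrn//; ring.
Qed.

(** Scaling by [r] with amplitude [r^q]: each differentiation lowers [q] by 1, and for [q = a] the
    function [|x|^a] is left unchanged. *)
Let scaled r q f x := r `^ q * f (r^-1 * x + 0).

Let is_derive_scaled r q f (f' : R -> R) x : 0 < r -> (forall y, is_derive y 1 f (f' y)) ->
  is_derive x 1 (scaled r q f) (scaled r (q - 1) f' x).
Proof.
move=> r0 df; have d1 : is_derive x 1 (fun x => r^-1 * x + 0) r^-1.
  by apply: is_derive_eq; rewrite /GRing.scale/=; ring.
have d2 := is_derive1_comp (g := fun x => r^-1 * x + 0) (df _) d1.
have -> : scaled r q f = r `^ q \*: (f \o (fun x => r^-1 * x + 0)) by [].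
apply: is_derive_eq; rewrite /scaled /GRing.scale/= powRD_gt0// powRN powRr1 ?ltW//.
by ring.
Qed.

Let scaled_bound r c q f x : 0 < r -> (forall y, `|f y| <= c * (1 + `|y|) `^ (- q)) ->
  `|scaled r (- q) f x| <= c * (r + `|x|) `^ (- q).
Proof.
move=> r0 fc; rewrite /scaled normrM (ger0_norm (powR_ge0 _ _)).
rewrite (le_trans (ler_wpM2l (powR_ge0 _ _) (fc _)))// mulrCA.
rewrite -powRM ?(ltW r0) ?addr_ge0//.
rewrite addr0 normrM normfV (gtr0_norm r0) mulrDr mulr1 mulVKf// gt_eqF//.
Qed.

Let c_total : R := 76 * C * 16 * (1 + total (fun x : R => (1 + `|x|) `^ (- (2 - a)))).

Let c_total_ge : 6 * C * 4 <= c_total /\ 76 * C * 16 <= c_total.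
Proof.
have w0 : 0 <= total (fun x : R => (1 + `|x|) `^ (- (2 - a))).
  by apply: total_ge0 => x; exact: powR_ge0.
have h : 76 * C * 16 <= c_total by rewrite /c_total ler_peMr ?lerDl// !mulr_ge0.
by split=> //; rewrite (le_trans _ h)//; have := C_ge0; lra.
Qed.

(* [|.|^a - g] is supported in the ball of radius [r], and [G] is [g'']. *)
Lemma exists_truncated_kernel : exists2 c, 0 <= c & forall r, 1 <= r ->
  exists g G : R -> R, [/\ continuous g, (forall x, r < `|x| -> g x = `|x| `^ a),
    (forall psi x, test_function psi ->
       convolve g (derive1 (derive1 psi)) x = convolve G psi x) &
    [/\ continuous G, (forall x, `|G x| <= c * r `^ (- (1 - a))),
     (forall x t, `|diff2 G x t| <= c * Num.min 1 (t ^+ 2)) &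
     (forall x, `|frac_diff (2 + a) G x| <=
        c * r `^ (- (1 - a)) * (1 + `|x|) `^ (- (2 + a)))]].
Proof.
have ha0 := a0; have ha1 := a1; have [ct1 ct2] := c_total_ge.
have ct0 : 0 <= c_total by rewrite (le_trans _ ct1)// !mulr_ge0.
have dc0 : 0 <= decay_constant a.
  rewrite /decay_constant mulr_ge0 ?powR_ge0// addr_ge0// total_ge0// => t.
  by rewrite mulr_ge0 ?powR_ge0// le_min ler01 sqr_ge0.
exists ((6 + decay_constant a) * c_total); first by rewrite mulr_ge0// addr_ge0.
move=> r r1; have r0 : 0 < r by exact: lt_le_trans r1.
pose gr := scaled r a g; pose gr1 := scaled r (a - 1) g1.
pose Gr := scaled r (- (2 - a)) G; pose Gr1 := scaled r (- (2 - a) - 1) G1.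
pose Gr2 := scaled r (- (4 - a)) G2.
have dgr x : is_derive x 1 gr (gr1 x) by exact: is_derive_scaled.
have dgr1 x : is_derive x 1 gr1 (Gr x).
  by rewrite /Gr (_ : - (2 - a) = a - 1 - 1); [exact: is_derive_scaled|ring].
have dGr x : is_derive x 1 Gr (Gr1 x) by exact: is_derive_scaled.
have dGr1 x : is_derive x 1 Gr1 (Gr2 x).
  by rewrite /Gr2 (_ : - (4 - a) = - (2 - a) - 1 - 1); [exact: is_derive_scaled|ring].
have cgr : continuous gr by move=> x; exact: is_derive_continuous (dgr x).
have cgr1 : continuous gr1 by move=> x; exact: is_derive_continuous (dgr1 x).
have cGr : continuous Gr by move=> x; exact: is_derive_continuous (dGr x).
have r1a : r `^ (- (1 - a)) <= 1.
  by rewrite -[leRHS](powRr0 r) ler_powR//; lra.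
have ra0 := powR_ge0 r (- (1 - a)).
pose k := c_total * r `^ (- (1 - a)).
have k0 : 0 <= k by rewrite mulr_ge0.
have rx x : 1 + `|x| <= r + `|x| by rewrite lerD2r.
have x0 x : 0 < 1 + `|x| :> R by rewrite ltr_pwDl.
have rx0 x : 0 < r + `|x| by rewrite (lt_le_trans _ (rx x)).
(* Of the decay [(r + |x|)^(-(m + 1 - a))], the exponent [1 - a] is spent on [r] and the exponent
   [m] on [1 + |x|]; it is used for [m = 1] and [m = 3]. *)
have part (m : nat) x : (r + `|x|) `^ (- (m.+1%:R - a)) <= r `^ (- (1 - a)) * (1 + `|x|) ^- m.
  rewrite (_ : - (m.+1%:R - a) = - (1 - a) + - m%:R); last by rewrite -natr1; ring.
  rewrite powRD_gt0// ler_pM ?powR_ge0//.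
    by rewrite !powRN lef_pV2 ?posrE ?powR_gt0// ge0_ler_powR ?nnegrE ?(ltW r0) ?(ltW (rx0 x))// ?lerDl//; lra.
  by rewrite powRN powR_mulrn ?(ltW (rx0 x))// lef_pV2 ?posrE ?exprn_gt0// lerXn2r ?nnegrE ?(ltW (x0 x)) ?(ltW (rx0 x)).
have bG x : `|Gr x| <= k * (1 + `|x|)^-1.
  rewrite (le_trans (scaled_bound x r0 G_bound))// /k -(mulrA c_total) ler_pM ?powR_ge0 ?mulr_ge0//.
have bG2 x : `|Gr2 x| <= k * (1 + `|x|) ^- 3.
  rewrite (le_trans (scaled_bound x r0 G2_bound))// /k -(mulrA c_total) ler_pM ?powR_ge0 ?mulr_ge0//.
have inv_le1 (m : nat) x : (1 + `|x|) ^- m <= 1 :> R.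
  by rewrite invf_le1 ?exprn_gt0// exprn_ege1// lerDl.
have bG' x : `|Gr x| <= k by rewrite (le_trans (bG x))// ler_piMr// (inv_le1 1%N).
have bG2' x : `|Gr2 x| <= k by rewrite (le_trans (bG2 x))// ler_piMr.
have sw := @summable_weight R (2 - a) ltac:(lra).
have ri0 : r^-1 != 0 by rewrite gt_eqF// invr_gt0.
have sdom := summableZ (r `^ (- (2 - a)) * (6 * C * 4)) (summable_affine 0 ri0 sw).
have bdom x : `|Gr x| <= r `^ (- (2 - a)) * (6 * C * 4) * (1 + `|r^-1 * x + 0|) `^ (- (2 - a)).
  rewrite /Gr /scaled normrM (ger0_norm (powR_ge0 _ _)) -mulrA ler_wpM2l ?powR_ge0//.
have mGr := continuous_measurable_fun cGr.
have sGr := summable_le mGr sdom bdom.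
(* The substitution costs one power of [r], and [r^(-(2 - a)) r = r^(-(1 - a))] is again the gain
   contained in [k]. *)
have tGr : total (fun y => `|Gr y|) <= k.
  rewrite (le_trans (total_le (summable_norm sGr) sdom bdom))//.
  rewrite (totalZ _ (summable_affine 0 ri0 sw)) (total_affine 0 ri0 sw).
  rewrite normfV invrK (gtr0_norm r0) /k.
  have -> : r `^ (- (1 - a)) = r `^ (- (2 - a)) * r.
    by rewrite -[X in _ * X](powRr1 (ltW r0)) -powRD_gt0//; congr (_ `^ _); ring.
  rewrite (_ : c_total * _ = r `^ (- (2 - a)) * (r * c_total)); last by ring.
  rewrite -mulrA ler_wpM2l ?powR_ge0// mulrCA ler_wpM2l ?(ltW r0)//.
  have w0 : 0 <= total (fun x : R => (1 + `|x|) `^ (- (2 - a))).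
    by apply: total_ge0 => x; exact: powR_ge0.
  rewrite /c_total ler_pM ?mulr_ge0//; first by have := C_ge0; lra.
  by rewrite lerDr.
have kc : k <= c_total by rewrite /k ler_piMr.
exists gr, Gr; split.
- exact: cgr.
- move=> x rx'; rewrite /gr /scaled /g /theta0 addr0.
  have q1 : 1 < `|r^-1 * x|.
    by rewrite normrM normfV (gtr0_norm r0) mulrC ltr_pdivlMr// mul1r.
  have -> : (r^-1 * x) ^+ 2 = `|r^-1 * x| ^+ 2 by rewrite real_normK ?num_real.
  rewrite expr_gt1// q1 -powR_mulrn// -powRrM [2 * b]mulrC divfK//.
  rewrite -powRM ?(ltW r0)// normrM normfV (gtr0_norm r0) mulVKf ?gt_eqF//.
- move=> psi x tpsi; have tpsi' := test_function_derive tpsi.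
  by rewrite -(convolve_by_parts x dgr cgr1 tpsi') -(convolve_by_parts x dgr1 cGr tpsi).
split.
- exact: cGr.
- move=> x; rewrite (le_trans (bG' x))// -(mulrA (6 + decay_constant a)) -/k.
  by rewrite ler_peMl//; lra.
- move=> x t; rewrite (le_trans (diff2_min_bound x t dGr dGr1 bG' bG2'))//.
  rewrite ler_wpM2r//; first by rewrite le_min ler01 sqr_ge0.
  rewrite (_ : 4 * k + 2 * k = 6 * k); last by ring.
  by rewrite ler_pM//; lra.
- move=> x; rewrite (le_trans (frac_diff_decay x a0 a1 dGr dGr1 bG bG2 sGr tGr))//.
  rewrite ler_wpM2r ?powR_ge0// -(mulrA (6 + decay_constant a)) -/k ler_wpM2r//.
  by rewrite lerDr.
Qed.

End truncated_kernel.

(** * The equation in potential form *)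

Section potential.
Context {R : realType}.
Variable a : R.
Hypotheses (a0 : 0 < a) (a1 : a < 1).
Variable f : R -> R.
Hypotheses (sf : summable f) (f_ge0 : forall x, 0 <= f x).
Implicit Types (c r x y z : R) (psi eta : R -> R).

(** Subtracting [|x|^a] makes the kernel bounded in [x], by [|z|^a], so that integrability of [f]
    alone gives convergence. It changes the potential only by what is formally a constant. *)
Definition potential z := total (fun x => (`|x - z| `^ a - `|x| `^ a) * f x).

Let mf : measurable_fun setT f := summable_measurable sf.

Let measurable_kernel z : measurable_fun setT (fun x => `|x - z| `^ a - `|x| `^ a).
Proof.
apply: measurable_funB; last exact: measurable_powR_norm.
by apply: (measurableT_comp (measurable_powR_norm a)); exact: measurable_funB.
Qed.

Let kernel_le z w x : `|(`|x - z| `^ a - `|x - w| `^ a) * f x| <= `|z - w| `^ a * f x.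
Proof.
rewrite normrM (ger0_norm (f_ge0 x)) ler_wpM2r//.
rewrite (le_trans (holder_powR_norm _ _ a0 (ltW a1)))//.
by rewrite (_ : x - z - (x - w) = - (z - w)) ?normrN//; ring.
Qed.

Lemma summable_potential z : summable (fun x => (`|x - z| `^ a - `|x| `^ a) * f x).
Proof.
apply: (summable_le (measurable_funM (measurable_kernel z) mf)
  (summableZ (`|z| `^ a) sf)) => x.
by have := kernel_le z 0 x; rewrite !subr0.
Qed.

Lemma potential_holder z w : `|potential z - potential w| <= `|z - w| `^ a * total f.
Proof.
rewrite /potential -totalB; [|exact: summable_potential..].
rewrite -totalZ//; apply: total_norm_le_dom; last 1 first.
- by move=> x; rewrite -mulrBl opprB addrA subrK; exact: kernel_le.
- by apply: measurable_funB; exact: summable_measurable (summable_potential _).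
- exact: summableZ.
Qed.

Lemma potential0 : potential 0 = 0.
Proof.
rewrite /potential -[RHS](@total0 R); apply: total_ext => x.
by rewrite subr0 subrr mul0r.
Qed.

Lemma potential_le z : `|potential z| <= `|z| `^ a * total f.
Proof. by have := potential_holder z 0; rewrite potential0 !subr0. Qed.

Lemma continuous_potential : continuous potential.
Proof.
move=> z; have F0 : 0 <= total f by exact: total_ge0.
have F1 : 0 < total f + 1 by rewrite ltr_wpDl.
apply/cvgrPdist_le => e e0.
have c : (fun w => `|w| `^ a) @ (0 : R) --> `|0 : R| `^ a by exact: continuous_powR_norm.
rewrite normr0 powR0 ?gt_eqF// in c.
have cz : (fun w : R => z - w) @ z --> z - z by apply: cvgB; [exact: cvg_cst|exact: cvg_id].
rewrite subrr in cz.
have cw : (fun w => `|z - w| `^ a) @ z --> (0 : R) by exact: cvg_comp cz c.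
near=> w; rewrite (le_trans (potential_holder z w))//.
have : `|0 - `|z - w| `^ a| <= e / (total f + 1).
  by near: w; move/cvgrPdist_le : cw; apply; rewrite divr_gt0.
rewrite sub0r normrN ger0_norm ?powR_ge0// ler_pdivlMr//.
by apply: le_trans; rewrite ler_wpM2l ?powR_ge0// lerDl.
Unshelve. all: end_near. Qed.

(** Choose a ball of radius [n] carrying three quarters of the mass. Inside it the kernel is at
    least [|z|^a - 2 n^a], outside at least [-|z|^a]; the difference [3/4 - 1/4] leaves half of the
    mass. *)
Lemma potential_lower_bound : exists c, forall z,
  total f / 2 * `|z| `^ a - c <= potential z.
Proof.
have F0 : 0 <= total f by exact: total_ge0.
have cvT : (fun n : nat => total (fun x => if `|x| <= n%:R then f x else 0)) @ \oo --> total f.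
  apply: (dominated_total _ sf); last 1 first.
  - exact: mf.
  - move=> n; apply: measurable_fun_ifT => //.
    by apply: measurable_fun_ler => //; exact: normr_measurable.
  - by move=> n x; case: ifP => _; rewrite ?normr0// ger0_norm.
  - apply: aeW => x; apply: cvg_near_cst; near=> n; rewrite ifT//.
    near: n; exact: nbhs_infty_ger.
have [T0|Tp] := eqVneq (total f) 0.
  exists 0 => z; have := potential_le z; rewrite T0 !(mulr0, mul0r) normr_le0 => /eqP ->.
  by rewrite subr0.
have {Tp} Tp : 0 < total f by rewrite lt_neqAle eq_sym Tp.
have [n hn] : exists n : nat, 3 / 4 * total f <= total (fun x => if `|x| <= n%:R then f x else 0).
  have /cvgrPdist_le/(_ (total f / 4)) := cvT.
  rewrite divr_gt0// => /(_ isT)[n _ /(_ n (leqnn n))]/=.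
  rewrite ler_norml => /andP[_ h]; exists n; lra.
pose fi x := if `|x| <= n%:R then f x else 0.
have sfi : summable fi.
  apply: (summable_le _ sf).
    apply: measurable_fun_ifT => //.
    by apply: measurable_fun_ler => //; exact: normr_measurable.
  by move=> x; rewrite /fi; case: ifP => _; rewrite ?normr0// ger0_norm.
exists (2 * n%:R `^ a * total f) => z.
have za := powR_ge0 `|z| a; have na := powR_ge0 (n%:R : R) a.
rewrite (@le_trans _ _ ((`|z| `^ a - 2 * n%:R `^ a) * total fi - `|z| `^ a * (total f - total fi)))//.
  have fi1 : total fi <= total f.
    by apply: total_le => // x; rewrite /fi; case: ifP.
  by rewrite -/fi in hn; nra.
rewrite -(totalB sf sfi) -(totalZ _ sfi) -(totalZ _ (summableB sf sfi)).
rewrite -(totalB (summableZ _ sfi) (summableZ _ (summableB sf sfi))).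
apply: total_le; [|exact: summable_potential|].
  by apply: summableB; [exact: summableZ|apply: summableZ; exact: summableB].
move=> x; rewrite /fi; case: ifPn => xn.
  rewrite subrr mulr0 subr0 ler_wpM2r//.
  have xa : `|x| `^ a <= n%:R `^ a by rewrite ge0_ler_powR ?nnegrE ?(ltW a0).
  have := holder_powR_norm z (z - x) a0 (ltW a1).
  by rewrite subKr (distrC z x) ler_norml => /andP[_]; lra.
rewrite mulr0 sub0r subr0 -mulNr ler_wpM2r//.
have := holder_powR_norm (x - z) x a0 (ltW a1).
by rewrite (_ : x - z - x = - z) ?normrN//; [rewrite ler_norml => /andP[]|ring].
Unshelve. all: end_near. Qed.

(** Since [eta''] has integral 0, the kernel may be replaced by [|x - z|^a - |x|^a], which is
    bounded in [x] and makes Fubini applicable. *)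
Lemma total_convolve_potential eta : test_function eta ->
  total (fun x => f x * convolve (fun y => `|y| `^ a) (derive1 (derive1 eta)) x) =
  total (fun z => potential z * derive1 (derive1 eta) z).
Proof.
move=> teta; have t1 := test_function_derive teta.
have t2 := test_function_derive t1; set psi := derive1 (derive1 eta) in t2 *.
have /test_functionP[s1 [b1 _ v1]] := t1.
have /test_functionP[s2 [b b0 psib]] := t2.
have cpsi := smooth_continuous s2.
have spsi := summable_continuous_vanishing cpsi psib.
have psi0 : total psi = 0.
  have [] := total_derivative (fun y => smooth_is_derive y s1) cpsi
    (fun x (bx : b1 < `|x|) => v1 x bx) (vanishes_outside_derive v1).
  by [].
pose F z x := (`|x - z| `^ a - `|x| `^ a) * f x * psi z.
have mF : measurable_fun setT (fun q : R * R => F q.1 q.2).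
  apply: measurable_funM; last exact: (measurableT_comp (continuous_measurable_fun cpsi)).
  apply: measurable_funM; last exact: (measurableT_comp mf).
  apply: measurable_funB; last exact: (measurableT_comp (measurable_powR_norm a)).
  by apply: (measurableT_comp (measurable_powR_norm a)); exact: measurable_funB.
have sF z : summable (F z).
  by apply: summable_ext (summableZ (psi z) (summable_potential z)) => x; rewrite mulrC.
have bF z : total (fun x => `|F z x|) <= total f * (`|z| `^ a * `|psi z|).
  rewrite (le_trans (total_le (summable_norm (sF z)) (summableZ (`|z| `^ a * `|psi z|) sf) _))//.
    move=> x; rewrite /F normrM mulrAC ler_wpM2r//.
    by have := kernel_le z 0 x; rewrite !subr0.
  by rewrite totalZ// mulrC.
have sG : summable (fun z => total f * (`|z| `^ a * `|psi z|)).
  apply: summableZ; apply: (@summable_continuous_vanishing _ b).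
    move=> z; apply: cvgM; first exact: continuous_powR_norm.
    by apply: continuous_comp; [exact: cpsi|exact: norm_continuous].
  by move=> z bz; rewrite psib// normr0 mulr0.
have [E _ _ _ _] := fubini_total mF sF bF sG.
transitivity (total (fun x => total (F ^~ x))).
  apply: total_ext => x.
  have lk := locally_summable_continuous (continuous_powR_norm a0).
  have s1' := summable_convolve x lk cpsi psib.
  have s1'' := summable_reflect x s1'.
  have -> : total (F ^~ x) = f x * total (fun z => `|x - z| `^ a * psi (x - (x - z))) -
      f x * `|x| `^ a * total psi.
    rewrite -(totalZ _ s1'') -(totalZ _ spsi) -(totalB (summableZ _ s1'') (summableZ _ spsi)).
    by apply: total_ext => z; rewrite /F subKr; ring.
  by rewrite psi0 mulr0 subr0 (total_reflect x s1').
rewrite -E; apply: total_ext => z.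
rewrite /potential [RHS]mulrC -(totalZ _ (summable_potential z)).
by apply: total_ext => x; rewrite /F mulrC.
Qed.

End potential.

(** * From the weak equation to the potential *)

Section weak_equation.
Context {R : realType}.
Notation mu := (@lebesgue_measure R).
Implicit Types (c p q r x y z t : R) (psi eta phi : R -> R).

Lemma diff2B (f g h : R -> R) x t : (forall y, f y = g y - h y) ->
  diff2 f x t = diff2 g x t - diff2 h x t.
Proof.
move=> fE; rewrite /diff2 !fE.
by move: (g x) (h x) (g _) (h _) (g _) (h _) => *; ring.
Qed.

Lemma test_function_diff2 phi : test_function phi ->
  exists2 c, 0 <= c & forall x t, `|diff2 phi x t| <= c * Num.min 1 (t ^+ 2).
Proof.
move=> tphi; have t1 := test_function_derive tphi; have t2 := test_function_derive t1.
have [b b0 hb] := test_function_bounded tphi.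
have [c c0 hc] := test_function_bounded t2.
exists (4 * b + 2 * c); first by rewrite addr_ge0 ?mulr_ge0.
move=> x t; apply: (@diff2_min_bound _ phi (derive1 phi) (derive1 (derive1 phi)) b c x t _ _ hb hc) => y.
  by apply: smooth_is_derive; exact: tphi.1.
by apply: smooth_is_derive; exact: t1.1.
Qed.

Lemma vanishing_of_powR_bound x c q : 0 < q ->
  (forall r, 1 <= r -> `|x| <= c * r `^ (- q)) -> x = 0.
Proof.
move=> q0 h; apply/eqP/negPn/negP => x0.
have nx : 0 < `|x| by rewrite normr_gt0.
have c0 : 0 <= c.
  by have := h 1 (lexx _); rewrite powR1 mulr1; exact: le_trans.
(* For [r = d^(1/q)] the bound becomes [c / d], which is smaller than [|x|]. *)
pose d := (c + 1) / `|x| + 1.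
have d1 : 1 <= d by rewrite lerDr divr_ge0// addr_ge0.
have d0 : 0 < d by exact: lt_le_trans d1.
have r1 : 1 <= d `^ q^-1 by rewrite -[leLHS](powRr0 d) ler_powR// invr_ge0 ltW.
have := h _ r1; rewrite powRN -powRrM mulVf ?gt_eqF// powRr1 ?(ltW d0)//.
rewrite ler_pdivlMr// /d mulrDr mulr1 mulrC divfK ?gt_eqF//.
lra.
Qed.

(** Where [eta (x - y)] does not vanish, [|x - y| <= b] and hence [1 + |x| <= (1 + b) (1 + |y|)]. *)
Lemma convolve_weight_le p (k : R -> R) eta b d x : 0 < p -> 0 <= d ->
  (forall y, `|k y| <= d * (1 + `|y|) `^ (- p)) ->
  measurable_fun setT k -> test_function eta -> 0 < b -> vanishes_outside b eta ->
  `|convolve k eta x| <= d * ((1 + b) `^ p * total (fun y => `|eta y|)) * (1 + `|x|) `^ (- p).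
Proof.
move=> p0 d0 kp mk teta b0 etab; have ceta := smooth_continuous teta.1.
have seta := summable_continuous_vanishing ceta etab.
have s2 := summable_reflect x (summable_norm seta).
rewrite mulrA mulrAC -(total_reflect x (summable_norm seta)) -(totalZ _ s2).
apply: total_norm_le_dom; last 1 first.
- move=> y; have [yb|yb] := ltP b `|x - y|; first by rewrite etab// normr0 !mulr0 normr0.
  rewrite normrM ler_wpM2r// (le_trans (kp y))// -mulrA ler_wpM2l//.
  have x1 : 0 < 1 + `|x| by rewrite ltr_pwDl.
  have y1 : 0 < 1 + `|y| by rewrite ltr_pwDl.
  rewrite !powRN ler_pdivlMr ?powR_gt0// mulrC ler_pdivrMr ?powR_gt0//.
  rewrite -powRM ?(ltW y1) ?addr_ge0 ?(ltW b0)//.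
  rewrite ge0_ler_powR ?nnegrE ?(ltW p0) ?(ltW x1) ?mulr_ge0 ?addr_ge0 ?(ltW b0)//.
  have := ler_normD (x - y) y; rewrite subrK.
  have : 0 <= b * `|y| by rewrite mulr_ge0// ltW.
  lra.
- by apply: measurable_funM => //; exact: measurable_sub_comp (continuous_measurable_fun ceta).
- exact: summableZ.
Qed.

Variables (s : R) (u : R -> R).
Hypotheses (s_gt : 2^-1 < s) (s_lt : s < 1).
Hypothesis u_sol : liouville_solution s u.
Hypothesis u_fin : (\int[mu]_x (expR (u x))%:E < +oo)%E.

Let a := 2 * s - 1.
Let a0 : 0 < a. Proof. by have := s_gt; rewrite /a; lra. Qed.
Let a1 : a < 1. Proof. by have := s_lt; rewrite /a; lra. Qed.
Let sa : 1 + 2 * s = 2 + a. Proof. by rewrite /a; ring. Qed.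

Lemma measurable_solution : measurable_fun setT u.
Proof. by have [[[]]] := u_sol. Qed.

Lemma summable_exp_solution : summable (fun x => expR (u x)).
Proof.
apply: summable_ge0P => [|x|]; [|exact: expR_ge0|exact: u_fin].
exact: (measurableT_comp (@measurable_expR R) measurable_solution).
Qed.

(** Brings the [L_s] weight into the form in which the truncation error is estimated. The factor 2
    comes from bounding both 1 and [|x|^(2 + a)] by [(1 + |x|)^(2 + a)]. *)
Lemma summable_solution_weight : summable (fun x => `|u x| * (1 + `|x|) `^ (- (2 + a))).
Proof.
have mu' := measurable_solution.
have [[_ hw] _ _] := u_sol.
have mw : measurable_fun setT (fun x : R => `|u x| / (1 + `|x| `^ (1 + 2 * s))).
  apply: measurable_funM; first exact: measurableT_comp.
  rewrite (_ : (fun x => _) = fun x : R => (1 + `|x| `^ (1 + 2 * s)) `^ (-1)); last first.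
    by apply/funext => x; rewrite powR_inv1// addr_ge0// powR_ge0.
  apply: (measurableT_comp (measurable_powR (-1))).
  by apply: measurable_funD => //; exact: measurable_powR_norm.
have sw : summable (fun x => `|u x| / (1 + `|x| `^ (1 + 2 * s))).
  apply: summable_ge0P => [|x|]; [exact: mw| |exact: hw].
  by rewrite divr_ge0// addr_ge0// powR_ge0.
apply: (summable_le _ (summableZ 2 sw)).
  by apply: measurable_funM; [exact: measurableT_comp|exact: measurable_weight].
move=> x; rewrite ger0_norm ?mulr_ge0 ?powR_ge0// mulrCA ler_wpM2l// sa.
have x1 : 0 < 1 + `|x| by rewrite ltr_pwDl.
have xp : 0 <= `|x| `^ (2 + a) by exact: powR_ge0.
rewrite powRN -[leLHS]mul1r ler_pdivrMr ?powR_gt0// mulrAC ler_pdivlMr ?ltr_pwDl//.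
have p0 : 0 <= 2 + a by have := a0; lra.
have h1 : 1 <= (1 + `|x|) `^ (2 + a).
  by rewrite -[leLHS](powRr0 (1 + `|x|)) ler_powR// lerDl.
have h2 : `|x| `^ (2 + a) <= (1 + `|x|) `^ (2 + a).
  by rewrite ge0_ler_powR ?nnegrE ?(ltW x1)// lerDr.
lra.
Qed.

(* The equation is tested with [(|.|^a - g) * eta''], [g] as in
   [exists_truncated_kernel], and [r] tends to infinity. *)
Lemma solution_weak_potential eta : test_function eta ->
  summable (fun x => u x * derive1 (derive1 eta) x) /\
  fracLap_const s * riesz_constant a * total (fun x => u x * derive1 (derive1 eta) x) =
  total (fun z => potential a (fun x => expR (u x)) z * derive1 (derive1 eta) z).
Proof.
move=> teta; have mu' := measurable_solution.
have sf := summable_exp_solution; have mf := summable_measurable sf.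
have t2 := test_function_derive (test_function_derive teta).
rewrite -(total_convolve_potential a0 a1 sf (fun x => expR_ge0 _) teta).
set psi := derive1 (derive1 eta) in t2 *.
have /test_functionP[s0 [b b0 etab]] := teta.
have psib := vanishes_outside_derive (vanishes_outside_derive etab).
rewrite -/psi in psib.
have /test_functionP[s2 _] := t2.
have ceta := smooth_continuous s0; have cpsi := smooth_continuous s2.
have [B B0 psiB] := test_function_bounded t2.
have W := summable_solution_weight.
set w := fun x : R => (1 + `|x|) `^ (- (2 + a)).
have w0 x : 0 < w x by rewrite powR_gt0// ltr_pwDl.
have p0 : 0 < 2 + a by have := a0; lra.
have psiw x : `|psi x| <= B * (1 + b) `^ (2 + a) * w x.
  have [xb|xb] := ltP b `|x|.
    by rewrite psib// normr0 !mulr_ge0 ?powR_ge0// ltW.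
  rewrite (le_trans (psiB x))// -mulrA ler_peMr// /w powRN ler_pdivlMr ?powR_gt0 ?ltr_pwDl// mul1r.
  by rewrite ge0_ler_powR ?nnegrE ?(ltW p0) ?addr_ge0 ?(ltW b0)// lerD2l.
have dom_u (h : R -> R) c : measurable_fun setT h -> (forall x, `|h x| <= c * w x) ->
    summable (fun x => u x * h x) /\
    `|total (fun x => u x * h x)| <= c * total (fun x => `|u x| * w x).
  move=> mh hc; have mi := measurable_funM mu' mh.
  have hb x : `|u x * h x| <= c * (`|u x| * w x).
    by rewrite normrM mulrCA ler_wpM2l.
  split; first exact: (summable_le mi (summableZ c W)).
  by rewrite -(totalZ _ W); exact: (total_norm_le_dom mi (summableZ c W)).
have mpsi := continuous_measurable_fun cpsi.
have [supsi _] := dom_u psi _ mpsi psiw.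
split => //.
set K := fun y : R => `|y| `^ a.
have lK : locally_summable K := locally_summable_continuous (continuous_powR_norm a0).
have [c c0 trunc] := exists_truncated_kernel a0 a1.
set L := total (fun y => `|eta y|).
have seta := summable_continuous_vanishing ceta etab.
have L0 : 0 <= L by exact: total_ge0.
set A := total (fun x => `|u x| * w x).
have A0 : 0 <= A by apply: total_ge0 => x; rewrite mulr_ge0// ltW.
set Lam := total (fun x => expR (u x)).
have sKpsi := smooth_convolve lK t2.
have cKpsi := smooth_continuous sKpsi.
set Cs := fracLap_const s; set m := riesz_constant a.
have L1 : 0 <= Lam by apply: total_ge0 => x; exact: expR_ge0.
apply/eqP; rewrite -subr_eq0; apply/eqP.
(* The two sides do not involve [r], so it suffices that they differ by a multiple of [r^(-(1 - a))]
   for every [r >= 1]. The first summand of the constant accounts for the error tested against [u],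
   the second for the one tested against [e^u]. *)
apply: (@vanishing_of_powR_bound _
  (`|Cs| * (c * ((1 + b) `^ (2 + a) * L) * A) + c * L * Lam) (1 - a)).
  by have := a1; lra.
move=> r r1; have r0 : 0 < r by exact: lt_le_trans r1.
have [g [G [cg gK gG [cG Gc GQ DG]]]] := trunc r r1.
set d := c * r `^ (- (1 - a)) in Gc DG.
have d0 : 0 <= d by rewrite mulr_ge0// powR_ge0.
have mG := continuous_measurable_fun cG.
pose k y := K y - g y.
have lg := locally_summable_continuous cg.
have lG := locally_summable_continuous cG.
have lk : locally_summable k by exact: locally_summableB.
have kr : vanishes_outside r k by move=> y ry; rewrite /k gK// subrr.
pose phi := convolve k psi.
have tphi : test_function phi by exact: test_function_convolve lk t2 r0 kr.
pose Gam := convolve G eta.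
(* Both derivatives of [eta''] pass to [g], whose second derivative [G] is small, uniformly in
   [x]. *)
have phiE x : phi x = convolve K psi x - Gam x.
  by rewrite /phi (convolveB x lK lg cpsi psib) gG.
have Gam_le x : `|Gam x| <= d * L.
  have s2' := summable_reflect x (summable_norm seta).
  rewrite /L -(total_reflect x (summable_norm seta)) -(totalZ _ s2').
  apply: total_norm_le_dom; last by move=> y; rewrite normrM ler_wpM2r.
    by apply: measurable_funM => //; exact: measurable_sub_comp (continuous_measurable_fun ceta).
  exact: summableZ.
have [S1 E1] : (forall x, summable (fun t => diff2 (convolve K psi) x t * `|t| `^ (- (2 + a)))) /\
    forall x, frac_diff (2 + a) (convolve K psi) x = 2 * m * psi x.
  by split => x; have [] := frac_diff_riesz a0 a1 x teta.
have sGQ := summable_frac_diff a0 a1 c0 cG GQ.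
have GQ' y : total (fun t => `|diff2 G y t * `|t| `^ (- (2 + a))|) <=
    total (fun t => c * singular_weight a t).
  apply: total_le; [exact: summable_norm|exact: summableZ (summable_singular_weight a0 a1)|].
  by move=> t; exact: frac_diff_integrand_le.
have [S2 E2] : (forall x, summable (fun t => diff2 Gam x t * `|t| `^ (- (2 + a)))) /\
    forall x, frac_diff (2 + a) Gam x = convolve (frac_diff (2 + a) G) eta x.
  by split => x; have [] := frac_diff_convolve x cG ceta etab sGQ GQ'.
have mDG : measurable_fun setT (frac_diff (2 + a) G).
  exact: continuous_measurable_fun (continuous_frac_diff a0 a1 c0 cG GQ).
pose E := convolve (frac_diff (2 + a) G) eta.
have Dphi x : frac_diff (2 + a) phi x = 2 * m * psi x - E x.
  rewrite -E1 /E -E2 /frac_diff -(totalB (S1 x) (S2 x)); apply: total_ext => t.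
  by rewrite (diff2B _ _ phiE) mulrBl.
have cphi := smooth_continuous tphi.1.
have [c' c'0 phiQ] := test_function_diff2 tphi.
have [B' B'0 phiB'] := test_function_bounded tphi.
have LE x : fracLap s phi x = Cs * m * psi x - Cs / 2 * E x.
  rewrite (fracLap_frac_diff a0 a1 c'0 cphi phiQ _ x sa); last by exists B'.
  have alg (C0 m0 p e : R) : C0 * (2^-1 * (2 * m0 * p - e)) = C0 * m0 * p - C0 / 2 * e by field.
  by rewrite Dphi; exact: alg.
(* Up to a multiple of [psi], the error is the fractional difference of a test function, and that is
   continuous. *)
have mE : measurable_fun setT E.
  rewrite (_ : E = fun x => 2 * m * psi x - frac_diff (2 + a) phi x); last first.
    by apply/funext => x; rewrite Dphi opprB addrC subrK.
  apply: measurable_funB; first exact: measurable_funM.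
  exact: continuous_measurable_fun (continuous_frac_diff a0 a1 c'0 cphi phiQ).
have bE x : `|E x| <= d * ((1 + b) `^ (2 + a) * L) * w x.
  exact: convolve_weight_le.
have [suE tuE] := dom_u E _ mE bE.
have [_ _ /(_ phi tphi) weak] := u_sol.
have {}weak : total (fun x => u x * fracLap s phi x) = total (fun x => expR (u x) * phi x).
  exact: (congr1 fine weak).
rewrite (total_ext (g := fun x => Cs * m * (u x * psi x) - Cs / 2 * (u x * E x))) in weak; last first.
  have alg (C0 m0 p e v : R) :
      v * (C0 * m0 * p - C0 / 2 * e) = C0 * m0 * (v * p) - C0 / 2 * (v * e) by ring.
  by move=> x; rewrite LE; exact: alg.
rewrite (totalB (summableZ _ supsi) (summableZ _ suE)) (totalZ _ supsi) (totalZ _ suE) in weak.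
have dom_f (h : R -> R) M : measurable_fun setT h -> (forall x, `|h x| <= M) ->
    summable (fun x => expR (u x) * h x) /\ `|total (fun x => expR (u x) * h x)| <= M * Lam.
  move=> mh hc; have mi := measurable_funM mf mh.
  have hb x : `|expR (u x) * h x| <= M * expR (u x).
    by rewrite normrM mulrC (ger0_norm (expR_ge0 _)) ler_wpM2r ?expR_ge0.
  split; first exact: (summable_le mi (summableZ M sf)).
  by rewrite -(totalZ _ sf); exact: (total_norm_le_dom mi (summableZ M sf)).
have mGam : measurable_fun setT Gam.
  rewrite (_ : Gam = fun x => convolve K psi x - phi x); last first.
    by apply/funext => x; rewrite phiE opprB addrC subrK.
  by apply: measurable_funB; exact: continuous_measurable_fun.
have [sG tG] := dom_f Gam _ mGam Gam_le.
(* The kernel is unbounded, but its convolution with [psi] differs from the bounded [phi] by the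
   small [Gam]. *)
have Kpsi_le x : `|convolve K psi x| <= B' + d * L.
  by rewrite -(subrK (Gam x) (convolve K psi x)) -phiE (le_trans (ler_normD _ _))// lerD.
have [sKf _] := dom_f (convolve K psi) (B' + d * L) (continuous_measurable_fun cKpsi) Kpsi_le.
have Ef : total (fun x => expR (u x) * phi x) =
    total (fun x => expR (u x) * convolve K psi x) - total (fun x => expR (u x) * Gam x).
  by rewrite -(totalB sKf sG); apply: total_ext => x; rewrite phiE mulrBr.
rewrite Ef in weak.
(* The tested equation, rearranged with the main terms on one side and the two errors on the
   other. *)
have -> : Cs * m * total (fun x => u x * psi x) - total (fun x => expR (u x) * convolve K psi x) =
    Cs / 2 * total (fun x => u x * E x) - total (fun x => expR (u x) * Gam x).
  have alg (p q e h : R) : p - e = q - h -> p - q = e - h.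
    by move=> /(canRL (subrK _)) ->; ring.
  exact: alg weak.
rewrite (le_trans (ler_normB _ _))// mulrDl lerD//; last first.
  have alg (c0' L' l r' : R) : c0' * r' * L' * l = c0' * L' * l * r' by ring.
  by rewrite (le_trans tG)// /d alg.
rewrite normrM (le_trans (ler_wpM2l (normr_ge0 _) tuE))//.
rewrite normrM (ger0_norm (_ : 0 <= 2^-1))//.
have -> : `|Cs| * (c * ((1 + b) `^ (2 + a) * L) * A) * r `^ (- (1 - a)) =
   `|Cs| * (d * ((1 + b) `^ (2 + a) * L) * A).
  have alg (C c1 p A1 r' : R) : C * (c1 * p * A1) * r' = C * (c1 * r' * p * A1) by ring.
  exact: alg.
rewrite -mulrA ler_wpM2l// ler_piMl//; last by rewrite invf_le1// ler1n.
by rewrite !mulr_ge0// powR_ge0.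
Qed.

End weak_equation.

(** * Mollification and the lemma of du Bois-Reymond *)

Section du_bois_reymond.
Context {R : realType}.
Notation mu := (@lebesgue_measure R).
Implicit Types (c d x y z r : R) (f h rho : R -> R).

Lemma is_derive_affine c d f x df : is_derive (c * x + d) 1 f df ->
  is_derive x 1 (fun y => f (c * y + d)) (c * df).
Proof.
move=> f'.
have h : is_derive x 1 (fun y => c * y + d) c.
  by apply: is_derive_eq; rewrite /GRing.scale/=; ring.
have := @is_derive1_comp R f (fun y => c * y + d) x _ _ f' h.
by rewrite /GRing.scale/= mulrC.
Qed.

Lemma smooth_affine c d f : smooth f -> smooth (fun y => f (c * y + d)).
Proof.
move=> sf n.
have E m : derive1n m (fun y => f (c * y + d)) = fun y => c ^+ m * derive1n m f (c * y + d).
  elim: m => [|m IH]; first by apply/funext => y; rewrite expr0 mul1r.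
  apply/funext => y; rewrite derive1nS IH derive1E.
  have := is_derive_affine (DeriveDef (sf m (c * y + d)) erefl).
  rewrite -derive1E -derive1nS => h.
  have {}h : is_derive y 1 (fun y => c ^+ m * derive1n m f (c * y + d))
      (c ^+ m * (c * derive1n m.+1 f (c * y + d))).
    by apply: is_derive_eq; rewrite /GRing.scale/=; ring.
  by rewrite (derive_val (is_derive := h)) mulrA -exprSr.
move=> x; rewrite E.
have h := is_derive_affine (DeriveDef (sf n (c * x + d)) erefl).
have h2 : is_derive x 1 (fun y => c ^+ n * derive1n n f (c * y + d))
    (c ^+ n * (c * 'D_1 (derive1n n f) (c * x + d))).
  by apply: is_derive_eq; rewrite /GRing.scale/=; ring.
exact: ex_derive.
Qed.

Lemma test_function_affine c d f : c != 0 -> test_function f ->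
  test_function (fun y => f (c * y + d)).
Proof.
move=> c0 /test_functionP[sf [b b0 fb]]; apply/test_functionP; split.
  exact: smooth_affine.
have c0' : 0 < `|c| by rewrite normr_gt0.
exists ((b + `|d|) / `|c|); first by rewrite divr_gt0// ltr_wpDr.
move=> x; rewrite ltr_pdivrMr// => h; apply: fb.
have := lerB_normD (c * x) d; rewrite normrM mulrC.
by apply: lt_le_trans; rewrite ltrBrDr.
Qed.

Lemma derive1_affine c d f x : smooth f ->
  derive1 (fun y => f (c * y + d)) x = c * derive1 f (c * x + d).
Proof.
move=> sf; have h := is_derive_affine (smooth_is_derive (c * x + d) sf).
by rewrite derive1E (derive_val (is_derive := h)).
Qed.

Lemma test_functionZ c f : test_function f -> test_function (fun y => c * f y).
Proof.
move=> /test_functionP[sf [b b0 fb]]; apply/test_functionP; split; last first.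
  by exists b => // x bx; rewrite fb// mulr0.
move=> n.
have E m : derive1n m (fun y => c * f y) = fun y => c * derive1n m f y.
  elim: m => [//|m IH].
  apply/funext => y; rewrite derive1nS IH derive1E.
  have h := DeriveDef (sf m y) erefl.
  have {}h : is_derive y 1 (fun y => c * derive1n m f y)
      (c * 'D_1 (derive1n m f) y).
    by apply: is_derive_eq; rewrite /GRing.scale/=; ring.
  by rewrite (derive_val (is_derive := h)) derive1nS derive1E.
move=> x; rewrite E; have h := DeriveDef (sf n x) erefl.
have h2 : is_derive x 1 (fun y => c * derive1n n f y) (c * 'D_1 (derive1n n f) x).
  by apply: is_derive_eq; rewrite /GRing.scale/=; ring.
exact: ex_derive.
Qed.

Lemma locally_summable_integrable h : locally_integrable setT h -> locally_summable h.
Proof.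
move=> [mh _ hK]; split => // b.
have mb : measurable_fun setT (fun x => if `|x| <= b then h x else 0).
  have := measurable_patch (measurable_itv `[- b, b]) mh.
  by apply: eq_measurable_fun => x _; rewrite patchE mem_setE/= in_itv/= -ler_norml.
apply/integrableP; split; first exact/measurable_EFinP.
have := hK `[- b, b]%classic (@subsetT _ _) (@segment_compact _ _ _).
rewrite integral_mkcond; congr (_ < _)%E; apply: eq_integral => x _ /=.
by rewrite patchE mem_setE/= in_itv/= -ler_norml; case: ifP => // _; rewrite normr0.
Qed.

Lemma davg_total h x r : 0 < r -> locally_summable h ->
  let g y := if `|x - y| < r then `|h y - h x| else 0 in
  summable g /\ davg h x r = ((2 * r)^-1 * total g)%:E.
Proof.
move=> r0 [mh hb] g.
have mg : measurable_fun setT g.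
  have mh' : measurable_fun setT (fun y => `|h y - h x|).
    by apply: measurableT_comp => //; exact: measurable_funB.
  have := measurable_patch (measurable_ball x r) mh'.
  by apply: eq_measurable_fun => y _; rewrite patchE mem_setE.
have sg : summable g.
  apply: (summable_le mg (summableD (summable_norm (hb (`|x| + r)))
    (summableZ `|h x| (summable_ball (`|x| + r))))) => y.
  rewrite /g ger0_norm; last by case: ifP.
  case: ifPn => xy; last by rewrite addr_ge0// mulr_ge0//; case: ifP.
  have -> : `|y| <= `|x| + r.
    have -> : y = x - (x - y) by ring.
    by rewrite (le_trans (ler_normB _ _))// lerD2l ltW.
  by rewrite mulr1 ler_normB.
split => //; rewrite /davg /iavg lebesgue_measure_ball ?(ltW r0)//.
rewrite inver mulrn_eq0/= gt_eqF// -(mulr_natl r 2) EFinM (EFin_total sg).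
congr (_%:E * _)%E; rewrite integral_mkcond.
have E (y : R) : ((fun y => `|h y - h x|%:E) \_ (ball x r)) y = (g y)%:E.
  rewrite patchE /g; case: ifPn => [/set_mem|] xy.
    by have {}xy : `|x - y| < r := xy; rewrite xy.
  by case: ifPn => // yr; case/negP: xy; exact: mem_set.
by apply: eq_integral => y _; exact: E.
Qed.

(** The ball of radius [2 r] has length [4 r], so the right side is [c] times the integral of
    [|h - h x|] over it. Doubling the radius makes the open ball contain the closed one outside
    which [rho] vanishes. *)
Lemma mollifier_bound h rho c r x : locally_summable h -> test_function rho ->
  (forall y, `|rho y| <= c) -> vanishes_outside r rho -> 0 < r ->
  `|convolve h rho x - h x * total rho| <= 4 * r * c * fine (davg h x (2 * r)).
Proof.
move=> lh trho rhoc rhor r0.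
have crho := smooth_continuous trho.1.
have srho := summable_continuous_vanishing crho rhor.
have [sg ->] := davg_total x (mulr_gt0 (ltr0Sn R 1) r0) lh.
set g := fun y => _ in sg *; rewrite [fine _]/=.
have s1 := summable_convolve x lh crho rhor.
have s2 := summableZ (h x) (summable_reflect x srho).
rewrite /convolve -(total_reflect x srho) -(totalZ _ (summable_reflect x srho)).
rewrite -(totalB s1 s2).
have -> : 4 * r * c * ((2 * (2 * r))^-1 * total g) = c * total g.
  by move: (total g) => T; field; rewrite gt_eqF.
rewrite -(totalZ _ sg); apply: total_norm_le_dom (summableZ c sg) _.
  exact: summable_measurable (summableB s1 s2).
move=> y; rewrite -mulrBl normrM mulrC /g.
case: ifPn => [_|]; first by rewrite ler_wpM2r.
rewrite -leNgt => xy; rewrite rhor ?normr0 ?mul0r ?mulr0//.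
by rewrite (lt_le_trans _ xy)// ltr_pMl// ltr1n.
Qed.

(** Rescaled copies of one bump: height of order [n + 1] and support of radius [1 / (n + 1)]
    compensate in [mollifier_bound], leaving a fixed multiple of the mean deviation of [h] from
    [h x] over a shrinking ball. *)
Lemma exists_mollifier : exists rho_ : nat -> R -> R,
  (forall n, test_function (rho_ n)) /\
  forall h x, locally_integrable setT h -> lebesgue_pt h x ->
    convolve h (rho_ n) x @[n --> \oo] --> h x.
Proof.
have [rho [trho rho0 rho1 m0]] := exists_bump (R := R).
have [c c0 rhoc] := test_function_bounded trho.
have srho := summable_continuous_vanishing (smooth_continuous trho.1) rho1.
set m := total rho in m0.
have n0 (n : nat) : 0 < n.+1%:R :> R by rewrite ltr0n.
pose rho_ n y := (m^-1 * n.+1%:R) * rho (n.+1%:R * y + 0).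
exists rho_; split => [n|h x lh Lx].
  by apply: test_functionZ; apply: test_function_affine trho; rewrite gt_eqF.
have lsh := locally_summable_integrable lh.
have tot n : total (rho_ n) = 1.
  rewrite totalZ; last by apply: summable_affine srho; rewrite gt_eqF.
  rewrite (total_affine 0 _ srho) ?gt_eqF// gtr0_norm// -/m; field.
  by rewrite !gt_eqF// (n0 n).
have bnd n : `|convolve h (rho_ n) x - h x| <= 4 * m^-1 * c * fine (davg h x (2 * n.+1%:R^-1)).
  have <- : h x * total (rho_ n) = h x by rewrite tot mulr1.
  have -> : 4 * m^-1 * c = 4 * n.+1%:R^-1 * (m^-1 * n.+1%:R * c).
    by move: (n0 n) (m0) => ? ?; field; rewrite !gt_eqF.
  apply: mollifier_bound => //.
  - by apply: test_functionZ; apply: test_function_affine trho; rewrite gt_eqF.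
  - move=> y; rewrite /rho_ normrM ger0_norm ?ler_wpM2l// mulr_ge0// ?invr_ge0 ltW//.
  - move=> y yn; rewrite /rho_ rho1 ?mulr0// addr0 normrM gtr0_norm// mulrC.
    by rewrite -ltr_pdivrMr// div1r.
have d0 : fine (davg h x (2 * n.+1%:R^-1)) @[n --> \oo] --> 0.
  have h0 := (cvg_at_rightP (fun r => fine (davg h x r)) 0 0).1 (fine_cvg Lx).
  apply: h0; split.
    by move=> n; rewrite mulr_gt0// invr_gt0.
  rewrite -(mulr0 2); apply: cvgM; [exact: cvg_cst|exact: cvg_harmonic].
apply/cvgrPdist_lt => /= e e0.
have /cvgrPdist_lt : 4 * m^-1 * c * fine (davg h x (2 * n.+1%:R^-1)) @[n --> \oo] --> 4 * m^-1 * c * 0.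
  by apply: cvgM d0; exact: cvg_cst.
rewrite mulr0 => /(_ _ e0); apply: filterS => n.
rewrite sub0r normrN => h1; rewrite distrC; apply: le_lt_trans (bnd n) _.
exact: le_lt_trans (ler_norm _) h1.
Qed.

(** An affine function is written as the interpolation of two of its values, because the values of
    the mollifications are what converges. *)
Lemma affine_of_derive2 f : smooth f -> (forall x, derive1 (derive1 f) x = 0) ->
  forall x y z, y != z -> f x = f y + (x - y) / (z - y) * (f z - f y).
Proof.
move=> sf f2 x y z yz.
have s1 := smooth_derive sf.
have d1 (t : R) : is_derive t 1 (derive1 f) 0 by rewrite -(f2 t); exact: smooth_is_derive.
have c1 t : derive1 f t = derive1 f 0 by exact: is_derive_0_is_cst.
have d0 (t : R) : is_derive t 1 (fun t => f t - derive1 f 0 * t) 0.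
  have h := smooth_is_derive t sf.
  by apply: is_derive_eq; rewrite c1 /GRing.scale/=; ring.
have E t : f t = derive1 f 0 * t + (f 0 - derive1 f 0 * 0).
  by rewrite -(is_derive_0_is_cst t 0 d0); ring.
rewrite (E x) (E y) (E z); move: (derive1 f 0) (f 0) => p q; field.
by rewrite subr_eq0 eq_sym.
Qed.

(* The mollifications of [h] are affine and converge at Lebesgue points; two such
   points determine the limit. *)
Lemma du_bois_reymond h : locally_integrable setT h ->
  (forall eta, test_function eta -> total (fun x => h x * derive1 (derive1 eta) x) = 0) ->
  exists c d, {ae mu, forall x, h x = c + d * x}.
Proof.
move=> lh weak; have lsh := locally_summable_integrable lh.
have [rho_ [trho cvg_rho]] := exists_mollifier.
have leb := lebesgue_differentiation lh.
(* The second derivative at [x] is the hypothesis tested with [y -> rho_n (x - y)]. *)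
have conv0 n x : derive1 (derive1 (convolve h (rho_ n))) x = 0.
  have t1 := test_function_derive (trho n).
  have E y : derive1 (derive1 (fun y => rho_ n (-1 * y + x))) y =
      derive1 (derive1 (rho_ n)) (x - y).
    rewrite (_ : derive1 (fun y => rho_ n (-1 * y + x)) =
                 fun y => -1 * derive1 (rho_ n) (-1 * y + x)); last first.
      by apply/funext => t; apply: derive1_affine (trho n).1.
    have h1 := is_derive_affine (smooth_is_derive (-1 * y + x) t1.1).
    rewrite derive1E.
    have h2 : is_derive y 1 (fun y => -1 * derive1 (rho_ n) (-1 * y + x))
       (-1 * (-1 * derive1 (derive1 (rho_ n)) (-1 * y + x))).
      by apply: is_derive_eq; rewrite /GRing.scale/=; ring.
    by rewrite (derive_val (is_derive := h2)) mulrA mulrNN !mul1r mulN1r addrC.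
  rewrite !derive1_convolve// /convolve.
  have trx : test_function (fun y => rho_ n (-1 * y + x)).
    by apply: test_function_affine (trho n); rewrite oppr_eq0 oner_neq0.
  by rewrite -(weak _ trx); apply: total_ext => y; rewrite E.
have aff n := affine_of_derive2 (smooth_convolve lsh (trho n)) (conv0 n).
(* Every interval of length 1 contains a Lebesgue point; [[0, 1]] and [[2, 3]] supply two distinct
   ones. *)
have [p [q [pq Lp Lq]]] : exists p q, [/\ p != q, lebesgue_pt h p & lebesgue_pt h q].
  have meet (y : R) : exists2 x, y <= x <= y + 1 & lebesgue_pt h x.
    apply/not_exists2P => no.
    have [N [mN N0 subN]] := leb.
    have : (mu `[y, (y + 1)%R] <= mu N)%E.
      apply: le_measure; rewrite ?inE//.
      move=> x /=; rewrite in_itv/= => xy; apply: subN => /= Lx.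
      by have [] := no x.
    rewrite N0 lebesgue_measure_itv/= lte_fin ltrDl ltr01 -EFinB lee_fin.
    by rewrite addrAC subrr add0r ler10.
  have [p /andP[_ p1] Lp] := meet 0; have [q /andP[q2 _] Lq] := meet 2.
  exists p, q; split => //; rewrite lt_eqF//.
  by rewrite (lt_le_trans _ q2)// (le_lt_trans p1)// add0r ltr1n.
exists (h p - p / (q - p) * (h q - h p)), ((h q - h p) / (q - p)).
apply: ae_imply leb => x Lx.
have cx := cvg_rho _ _ lh Lx.
have cp := cvg_rho _ _ lh Lp.
have cq := cvg_rho _ _ lh Lq.
have cc := cvgD cp (cvgM (cvg_cst ((x - p) / (q - p))) (cvgB cq cp)).
have -> : h x = h p + (x - p) / (q - p) * (h q - h p).
  rewrite -(cvg_lim (@Rhausdorff R) cx); apply: cvg_lim => //.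
  by apply: cvg_trans (cc _ _ _ _); apply: near_eq_cvg; near=> n; exact: esym (aff _ _ _ _ pq).
by field; rewrite subr_eq0 eq_sym.
Unshelve. all: by end_near. Qed.

End du_bois_reymond.

(** * Growth of powers and obstructions to integrability *)

Section integrability_obstructions.
Context {R : realType}.
Notation mu := (@lebesgue_measure R).
Implicit Types (a c x y z r t : R) (f g h : R -> R).

Lemma powR_unbounded a c : 0 < a -> exists2 r0, 1 <= r0 & forall r, r0 <= r -> c <= r `^ a.
Proof.
move=> a0; have c1 : 1 <= `|c| + 1 by rewrite lerDr.
have c0 : 0 < `|c| + 1 by exact: lt_le_trans c1.
have r1 : 1 <= (`|c| + 1) `^ a^-1 by rewrite -[leLHS](powRr0 (`|c| + 1)) ler_powR// invr_ge0 ltW.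
exists ((`|c| + 1) `^ a^-1) => // r hr.
rewrite (le_trans (ler_norm c))// (@le_trans _ _ (((`|c| + 1) `^ a^-1) `^ a))//.
  by rewrite -powRrM mulVf ?gt_eqF// powRr1 ?(ltW c0)// lerDl.
by rewrite ge0_ler_powR ?nnegrE ?powR_ge0 ?(ltW a0)// (le_trans _ hr)// powR_ge0.
Qed.

Lemma powR_sublinear a c d : 0 < a -> a < 1 -> 0 < d ->
  exists2 r0, 1 <= r0 & forall r, r0 <= r -> c * (1 + r `^ a) <= d * r.
Proof.
move=> a0 a1 d0; have b0 : 0 < 1 - a by rewrite subr_gt0.
have [r0 r01 h] := powR_unbounded (2 * `|c| / d) b0.
exists r0 => // r rr; have r1 := le_trans r01 rr; have rp : 0 < r by exact: lt_le_trans r1.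
have ra : 1 <= r `^ a by rewrite -[leLHS](powRr0 r) ler_powR// ltW.
have rE : r = r `^ a * r `^ (1 - a) by rewrite -powRD_gt0// addrC subrK powRr1// ltW.
rewrite [leRHS](_ : _ = r `^ a * (d * r `^ (1 - a))); last by rewrite {1}rE; ring.
rewrite (@le_trans _ _ (r `^ a * (2 * `|c|)))//; last first.
  by rewrite ler_wpM2l ?powR_ge0// [leRHS]mulrC -ler_pdivrMr// h.
have := ler_norm c; have := normr_ge0 c; nra.
Qed.

Lemma continuous_ae_eq f g : continuous f -> continuous g ->
  {ae mu, forall x, f x = g x} -> f =1 g.
Proof.
move=> cf cg [N [mN N0 sub]] x; apply/eqP/negPn/negP => fgx.
have /cvgrPdist_lt : (f \- g) y @[y --> x] --> f x - g x by apply: cvgB; [exact: cf|exact: cg].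
have e0 : 0 < `|f x - g x| by rewrite normr_gt0 subr_eq0.
move=> /(_ _ e0)/nbhs_ballP[e /= e1 He].
have : (mu (ball x e) <= mu N)%E.
  apply: le_measure; rewrite ?inE//; first exact: measurable_ball.
  move=> y /He /= h; apply: sub => /= E; move: h; rewrite E subrr subr0.
  by rewrite ltxx.
by rewrite N0 lebesgue_measure_ball ?(ltW e1)// lee_fin leNgt pmulrn_lgt0// e1.
Qed.

Lemma not_summable_right r f : (forall x, 0 <= f x) -> summable f ->
  ~ {ae mu, forall x, r <= x -> 1 <= f x}.
Proof.
move=> f0 sf h; have mf := summable_measurable sf.
have T n : n.+1%:R <= total f.
  have rn : r < r + n.+1%:R by rewrite ltrDl ltr0n.
  have d (x : R) : is_derive x 1 (fun x : R => x) (1 : R) by exact: is_derive_id.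
  have c1 : continuous (fun _ : R => 1 : R) by move=> x; exact: cvg_cst.
  have := total_segment rn d c1; rewrite addrAC subrr add0r => <-.
  (* The maximum turns a lower bound valid almost everywhere into one valid everywhere, without
     changing the integral. *)
  pose g x := Num.max (f x) ((fun=> 1 : R) \_ `[r, r + n.+1%:R] x).
  have m1 : measurable_fun setT ((fun _ : R => 1 : R) \_ `[r, r + n.+1%:R]).
    by apply: measurable_patch.
  have mg : measurable_fun setT g by exact: measurable_maxr.
  have fg : {ae mu, forall x, f x = g x}.
    apply: ae_imply h => x hx; apply/esym/max_idPl.
    rewrite patchE mem_setE/= in_itv/=; case: ifPn => // /andP[rx _].
    exact: hx.
  rewrite (total_ae mf mg fg).
  apply: total_le.
  - apply: (summable_le m1 (summable_ae mg fg sf)) => x.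
    rewrite ger0_norm; last by rewrite patchE; case: ifP.
    by rewrite /g le_max lexx orbT.
  - exact: summable_ae sf.
  - by move=> x; rewrite /g le_max lexx orbT.
have := T (Num.Def.archi_bound (total f)); rewrite leNgt.
rewrite (lt_trans (archi_boundP (total_ge0 f0)))//.
by rewrite ltr_nat.
Qed.

Lemma not_summable_left r f : (forall x, 0 <= f x) -> summable f ->
  ~ {ae mu, forall x, r <= - x -> 1 <= f x}.
Proof.
move=> f0 sf [N [mN N0 sub]].
have s' := summable_reflect 0 sf.
apply: (@not_summable_right r _ (fun x => f0 (0 - x)) s').
have mR : measurable ((fun x : R => -1 * x + 0) @^-1` N).
  by rewrite -[X in measurable X]setTI; apply: (measurable_affine (-1) 0).
exists ((fun x : R => -1 * x + 0) @^-1` N); split => //.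
  have m1 : (-1 : R) != 0 by rewrite oppr_eq0 oner_neq0.
  by have := lebesgue_measure_affine 0 m1 mN; rewrite N0 normrN1 mul1e.
move=> x /= h; apply: sub => /= h'; apply: h => rx; rewrite sub0r.
by move: h'; rewrite mulN1r addr0 opprK; exact.
Qed.

Lemma locally_integrableP h : locally_integrable setT h <-> locally_summable h.
Proof.
split; first exact: locally_summable_integrable.
move=> [mh hb]; split; [exact: mh|exact: openT|move=> K _ cK].
have [M [_ bM]] := compact_bounded cK.
have KM x : K x -> `|x| <= M + 1 by move=> Kx; apply: bM => //; rewrite ltrDl.
have mK : measurable K by exact: closed_measurable (compact_closed (@Rhausdorff R) cK).
have /integrableP[_] := hb (M + 1); apply: le_lt_trans.
rewrite integral_mkcond; apply: ge0_le_integral => //.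
- by move=> x _; rewrite patchE; case: ifP.
- apply/(measurable_restrictT _ mK); apply/measurable_EFinP.
  exact/measurable_funTS/measurableT_comp.
- by apply/measurable_EFinP; apply: measurableT_comp => //; exact: summable_measurable (hb _).
move=> x _; rewrite patchE; case: ifPn => [/set_mem Kx|_]; last by rewrite lee_fin.
by rewrite /= KM.
Qed.

Lemma total_eq0_ae f : (forall x, 0 <= f x) -> summable f -> total f = 0 ->
  {ae mu, forall x, f x = 0}.
Proof.
move=> f0 sf T0; have mf := summable_measurable sf.
have mEf : measurable_fun setT (EFin \o f) by exact/measurable_EFinP.
have := (ae_eq_integral_abs mu measurableT mEf).1.
have -> : (\int[mu]_(x in setT) `|(EFin \o f) x| = 0)%E.
  rewrite -[RHS]/(0%:E) -T0 (EFin_total sf); apply: eq_integral => x _ /=.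
  by rewrite ger0_norm.
by move=> /(_ erefl); apply: ae_imply => x /(_ I)[].
Qed.

Lemma total_gt0 f : (forall x, 0 < f x) -> summable f -> 0 < total f.
Proof.
move=> f0 sf; have f0' x : 0 <= f x by exact: ltW.
rewrite lt_neqAle total_ge0// andbT eq_sym; apply/eqP => T0.
apply: (@not_summable_right 0 (fun=> 0)) => //; first exact: summable0.
apply: ae_imply (total_eq0_ae f0' sf T0) => x fx.
by have := f0 x; rewrite fx ltxx.
Qed.

Lemma continuous_total_gt0 f x : continuous f -> (forall x, 0 <= f x) -> 0 < f x ->
  summable f -> 0 < total f.
Proof.
move=> cf f0 fx sf; rewrite lt_neqAle total_ge0// andbT eq_sym; apply/eqP => T0.
have c0 : continuous (fun _ : R => 0 : R) by move=> y; exact: cvg_cst.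
by have := continuous_ae_eq cf c0 (total_eq0_ae f0 sf T0) x; move: fx => /[swap] ->; rewrite ltxx.
Qed.

End integrability_obstructions.

(** * Sign of the constant and absence of a linear term *)

Section sign_of_the_constant.
Context {R : realType}.
Notation mu := (@lebesgue_measure R).
Variable a : R.
Hypotheses (a0 : 0 < a) (a1 : a < 1).
Variables (c p q : R) (u : R -> R).
Hypothesis sf : summable (fun x => expR (u x)).
Notation f := (fun x => expR (u x)).
Notation V := (potential a f).
Hypothesis uV : {ae mu, forall x, c * u x = V x + p + q * x}.

Let f0 x : 0 <= expR (u x). Proof. exact: expR_ge0. Qed.

Let f_gt0 : 0 < total f. Proof. by apply: total_gt0 => // x; exact: expR_gt0. Qed.

Let not_nonneg_right r : ~ {ae mu, forall x, r <= x -> 0 <= u x}.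
Proof.
move=> h; apply: (@not_summable_right _ r _ f0 sf).
by apply: ae_imply h => x ux /ux ux0; rewrite -[leLHS]expR0 ler_expR.
Qed.

Let not_nonneg_left r : ~ {ae mu, forall x, r <= - x -> 0 <= u x}.
Proof.
move=> h; apply: (@not_summable_left _ r _ f0 sf).
by apply: ae_imply h => x ux /ux ux0; rewrite -[leLHS]expR0 ler_expR.
Qed.

Let potential_unbounded d : exists2 r, 1 <= r & forall x, r <= `|x| -> d <= V x.
Proof.
have [c1 Vlow] := potential_lower_bound a0 a1 sf f0.
have [r r1 hr] := powR_unbounded ((d + c1) * (2 / total f)) a0.
exists r => // x rx; apply: le_trans (Vlow x).
have := hr _ rx; rewrite mulrA ler_pdivrMr// => h.
by rewrite lerBrDr mulrAC ler_pdivlMr// (le_trans h)// mulrC.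
Qed.

(** For [c = 0] the continuous function [V] would be affine; its values at [r] and [-r] would add up
    to [-2 p], although both are at least [1 - p] for large [r]. *)
Lemma weak_constant_neq0 : c != 0.
Proof.
apply/eqP => c0.
have cV := continuous_potential a0 a1 sf f0.
have E x : 0 = V x + p + q * x.
  apply: (@continuous_ae_eq _ (fun=> 0) (fun x => V x + p + q * x)).
  - by move=> y; exact: cvg_cst.
  - move=> y; apply: cvgD; first by apply: cvgD; [exact: cV|exact: cvg_cst].
    by apply: cvgM; [exact: cvg_cst|exact: cvg_id].
  - by apply: ae_imply uV => y; rewrite c0 mul0r.
have [r r1 hr] := potential_unbounded (1 - p).
have r0 : 0 < r by exact: lt_le_trans r1.
have := hr r; have := hr (- r); rewrite normrN gtr0_norm// lexx => /(_ isT) h1 /(_ isT) h2.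
have := E r; have := E (- r); move: h1 h2.
by move: (V r) (V (- r)) => V1 V2; lra.
Qed.

(** If [c > 0], then on the half-line where [q x >= 0] the growth of [V] makes [u] nonnegative far
    out, so that [e^u >= 1] there. *)
Lemma weak_constant_lt0 : c < 0.
Proof.
rewrite ltNge le_eqVlt eq_sym (negbTE weak_constant_neq0)/=; apply/negP => c0.
have [r r1 hr] := potential_unbounded (- p).
have r0 : 0 < r by exact: lt_le_trans r1.
have [q0|q0] := leP 0 q.
  apply: (@not_nonneg_right r); apply: ae_imply uV => x E rx.
  have x0 : 0 < x by exact: lt_le_trans rx.
  rewrite -(pmulr_rge0 _ c0) E addr_ge0 ?mulr_ge0// ?(ltW x0)//.
  by rewrite -lerBlDr sub0r hr// gtr0_norm.
apply: (@not_nonneg_left r); apply: ae_imply uV => x E rx.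
have x0 : 0 < - x by exact: lt_le_trans rx.
rewrite -(pmulr_rge0 _ c0) E addr_ge0//.
  by rewrite -lerBlDr sub0r hr// -normrN gtr0_norm.
by rewrite -mulrNN mulr_ge0// ?(ltW x0)// oppr_ge0 ltW.
Qed.

(** The potential is sublinear, so a linear term would dominate it. On the half-line where [q x < 0]
    the right side is eventually nonpositive, and dividing by [c < 0] again gives [u >= 0]. *)
Lemma linear_term_eq0 : q = 0.
Proof.
have c0 := weak_constant_lt0.
have sub d : 0 < d -> exists2 r, 1 <= r & forall x, r <= `|x| -> V x + p <= d * `|x|.
  move=> d0; have [r r1 hr] := powR_sublinear (total f + `|p|) a0 a1 d0.
  exists r => // x rx; apply: le_trans (hr _ rx).
  have := potential_le a0 a1 sf f0 x; rewrite ler_norml => /andP[_ Vx].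
  have := ler_norm p; have := powR_ge0 `|x| a; have := normr_ge0 p; have := ltW f_gt0.
  move: (total f) (V x) (`|x| `^ a) `|p| Vx => T W X P; nra.
apply/eqP; rewrite eq_le !leNgt; apply/andP; split; apply/negP => q0.
  have [r r1 hr] := sub _ q0; have r0 : 0 < r by exact: lt_le_trans r1.
  apply: (@not_nonneg_left r); apply: ae_imply uV => x E rx.
  have x0 : 0 < - x by exact: lt_le_trans rx.
  rewrite -(nmulr_rle0 _ c0) E; have := hr x; rewrite -normrN gtr0_norm// => /(_ rx).
  by lra.
have q0' : 0 < - q by rewrite oppr_gt0.
have [r r1 hr] := sub _ q0'; have r0 : 0 < r by exact: lt_le_trans r1.
apply: (@not_nonneg_right r); apply: ae_imply uV => x E rx.
have x0 : 0 < x by exact: lt_le_trans rx.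
rewrite -(nmulr_rle0 _ c0) E; have := hr x; rewrite gtr0_norm// => /(_ rx).
by lra.
Qed.

End sign_of_the_constant.

(** * The integral equation for the continuous representative *)

Section continuous_representative.
Context {R : realType}.
Notation mu := (@lebesgue_measure R).
Variables (s : R) (u : R -> R).
Hypotheses (s_gt : 2^-1 < s) (s_lt : s < 1).
Hypothesis u_sol : liouville_solution s u.
Hypothesis u_fin : (\int[mu]_x (expR (u x))%:E < +oo)%E.
Let a := 2 * s - 1.
Let a0 : 0 < a. Proof. by have := s_gt; rewrite /a; lra. Qed.
Let a1 : a < 1. Proof. by have := s_lt; rewrite /a; lra. Qed.
Notation f := (fun x => expR (u x)).
Notation V := (potential a f).

Let sf : summable f := summable_exp_solution u_sol u_fin.
Let f0 x : 0 <= f x. Proof. exact: expR_ge0. Qed.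
Let cV : continuous V := continuous_potential a0 a1 sf f0.

Lemma solution_ae_potential : exists p q,
  {ae mu, forall x, fracLap_const s * riesz_constant a * u x = V x + p + q * x}.
Proof.
set c := _ * riesz_constant a.
have lu : locally_summable u.
  by apply/locally_integrableP; have [[]] := u_sol.
have lV := locally_summable_continuous cV.
have lh : locally_integrable setT (fun x => c * u x - V x).
  by apply/locally_integrableP; apply: locally_summableB lV; exact: locally_summableZ.
have weak eta : test_function eta ->
    total (fun x => (c * u x - V x) * derive1 (derive1 eta) x) = 0.
  move=> teta.
  have [su E] := solution_weak_potential s_gt s_lt u_sol u_fin teta.
  have t2 := test_function_derive (test_function_derive teta).
  have [_ [b b0 vb]] := (test_functionP _).1 t2.
  have sV : summable (fun x => V x * derive1 (derive1 eta) x).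
    apply: (@summable_continuous_vanishing _ b); last by move=> x /vb ->; rewrite mulr0.
    by move=> x; apply: cvgM; [exact: cV|exact: smooth_continuous t2.1 x].
  apply/eqP; rewrite (total_ext (g := fun x => c * (u x * derive1 (derive1 eta) x) -
      V x * derive1 (derive1 eta) x)); last by move=> x; rewrite mulrBl mulrA.
  by rewrite (totalB (summableZ _ su) sV) (totalZ _ su) subr_eq0; apply/eqP.
have [p [q h]] := du_bois_reymond lh weak.
by exists p, q; apply: ae_imply h => x; lra.
Qed.

(** The functions [e^u] and [e^v] agree almost everywhere and have the same potential. An identity
    for [u] valid almost everywhere thus becomes a closed integral equation for [v], valid at every
    point, with [k = -1 / c]. *)
Lemma exists_continuous_representative : exists v k p, [/\ 0 < k,
  {ae mu, forall x, v x = u x}, summable (fun x => expR (v x)) &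
  forall x, v x = p - k * potential a (fun y => expR (v y)) x].
Proof.
have [p [q uV]] := solution_ae_potential; set c := _ * riesz_constant a in uV.
have c0 : c < 0 := weak_constant_lt0 a0 a1 sf uV.
have q0 : q = 0 := linear_term_eq0 a0 a1 sf uV.
pose v x := c^-1 * p - (- c^-1) * V x.
have uv : {ae mu, forall x, v x = u x}.
  apply: ae_imply uV => x; rewrite q0 mul0r addr0 => E.
  by rewrite /v mulNr opprK -mulrDr addrC -E mulKf// lt_eqF.
have cv : continuous v.
  move=> x; apply: cvgB; first exact: cvg_cst.
  by apply: cvgM; [exact: cvg_cst|exact: cV].
have mev : measurable_fun setT (fun x => expR (v x)).
  by apply: (measurableT_comp (@measurable_expR R)); exact: continuous_measurable_fun.
have euv : {ae mu, forall x, expR (u x) = expR (v x)}.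
  by apply: ae_imply uv => x ->.
exists v, (- c^-1), (c^-1 * p); split.
- by rewrite oppr_gt0 invr_lt0.
- exact: uv.
- exact: summable_ae sf.
move=> x; rewrite {1}/v; congr (_ - _ * _).
apply: total_ae.
- exact: summable_measurable (summable_potential a0 a1 sf f0 x).
- apply: summable_measurable (summable_potential a0 a1 _ _ x).
    exact: summable_ae sf.
  by move=> y; exact: expR_ge0.
- by apply: ae_imply euv => y ->.
Qed.

End continuous_representative.

(** * Regularity *)

Section gradient_operator.
Context {R : realType}.
Notation mu := (@lebesgue_measure R).
Variable a : R.
Hypotheses (a0 : 0 < a) (a1 : a < 1).
Implicit Types (c q x y z : R) (f g : R -> R).

(** The derivative of [|z|^a] divided by [a]; of size [|z|^(a - 1)], hence locally integrable. *)
Definition gradient_kernel z := z * `|z| `^ (a - 2).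

(** The variable [x] sits in the argument of [g]: differentiation then falls on [g] and not on the
    kernel, whose derivative is no longer locally integrable. *)
Definition gradient_potential g x := total (fun z => gradient_kernel z * g (x - z)).

(** The regularity induction moves between two classes: [gradient_potential] maps [decaying]
    functions to [tame] ones, and a decaying function times a tame one is decaying. *)
Definition decaying g := continuous g /\
  exists c, forall y, `|g y| <= c * (1 + `|y|) `^ (- 2).

Definition tame g := continuous g /\ exists c, forall y, `|g y| <= c.

Lemma decaying_bound_ge0 c g : (forall y, `|g y| <= c * (1 + `|y|) `^ (- 2)) -> 0 <= c.
Proof.
by move=> /(_ 0); rewrite normr0 addr0 powR1 mulr1; exact: le_trans.
Qed.

Lemma decaying_summable g : decaying g -> summable g.
Proof.
move=> [cg [c gc]]; have p2 : (1 : R) < 2 by rewrite ltr1n.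
exact: (summable_le (continuous_measurable_fun cg) (summableZ c (summable_weight p2)) gc).
Qed.

Lemma decaying_tameM f g : decaying f -> tame g -> decaying (f * g).
Proof.
move=> [cf [c fc]] [cg [d gd]]; split.
  by move=> x; apply: cvgM; [exact: cf|exact: cg].
have c0 := decaying_bound_ge0 fc.
exists (c * d) => y; rewrite normrM mulrAC ler_pM//.
Qed.

Lemma tameD f g : tame f -> tame g -> tame (f + g).
Proof.
move=> [cf [c fc]] [cg [d gd]]; split.
  by move=> x; apply: cvgD; [exact: cf|exact: cg].
by exists (c + d) => y; rewrite (le_trans (ler_normD _ _))// lerD.
Qed.

Lemma tameM f g : tame f -> tame g -> tame (f * g).
Proof.
move=> [cf [c fc]] [cg [d gd]]; split.
  by move=> x; apply: cvgM; [exact: cf|exact: cg].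
by exists (c * d) => y; rewrite normrM ler_pM.
Qed.

Lemma tame_cst c : tame (fun=> c).
Proof. by split; [move=> x; exact: cvg_cst|exists `|c|]. Qed.

(** Peetre's inequality: [1 + |z| <= (1 + |y|) (1 + |y - z|)]. *)
Lemma weight_translate q y z : 0 <= q ->
  (1 + `|y - z|) `^ (- q) <= (1 + `|y|) `^ q * (1 + `|z|) `^ (- q).
Proof.
move=> q0; have w0 x : 0 < 1 + `|x| by rewrite ltr_pwDl.
rewrite !powRN ler_pdivlMr ?powR_gt0// mulrC ler_pdivrMr ?powR_gt0//.
rewrite -powRM ?(ltW (w0 _))//.
rewrite ge0_ler_powR ?nnegrE ?mulr_ge0 ?(ltW (w0 _))//.
have := ler_normB y (y - z); rewrite subKr.
have : 0 <= `|y| * `|y - z| by rewrite mulr_ge0.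
lra.
Qed.

Lemma norm_gradient_kernel z : `|gradient_kernel z| = `|z| `^ (a - 1).
Proof.
rewrite /gradient_kernel normrM (ger0_norm (powR_ge0 _ _)).
have [->|z0] := eqVneq z 0; first by rewrite normr0 mul0r powR0// subr_eq0 lt_eqF.
have n0 : 0 < `|z| by rewrite normr_gt0.
by rewrite -{1}(powRr1 (normr_ge0 z)) -powRD_gt0// (_ : 1 + (a - 2) = a - 1)//; ring.
Qed.

Lemma measurable_gradient_kernel : measurable_fun setT gradient_kernel.
Proof. by apply: measurable_funM; [exact: measurable_id|exact: measurable_powR_norm]. Qed.

Let near_singular z := if `|z| <= 1 then `|z| `^ (- (1 - a)) else 0.

Let summable_near_singular : summable near_singular.
Proof. by apply: summable_singularity; have := a0; have := a1; lra. Qed.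

Let near_singular_ge0 z : 0 <= near_singular z.
Proof. by rewrite /near_singular; case: ifP => // _; exact: powR_ge0. Qed.

Let kernel_le_near_singular z : `|gradient_kernel z| <= near_singular z + 1.
Proof.
rewrite norm_gradient_kernel /near_singular.
have [z1|z1] := leP `|z| 1; first by rewrite opprB lerDl.
rewrite add0r -[leRHS](powRr0 `|z|) ler_powR ?(ltW z1)//.
by have := a1; lra.
Qed.

Let near_singular_weight q z : 0 <= q ->
  near_singular z * (1 + `|z|) `^ (- q) <= near_singular z.
Proof.
move=> q0; rewrite ler_piMr// -[leRHS](powRr0 (1 + `|z|)).
by rewrite ler_powR ?lerDl// oppr_le0.
Qed.

Lemma gradient_dominated g x : decaying g -> exists2 h, summable h &
  forall z y, `|z - x| < 1 -> `|gradient_kernel y * g (z - y)| <= h y.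
Proof.
move=> [cg [c gc]]; have c0 := decaying_bound_ge0 gc.
pose w y : R := (1 + `|y|) `^ (- 2).
have sw : summable w by apply: summable_weight; rewrite ltr1n.
exists (fun y => c * (2 + `|x|) `^ 2 * (near_singular y + w y)).
  exact: summableZ (summableD summable_near_singular sw).
move=> z y zx; rewrite normrM mulrC.
have w0 : 0 <= w y by exact: powR_ge0.
have z2 : 1 + `|z| <= 2 + `|x|.
  have := ler_normD (z - x) x; rewrite subrK; lra.
have gz : `|g (z - y)| <= c * (2 + `|x|) `^ 2 * w y.
  apply: le_trans (gc _) _; rewrite -mulrA ler_wpM2l//.
  apply: le_trans (weight_translate z y (ler0n R 2)) _.
  by rewrite ler_wpM2r// ge0_ler_powR ?nnegrE ?addr_ge0.
apply: le_trans (ler_pM (normr_ge0 _) (normr_ge0 _) gz (kernel_le_near_singular y)) _.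
rewrite -[leLHS]mulrA ler_wpM2l ?mulr_ge0 ?powR_ge0// mulrDr mulr1 mulrC lerD2r.
by apply: near_singular_weight; rewrite ler0n.
Qed.

Lemma measurable_gradient_integrand g x : continuous g ->
  measurable_fun setT (fun z => gradient_kernel z * g (x - z)).
Proof.
move=> cg; apply: measurable_funM; first exact: measurable_gradient_kernel.
exact: measurable_sub_comp (continuous_measurable_fun cg).
Qed.

Lemma summable_gradient g x : decaying g ->
  summable (fun z => gradient_kernel z * g (x - z)).
Proof.
move=> dg; have [h sh dom] := gradient_dominated x dg.
apply: (summable_le (measurable_gradient_integrand x dg.1) sh) => z.
by apply: dom; rewrite subrr normr0.
Qed.

Lemma tame_gradient_potential g : decaying g -> tame (gradient_potential g).
Proof.
move=> dg; split.
  apply: continuous_total => [x|y|x]; first exact: measurable_gradient_integrand dg.1.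
    move=> x; apply: cvgM; first exact: cvg_cst.
    apply: continuous_comp; last exact: dg.1.
    by apply: cvgB; [exact: cvg_id|exact: cvg_cst].
  exact: gradient_dominated.
have [cg [c gc]] := dg; have c0 := decaying_bound_ge0 gc.
pose w y : R := (1 + `|y|) `^ (- 2).
have sw : summable w by apply: summable_weight; rewrite ltr1n.
exists (c * (total near_singular + total w)) => x.
have sw' := summable_reflect x sw.
rewrite -(total_reflect x sw) -(totalD summable_near_singular sw').
rewrite -(totalZ _ (summableD summable_near_singular sw')).
apply: total_norm_le_dom; first exact: measurable_gradient_integrand.
  exact: summableZ (summableD summable_near_singular sw').
move=> z; rewrite normrM mulrC.
have w0 : 0 <= w (x - z) by exact: powR_ge0.
have w1 : w (x - z) <= 1.
  by rewrite -[leRHS](powRr0 (1 + `|x - z|)) ler_powR ?lerDl// oppr_le0.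
apply: le_trans (ler_pM (normr_ge0 _) (normr_ge0 _) (gc _) (kernel_le_near_singular z)) _.
rewrite -mulrA ler_wpM2l// mulrDr mulr1 lerD2r.
by rewrite -[leRHS]mul1r ler_wpM2r.
Qed.

Lemma is_derive_gradient_potential f g x : decaying f -> decaying g ->
  (forall y, is_derive y 1 f (g y)) ->
  is_derive x 1 (gradient_potential f) (gradient_potential g x).
Proof.
move=> df dg fg; apply: (is_derive_total (dF := fun x z => gradient_kernel z * g (x - z))).
- by move=> y; exact: summable_gradient.
- move=> y z.
  have h : is_derive y 1 (fun t => f (t - z)) (g (y - z)).
    have := @is_derive_affine _ 1 (- z) f y (g (y - z)); rewrite !mul1r => h.
    have -> : (fun t => f (t - z)) = (fun t => f (1 * t + - z)) by apply/funext => t; rewrite mul1r.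
    exact: h.
  by apply: is_derive_eq; rewrite /GRing.scale/=; ring.
- exact: gradient_dominated.
Qed.

(** By [lipschitz_powR_norm] the difference quotients of the kernel are bounded by [|x - y|^(a - 1)]
    for every step, even across the singularity, so dominated convergence applies off the point
    [y = x]. *)
Lemma is_derive_potential f x : decaying f -> (forall y, 0 <= f y) ->
  is_derive x 1 (potential a f) (a * gradient_potential f x).
Proof.
move=> df f0; have sf := decaying_summable df; have mf := summable_measurable sf.
have sk := summable_gradient x df.
have sk' := summable_reflect x sk.
rewrite /gradient_potential -(total_reflect x sk) -(totalZ _ sk').
apply: is_derive_quotient; apply/cvgr_dnbhsP => h [h0 hcv].
pose F n y := (h n)^-1 * ((`|y - (h n + x)| `^ a - `|y - x| `^ a) * f y).
pose G y := a * (gradient_kernel (x - y) * f (x - (x - y))).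
have sF n : summable (F n).
  apply: summableZ; apply: summable_ext (summableB (summable_potential a0 a1 sf f0 (h n + x))
    (summable_potential a0 a1 sf f0 x)) => y; ring.
have E n : (h n)^-1 * (potential a f (h n + x) - potential a f x) = total (F n).
  rewrite /potential -(totalB (summable_potential a0 a1 sf f0 _) (summable_potential a0 a1 sf f0 _)).
  rewrite -totalZ; last by apply: summableB; exact: summable_potential.
  by apply: total_ext => y; rewrite /F; ring.
rewrite (_ : (fun n => _) = total \o F); last by apply/funext => n; exact: E.
(* The difference quotients are not dominated at the single point x. *)
pose D := ~` [set x].
have mD : measurable D by exact: measurableC.
have offx (g : R -> R) : {ae mu, forall y, g y = (g \_ D) y}.
  exists [set x]; split => //; first exact: lebesgue_measure_set1.
  move=> y /= gy; apply/eqP/negPn/negP => /eqP yx; apply: gy.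
  by rewrite patchE mem_set.
have mG : measurable_fun setT G by exact: summable_measurable (summableZ a sk').
have mFn n := summable_measurable (sF n).
rewrite (total_ae mG (measurable_patch mD mG) (offx G)).
rewrite (_ : total \o F = fun n => total (F n \_ D)); last first.
  by apply/funext => n; exact: total_ae (mFn n) (measurable_patch mD (mFn n)) (offx (F n)).
apply: (dominated_total (g := fun y => `|gradient_kernel (x - y) * f (x - (x - y))|)).
- by move=> n; exact: measurable_patch.
- exact: summable_norm.
- move=> n y; rewrite patchE; case: ifPn => [/set_mem yx|_]; last by rewrite normr0.
  rewrite /F subKr [leRHS]normrM norm_gradient_kernel !normrM mulrA ler_wpM2r//.
  rewrite normfV ler_pdivrMl ?normr_gt0// (distrC x y).
  have yx0 : y - x != 0 by rewrite subr_eq0; apply/eqP.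
  have := lipschitz_powR_norm (- h n) a0 (ltW a1) yx0.
  by rewrite normrN (_ : y - (h n + x) = y - x - h n)//; ring.
- apply: aeW => y; have [->|yx] := eqVneq y x.
    have xD : (x \in D) = false by apply/negbTE/negP => /set_mem; exact.
    rewrite (_ : (fun n => _) = fun=> 0); last by apply/funext => n; rewrite patchE xD.
    by rewrite patchE xD; exact: cvg_cst.
  have yD : y \in D by apply/mem_set/eqP.
  rewrite (_ : (fun n => _) = F ^~ y); last by apply/funext => n; rewrite patchE yD.
  rewrite patchE yD /F /G subKr.
  have xy0 : 1 * x - y != 0 by rewrite mul1r subr_eq0 eq_sym.
  have d := is_derive_quotient_cvg (is_derive_affine (is_derive_powR_norm a xy0)).
  have := (cvgr_dnbhsP _ _ _).1 d h (conj h0 hcv) => {}d.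
  have -> : a * (gradient_kernel (x - y) * f y) =
      1 * (a * ((1 * x - y) * `|1 * x - y| `^ (a - 2))) * f y.
    by rewrite !mul1r mulrA.
  apply: cvg_trans (cvgM d (cvg_cst (f y))); apply: near_eq_cvg; near=> n => /=.
  by rewrite !mul1r -mulrA (distrC (h n + x)) (distrC x).
- exact: measurable_patch.
Unshelve. all: by end_near. Qed.

End gradient_operator.

(** * Growth, decay and smoothness of solutions of the integral equation *)

Section profile_regularity.
Context {R : realType}.
Variables (a k p : R) (v : R -> R).
Hypotheses (a0 : 0 < a) (a1 : a < 1) (k0 : 0 < k).
Notation f := (fun x => expR (v x)).
Hypothesis sf : summable f.
Hypothesis vE : forall x, v x = p - k * potential a f x.
Implicit Types (c r x y z : R).

Let f0 x : 0 <= f x. Proof. exact: expR_ge0. Qed.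

Lemma profile_continuous : continuous v.
Proof.
rewrite (_ : v = fun x => p - k * potential a f x); last exact/funext.
move=> x; apply: cvgB; first exact: cvg_cst.
by apply: cvgM; [exact: cvg_cst|exact: continuous_potential].
Qed.

Lemma profile_upper_bound : exists c d, 0 < d /\ forall x, v x <= c - d * `|x| `^ a.
Proof.
have [c h] := potential_lower_bound a0 a1 sf f0.
exists (p + k * c), (k * (total f / 2)); split.
  by rewrite mulr_gt0// divr_gt0// total_gt0// => x; exact: expR_gt0.
move=> x; rewrite vE -addrA lerD2l -mulrA -mulrBr -mulrN ler_wpM2l ?(ltW k0)//.
by rewrite -opprB lerN2.
Qed.

Lemma profile_bounded_above : exists c, forall x, v x <= c.
Proof.
have [c [d [d0 h]]] := profile_upper_bound; exists c => x.
by rewrite (le_trans (h x))// gerBl mulr_ge0 ?powR_ge0// ltW.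
Qed.

Lemma profile_growth : exists c, forall x, 1 <= `|x| -> `|v x| <= c * `|x| `^ a.
Proof.
exists (`|p| + k * total f) => x x1; rewrite vE.
have xa : 1 <= `|x| `^ a by rewrite -[leLHS](powRr0 `|x|) ler_powR// ltW.
rewrite (le_trans (ler_normB _ _))// mulrDl lerD//; first by rewrite ler_peMr.
rewrite normrM gtr0_norm// -mulrA ler_wpM2l ?(ltW k0)// mulrC.
exact: potential_le.
Qed.

Lemma profile_tends_to_minus_infinity c : exists2 r, 1 <= r &
  forall x, r <= `|x| -> v x <= c.
Proof.
have [c1 [d [d0 h]]] := profile_upper_bound.
have [r r1 hr] := powR_unbounded ((c1 - c) / d) a0.
exists r => // x rx; apply: le_trans (h x) _.
by rewrite lerBlDr -lerBlDl mulrC -ler_pdivrMr// hr.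
Qed.

(** From [v <= c - d |x|^a]: the single term of order [n + 1 >= 2 / a] in the exponential series
    already gives decay of order 2. *)
Lemma decaying_profile : decaying f.
Proof.
split; first by move=> x; apply: continuous_comp; [exact: profile_continuous|exact: continuous_expR].
have [c [d [d0 h]]] := profile_upper_bound.
pose n := Num.Def.archi_bound (2 / a).
have na : 2 / a <= n.+1%:R.
  rewrite (le_trans (ltW (archi_boundP _)))//; first by rewrite divr_ge0// ltW.
  by rewrite ler_nat.
pose B := expR c * (4 + 4 * ((n.+1)`!%:R / d ^+ n.+1)).
have D0 : 0 < d ^+ n.+1 by exact: exprn_gt0.
exists B => x; rewrite ger0_norm// powRN -(@ler_pdivrMr _ (_^-1)) ?invr_gt0 ?powR_gt0 ?ltr_pwDl//.
rewrite invrK powR_mulrn ?addr_ge0//.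
set t := `|x| `^ a; have t0 : 0 <= t by exact: powR_ge0.
have fx : f x <= expR c * (expR (d * t))^-1.
  by rewrite -expRN -expRD ler_expR h.
rewrite (le_trans (ler_wpM2r (exprn_ge0 _ _) fx)) ?addr_ge0// -mulrA ler_wpM2l ?expR_ge0//.
rewrite mulrC ler_pdivrMr ?expR_gt0//.
have e1 : 1 <= expR (d * t) by rewrite -[leLHS]expR0 ler_expR mulr_ge0// ltW.
have e2 : (d * t) ^+ n.+1 / (n.+1)`!%:R <= expR (d * t).
  rewrite (le_trans _ (expR_ge1Dxn n (mulr_ge0 (ltW d0) t0)))//.
  by rewrite lerDr.
have F0 : 0 < (n.+1)`!%:R :> R by rewrite ltr0n fact_gt0.
have e3 : t ^+ n.+1 <= (n.+1)`!%:R / d ^+ n.+1 * expR (d * t).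
  by rewrite mulrAC ler_pdivlMr// -ler_pdivrMl// mulrC (mulrC (t ^+ _)) -exprMn.
have C0 : 0 <= (n.+1)`!%:R / d ^+ n.+1 by rewrite divr_ge0// ltW.
(* The two summands of [B] answer the cases [|x| <= 1] and [|x| > 1]; in the latter
   [|x|^2 <= t^(n + 1)] because [(n + 1) a >= 2]. *)
suff : (1 + `|x|) ^+ 2 <= 4 \/ (1 + `|x|) ^+ 2 <= 4 * t ^+ n.+1.
  have CE0 : 0 <= (n.+1)`!%:R / d ^+ n.+1 * expR (d * t) by rewrite mulr_ge0 ?expR_ge0.
  move: e1 e3 CE0; move: (expR (d * t)) (_ / d ^+ _) (t ^+ _) => E C T e1 e3 CE0.
  rewrite (_ : (4 + 4 * C) * E = 4 * E + 4 * (C * E)); last by ring.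
  by move: (C * E) e3 CE0 => CE e3 CE0 [] h1; lra.
have [x1|x1] := leP `|x| 1; [left|right].
  by rewrite (_ : 4 = (1 + 1) ^+ 2); [rewrite lerXn2r ?nnegrE ?addr_ge0// lerD2l|ring].
rewrite (@le_trans _ _ (4 * `|x| ^+ 2))//.
  rewrite (_ : 4 * `|x| ^+ 2 = (`|x| + `|x|) ^+ 2); last by ring.
  by rewrite lerXn2r ?nnegrE ?addr_ge0// lerD2r ltW.
rewrite ler_wpM2l// /t -!powR_mulrn ?powR_ge0// -powRrM ler_powR ?(ltW x1)//.
by rewrite mulrC -ler_pdivrMr.
Qed.

Definition slope x := - k * (a * gradient_potential a f x).

Lemma is_derive_profile x : is_derive x 1 v (slope x).
Proof.
have h := is_derive_potential a0 a1 x decaying_profile f0.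
rewrite (_ : v = fun x => p + - k * potential a f x); last first.
  by apply/funext => y; rewrite vE mulNr.
by apply: is_derive_eq; rewrite /slope /GRing.scale/=; ring.
Qed.

(** The derivative is again [f] times a function, so the decay of [f] is never lost in repeated
    differentiation. *)
Lemma is_derive_exp_profile g g' x : is_derive x 1 g g' ->
  is_derive x 1 (f * g) ((f * (slope * g + fun=> g')) x).
Proof.
move=> gg'; have vv := is_derive_profile x.
have h := @is_derive1_comp R expR v x _ _ (is_derive_expR (v x)) vv.
by apply: is_derive_eq; rewrite /GRing.scale/= !fctE; ring.
Qed.

Lemma tame_slope : tame slope.
Proof.
rewrite (_ : slope = (fun=> - k * a) * gradient_potential a f); last first.
  by apply/funext => x; rewrite /slope mulrA.
by apply: tameM; [exact: tame_cst|exact: tame_gradient_potential decaying_profile].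
Qed.

(** With [T] the gradient potential, the derivative of [T (f g)] is [T (f (v' g + g'))], so [n]
    derivatives of [T (f g)] cost only [n - 1] of the slope [v']. As [v'] is itself a multiple of
    [T f], this gain of one order closes the induction in [iter_derivable_slope]. *)
Lemma iter_derivable_gradient n g : iter_derivable tame n g -> iter_derivable tame n.-1 slope ->
  iter_derivable tame n (gradient_potential a (f * g)).
Proof.
elim: n g => [|n IH] g ig islope.
  split => //; apply: tame_gradient_potential => //.
  exact: decaying_tameM decaying_profile (iter_derivable_base ig).
have tg := iter_derivable_base ig; have ig0 := iter_derivableW ig.
split.
  by apply: tame_gradient_potential => //; exact: decaying_tameM decaying_profile tg.
case: ig => _ [dg ig].
have d x : is_derive x 1 (f * g) ((f * (slope * g + derive1 g)) x).
  have := is_derive_exp_profile (DeriveDef (dg x) erefl); rewrite -derive1E; exact.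
have ih : iter_derivable tame n (slope * g + derive1 g).
  by apply: (iter_derivableD tameD) => //; exact: (iter_derivableM tameD tameM).
have dT x := is_derive_gradient_potential a0 a1 x
  (decaying_tameM decaying_profile tg)
  (decaying_tameM decaying_profile (iter_derivable_base ih)) d.
split; first by move=> x; have := dT x; case.
have -> : derive1 (gradient_potential a (f * g)) = gradient_potential a (f * (slope * g + derive1 g)).
  by apply/funext => x; rewrite derive1E (derive_val (is_derive := dT x)).
apply: IH => //.
by case: n islope {ih ig ig0} => // n; exact: iter_derivableW.
Qed.

Lemma iter_derivable_slope n : iter_derivable tame n slope.
Proof.
elim: n => [|n IH]; first by split => //; exact: tame_slope.
rewrite (_ : slope = (fun=> - k * a) * gradient_potential a (f * fun=> 1)); last first.
  by apply/funext => x; rewrite /slope mulrA; congr (_ * gradient_potential a _ x); apply/funext => y; rewrite /= mulr1.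
apply: (iter_derivableM tameD tameM); first exact: iter_derivable_cst tame_cst.
by apply: iter_derivable_gradient => //; exact: iter_derivable_cst tame_cst.
Qed.

Lemma profile_smooth : smooth v.
Proof.
apply: (@smooth_iter_derivable _ (fun=> True)) => -[|n]; first by [].
split => //; split; first by move=> x; have := is_derive_profile x; case.
have -> : derive1 v = slope.
  by apply/funext => x; rewrite derive1E (derive_val (is_derive := is_derive_profile x)).
exact: iter_derivable_sub (iter_derivable_slope n).
Qed.

End profile_regularity.

(** * Moving planes *)

Section moving_planes.
Context {R : realType}.
Notation mu := (@lebesgue_measure R).
Variables (a k p : R) (v : R -> R).
Hypotheses (a0 : 0 < a) (a1 : a < 1) (k0 : 0 < k).
Notation f := (fun x => expR (v x)).
Hypothesis sf : summable f.
Hypothesis vE : forall x, v x = p - k * potential a f x.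
Implicit Types (b c l m r x y z : R).

Let f0 x : 0 <= f x. Proof. exact: expR_ge0. Qed.
Let cv : continuous v := profile_continuous a0 a1 sf vE.
Let df : decaying f := decaying_profile a0 a1 k0 sf vE.
Let mf : measurable_fun setT f := summable_measurable sf.

Definition plane_kernel l x y := `|2 * l - x - y| `^ a - `|x - y| `^ a.

Lemma plane_kernel_reflect l x y : plane_kernel l x (2 * l - y) = - plane_kernel l x y.
Proof.
have e1 : 2 * l - x - (2 * l - y) = - (x - y) by ring.
have e2 : x - (2 * l - y) = - (2 * l - x - y) by ring.
by rewrite /plane_kernel e1 e2 !normrN opprB.
Qed.

Lemma plane_kernel_gt0 l x y : l < x -> l < y -> 0 < plane_kernel l x y.
Proof.
move=> lx ly; rewrite subr_gt0 gt0_ltr_powR ?nnegrE//.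
rewrite (ltr0_norm (_ : 2 * l - x - y < 0)); last by lra.
by rewrite ltr_norml; apply/andP; split; lra.
Qed.

(** The bound is independent of [x], which makes the contraction factor uniform. *)
Lemma plane_kernel_le l x y : `|plane_kernel l x y| <= (2 * `|y - l|) `^ a.
Proof.
rewrite /plane_kernel -(normrN (x - y)) (le_trans (holder_powR_norm _ _ a0 (ltW a1)))//.
have -> : 2 * l - x - y - - (x - y) = - (2 * (y - l)) by ring.
by rewrite normrN normrM ger0_norm.
Qed.

Lemma continuous_plane_kernel l x : continuous (plane_kernel l x).
Proof.
move=> y; apply: cvgB.
  apply: (@continuous_comp _ _ _ (fun y => 2 * l - x - y) (fun z => `|z| `^ a)); last exact: continuous_powR_norm.
  by apply: cvgB; [exact: cvg_cst|exact: cvg_id].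
apply: (@continuous_comp _ _ _ (fun y => x - y) (fun z => `|z| `^ a)); last exact: continuous_powR_norm.
by apply: cvgB; [exact: cvg_cst|exact: cvg_id].
Qed.

(** Decay of order 2 against growth of order [a] leaves the summable order [2 - a > 1]. The result
    is a majorant for all planes with [|l| <= b] at once. *)
Lemma summable_moment b : 0 <= b -> summable (fun y => (2 * (`|y| + b)) `^ a * f y).
Proof.
move=> b0; have [_ [c fc]] := df; have c0 := decaying_bound_ge0 fc.
have q1 : 1 < 2 - a by have := a1; lra.
apply: (summable_le _ (summableZ ((2 * (1 + b)) `^ a * c) (summable_weight q1))).
  apply: measurable_funM => //; apply: (measurableT_comp (measurable_powR a)).
  by apply: measurable_funM => //; apply: measurable_funD => //; exact: normr_measurable.
move=> y; rewrite normrM (ger0_norm (powR_ge0 _ _)).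
have y1 : 0 < 1 + `|y| by rewrite ltr_pwDl.
have h1 : (2 * (`|y| + b)) `^ a <= (2 * (1 + b)) `^ a * (1 + `|y|) `^ a.
  rewrite -powRM ?(ltW y1) ?mulr_ge0 ?addr_ge0//.
  rewrite ge0_ler_powR ?nnegrE ?(ltW a0) ?mulr_ge0 ?addr_ge0//.
  rewrite -mulrA ler_wpM2l//; have : 0 <= b * `|y| by rewrite mulr_ge0.
  have := normr_ge0 y; lra.
apply: le_trans (ler_pM (powR_ge0 _ _) (normr_ge0 _) h1 (fc y)) _.
rewrite mulrACA -powRD_gt0// (_ : a + - 2 = - (2 - a))//; ring.
Qed.

Lemma summable_plane_weight l : summable (fun y => (2 * `|y - l|) `^ a * f y).
Proof.
apply: (summable_le _ (summable_moment (normr_ge0 l))).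
  apply: measurable_funM => //; apply: (measurableT_comp (measurable_powR a)).
  apply: measurable_funM => //; apply: measurableT_comp; first exact: normr_measurable.
  exact: measurable_funB.
move=> y; rewrite ger0_norm ?mulr_ge0 ?powR_ge0// ler_wpM2r//.
by rewrite ge0_ler_powR ?nnegrE ?(ltW a0) ?mulr_ge0 ?addr_ge0// ler_wpM2l// ler_normB.
Qed.

(* Invariant under [y -> 2 l - y]: integrals over [y > l] are halves of integrals
   over the whole line. *)
Definition reflected_integrand l x y := plane_kernel l x y * (f y - f (2 * l - y)).

Let kernel_integrand_le l x y :
  `|plane_kernel l x y * f y| <= (2 * `|y - l|) `^ a * f y.
Proof. by rewrite normrM (ger0_norm (f0 _)) ler_wpM2r// plane_kernel_le. Qed.

Let summable_kernel l x : summable (fun y => plane_kernel l x y * f y).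
Proof.
apply: (summable_le _ (summable_plane_weight l) (kernel_integrand_le l x)).
apply: measurable_funM => //.
have c : continuous (plane_kernel l x : R -> R) by exact: continuous_plane_kernel.
exact: continuous_measurable_fun c.
Qed.

Lemma summable_reflected_integrand l x : summable (reflected_integrand l x).
Proof.
have h := summableD (summable_kernel l x) (summable_reflect (2 * l) (summable_kernel l x)).
apply: summable_ext h => y; rewrite plane_kernel_reflect /reflected_integrand; ring.
Qed.

Let profile_difference_kernel l x :
  v x - v (2 * l - x) = k * total (fun y => plane_kernel l x y * f y).
Proof.
have -> : v x - v (2 * l - x) = k * (potential a f (2 * l - x) - potential a f x).
  by rewrite !vE; move: (potential _ _ _) (potential _ _ _) => V W; ring.
congr (k * _); rewrite /potential -(totalB (summable_potential a0 a1 sf f0 _) (summable_potential a0 a1 sf f0 _)).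
apply: total_ext => y; rewrite -mulrBl /plane_kernel; congr (_ * _).
rewrite (_ : y - (2 * l - x) = - (2 * l - x - y)) ?normrN; last by ring.
by rewrite (distrC y x); ring.
Qed.

Lemma profile_difference l x :
  v x - v (2 * l - x) = k / 2 * total (reflected_integrand l x).
Proof.
rewrite profile_difference_kernel -mulrA; congr (_ * _).
have sk := summable_kernel l x; have sk' := summable_reflect (2 * l) sk.
have -> : total (reflected_integrand l x) =
    total (fun y => plane_kernel l x y * f y) + total (fun y => plane_kernel l x y * f y).
  rewrite -{2}(total_reflect (2 * l) sk) -(totalD sk sk'); apply: total_ext => y.
  by rewrite plane_kernel_reflect /reflected_integrand; ring.
by move: (total _) => T; field.
Qed.

(** An upper bound independent of [x]: the starting value for iterating the contraction. *)
Lemma profile_difference_le l x :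
  v x - v (2 * l - x) <= k * total (fun y => (2 * `|y - l|) `^ a * f y).
Proof.
rewrite profile_difference_kernel ler_wpM2l ?(ltW k0)//.
apply: total_le; [exact: summable_kernel|exact: summable_plane_weight|].
by move=> y; apply: le_trans (ler_norm _) (kernel_integrand_le l x y).
Qed.

(** The integrand of the contraction factor, which is [k * total (excess_weight l)]: the uniform
    kernel bound times [f], on the part of the half-line where the desired inequality fails. *)
Definition excess_weight l y :=
  if (l < y) && (v (2 * l - y) < v y) then (2 * `|y - l|) `^ a * f y else 0.

Lemma excess_weight_ge0 l y : 0 <= excess_weight l y.
Proof. by rewrite /excess_weight; case: ifP => // _; rewrite mulr_ge0 ?powR_ge0. Qed.

Lemma excess_weight_le l y : excess_weight l y <= (2 * `|y - l|) `^ a * f y.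
Proof. by rewrite /excess_weight; case: ifP => // _; rewrite mulr_ge0 ?powR_ge0. Qed.

Lemma measurable_excess_weight l : measurable_fun setT (excess_weight l).
Proof.
have mv := continuous_measurable_fun cv.
apply: measurable_fun_ifT => //; last exact: summable_measurable (summable_plane_weight l).
apply: measurable_and; first exact: measurable_fun_ltr.
by apply: measurable_fun_ltr => //; exact: measurable_sub_comp.
Qed.

Lemma summable_excess_weight l : summable (excess_weight l).
Proof.
apply: (summable_le (measurable_excess_weight l) (summable_plane_weight l)) => y.
by rewrite ger0_norm ?excess_weight_ge0// excess_weight_le.
Qed.

Lemma reflected_integrand_reflect l x y :
  reflected_integrand l x (2 * l - y) = reflected_integrand l x y.
Proof. by rewrite /reflected_integrand plane_kernel_reflect subKr; ring. Qed.

(** Where [v] exceeds its reflection by [d > 0], the difference of exponentials is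
    [f y (1 - e^(-d)) <= f y d]; elsewhere the positive kernel makes the integrand nonpositive. *)
Let reflected_integrand_right l x y c : l < x -> l < y -> 0 <= c ->
  (forall z, l < z -> v z - v (2 * l - z) <= c) ->
  reflected_integrand l x y <= c * excess_weight l y.
Proof.
move=> lx ly c0 hc; have kp := plane_kernel_gt0 lx ly.
rewrite /reflected_integrand /excess_weight ly/=; case: ifPn => [vy|].
  rewrite mulrCA ler_pM ?(ltW kp)//.
  - by rewrite subr_ge0 ler_expR ltW.
  - exact: le_trans (ler_norm _) (plane_kernel_le l x y).
  - have -> : v (2 * l - y) = v y + - (v y - v (2 * l - y)) by ring.
    rewrite expRD -{1}(mulr1 (expR (v y))) -mulrBr mulrC ler_wpM2r//.
    apply: le_trans (hc _ ly); have := expR_ge1Dx (- (v y - v (2 * l - y))); lra.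
rewrite -leNgt => vy; rewrite mulr0 pmulr_rle0// subr_le0 ler_expR//.
Qed.

Lemma profile_difference_contraction l c : 0 <= c ->
  (forall z, l < z -> v z - v (2 * l - z) <= c) ->
  forall z, l < z -> v z - v (2 * l - z) <= k * total (excess_weight l) * c.
Proof.
move=> c0 hc x lx.
have sw := summable_excess_weight l; have sw' := summable_reflect (2 * l) sw.
rewrite profile_difference.
(* The reflected summand covers the points to the left of the plane; both summands have the same
   integral, which absorbs the factor 1/2. *)
rewrite (@le_trans _ _ (k / 2 * total (fun y => c * (excess_weight l y + excess_weight l (2 * l - y)))))//.
  rewrite ler_wpM2l ?divr_ge0 ?(ltW k0)//.
  apply: total_le; [exact: summable_reflected_integrand|exact: summableZ (summableD sw sw')|].
  move=> y; have [ly|yl|->] := ltgtP l y.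
  - apply: le_trans (reflected_integrand_right lx ly c0 hc) _.
    by rewrite ler_wpM2l// lerDl excess_weight_ge0.
  - rewrite -reflected_integrand_reflect.
    have ly' : l < 2 * l - y by lra.
    apply: le_trans (reflected_integrand_right lx ly' c0 hc) _.
    by rewrite ler_wpM2l// lerDr excess_weight_ge0.
  - rewrite /reflected_integrand (_ : 2 * y - y = y); last by ring.
    by rewrite subrr mulr0 mulr_ge0// addr_ge0 ?excess_weight_ge0.
rewrite (totalZ _ (summableD sw sw')) (totalD sw sw') (total_reflect (2 * l) sw).
by move: (total _) => T; rewrite le_eqVlt; apply/orP; left; apply/eqP; field.
Qed.

(** Iterating the contraction from the bound [S] gives [S q^n] for every [n], which tends to 0. *)
Lemma profile_le_reflection l : k * total (excess_weight l) < 1 ->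
  forall x, l < x -> v x <= v (2 * l - x).
Proof.
set q := k * _ => q1 x lx.
have q0 : 0 <= q by rewrite mulr_ge0 ?(ltW k0)// total_ge0// => y; exact: excess_weight_ge0.
set S := k * total (fun y => (2 * `|y - l|) `^ a * f y).
have S0 : 0 <= S.
  by rewrite mulr_ge0 ?(ltW k0)// total_ge0// => y; rewrite mulr_ge0 ?powR_ge0.
have iter n : forall z, l < z -> v z - v (2 * l - z) <= S * q ^+ n.
  elim: n => [|n IH] z lz; first by rewrite expr0 mulr1 profile_difference_le.
  rewrite exprS mulrCA; apply: profile_difference_contraction => //.
  by rewrite mulr_ge0// exprn_ge0.
rewrite -subr_le0; have q1' : `|q| < 1 by rewrite ger0_norm.
apply: (cvgr_to_ge (cvg_geometric S q1')).
by near=> n; exact: iter.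
Unshelve. all: by end_near. Qed.

(** Serves planes going to infinity as well as planes approaching the critical position [m]; in the
    second case nothing is known at the point [m] itself. *)
Lemma total_excess_cvg0 (l_ : nat -> R) b m : 0 <= b ->
  (forall n y, excess_weight (l_ n) y <= (2 * (`|y| + b)) `^ a * f y) ->
  (forall y, y != m -> \forall n \near \oo, excess_weight (l_ n) y = 0) ->
  exists n, k * total (excess_weight (l_ n)) < 1.
Proof.
move=> b0 dom ev0.
have : total (excess_weight (l_ n)) @[n --> \oo] --> 0.
  rewrite -(@total0 R).
  apply: (dominated_total (g := fun y => (2 * (`|y| + b)) `^ a * f y)).
  - by move=> n; exact: measurable_excess_weight.
  - exact: summable_moment.
  - by move=> n y; rewrite ger0_norm ?excess_weight_ge0.
  - exists [set m]; split => //; first exact: lebesgue_measure_set1.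
    move=> y /= hy; apply/eqP/negPn/negP => ym; apply: hy.
    by apply: cvg_near_cst; exact: ev0.
  - by [].
move=> /cvgrPdist_lt/(_ k^-1); rewrite invr_gt0 => /(_ k0)[n _ /(_ n (leqnn n))]/=.
rewrite sub0r normrN ger0_norm ?total_ge0//; last by move=> y; exact: excess_weight_ge0.
by move=> h; exists n; rewrite mulrC -ltr_pdivlMr// div1r.
Qed.

(** Planes [l_n >= n] violating the claim have factors at least 1, yet their half-lines leave every
    point behind. As [0 <= l_n < y] gives [|y - l_n| <= |y|], the majorant with [b = 0] applies to
    all of them. *)
Lemma profile_le_reflection_far : exists l0, forall l, l0 <= l ->
  forall x, l < x -> v x <= v (2 * l - x).
Proof.
apply: contrapT => /forallNP no.
have /choice[l_ hl] n : exists l, n%:R <= l /\ ~ (k * total (excess_weight l) < 1).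
  apply: contrapT => no'; apply: (no n%:R) => l nl; apply: profile_le_reflection.
  by apply: contrapT => h; apply: no'; exists l.
have [n hn] : exists n, k * total (excess_weight (l_ n)) < 1; last by case: (hl n).
apply: (@total_excess_cvg0 l_ 0 0) => // [n y|y _].
  rewrite addr0 /excess_weight; case: ifPn => [/andP[ly _]|_]; last first.
    by rewrite mulr_ge0 ?powR_ge0.
  have l0 : 0 <= l_ n by rewrite (le_trans _ (hl n).1).
  rewrite ler_wpM2r// ge0_ler_powR ?nnegrE ?(ltW a0) ?mulr_ge0// ler_wpM2l//.
  by rewrite !ger0_norm; lra.
near=> n; rewrite /excess_weight ifF//; apply/negbTE/negP => /andP[ly _].
have : y < l_ n.
  rewrite (lt_le_trans _ (hl n).1)//; near: n; exact: nbhs_infty_gtr.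
by rewrite ltNge (ltW ly).
Unshelve. all: by end_near. Qed.

(** A strong maximum principle: the integrand representing the difference at [x] is continuous and
    of one sign, so strictness at a single point [x1] makes the integral nonzero for every
    [x > l]. *)
Lemma profile_reflection_dichotomy l : (forall x, l < x -> v x <= v (2 * l - x)) ->
  (forall x, l < x -> v x < v (2 * l - x)) \/ (forall x, v (2 * l - x) = v x).
Proof.
move=> le_l; have [[x1 lx1 vx1]|no] := pselect (exists2 x, l < x & v x < v (2 * l - x)).
  left=> x lx.
  pose g y := - reflected_integrand l x y.
  have right_le0 y : l < y -> 0 <= g y.
    move=> ly; rewrite oppr_ge0 pmulr_rle0 ?plane_kernel_gt0// subr_le0 ler_expR.
    exact: le_l.
  have g0 y : 0 <= g y.
    have [ly|yl|E] := ltgtP l y; first exact: right_le0.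
      rewrite /g -reflected_integrand_reflect; apply: right_le0; lra.
    rewrite /g /reflected_integrand (_ : 2 * l - y = y); last by rewrite E; ring.
    by rewrite subrr mulr0 oppr0.
  have cf : continuous f := df.1.
  have cg : continuous g.
    move=> y; apply: cvgN; apply: cvgM; first exact: continuous_plane_kernel.
    apply: cvgB; first exact: cf.
    apply: (@continuous_comp _ _ _ (fun y => 2 * l - y) f); last exact: cf.
    by apply: cvgB; [exact: cvg_cst|exact: cvg_id].
  have gx1 : 0 < g x1.
    by rewrite oppr_gt0 pmulr_rlt0 ?plane_kernel_gt0// subr_lt0 ltr_expR.
  have sr := summable_reflected_integrand l x.
  have := continuous_total_gt0 cg g0 gx1 (summableN sr).
  rewrite /g (totalN sr) oppr_gt0 => t0.
  by rewrite -subr_lt0 profile_difference pmulr_rlt0// divr_gt0.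
right=> x.
have E y : l < y -> v (2 * l - y) = v y.
  move=> ly; apply/eqP; rewrite eq_le le_l// andbT leNgt; apply/negP => h.
  by apply: no; exists y.
have [lx|xl|->] := ltgtP l x; first exact: E.
  by rewrite -(E (2 * l - x)) ?subKr//; lra.
by congr v; ring.
Qed.

(** The two reflections compose to a translation by [2 (m - l)]; a periodic [v] cannot tend to minus
    infinity. *)
Lemma profile_two_centers l m : l < m -> (forall x, v (2 * l - x) = v x) ->
  (forall x, v (2 * m - x) = v x) -> False.
Proof.
move=> lm El Em; pose d := 2 * (m - l); have d0 : 0 < d by rewrite mulr_gt0// subr_gt0.
have per n : v (n%:R * d) = v 0.
  elim: n => [|n IH]; first by rewrite mul0r.
  rewrite -IH -(El (n%:R * d)) -Em; congr v; rewrite /d -natr1; ring.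
have [r r1 hr] := profile_tends_to_minus_infinity a0 a1 k0 sf vE (v 0 - 1).
have := hr ((Num.Def.archi_bound (r / d))%:R * d).
have r0 : 0 < r by exact: lt_le_trans r1.
rewrite per normrM normr_nat (gtr0_norm d0) -ler_pdivrMr//.
move=> /(_ (ltW (archi_boundP (ltW (divr_gt0 r0 d0))))); lra.
Qed.

(** The critical position [x0] is the infimum of the set [B], upward closed by its form. For
    [l > x0] the inequality is strict, since equality would make [l] a second centre of symmetry. *)
Lemma profile_symmetric_decreasing : exists x0, (forall x, v (2 * x0 - x) = v x) /\
  forall l, x0 < l -> forall x, l < x -> v x < v (2 * l - x).
Proof.
pose B : set R := [set l | forall m, l <= m -> forall x, m < x -> v x <= v (2 * m - x)].
have [l0 Bl0] := profile_le_reflection_far.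
have [r r1 hr] := profile_tends_to_minus_infinity a0 a1 k0 sf vE (v 0 - 1).
have lbB : lbound B (- r).
  move=> l Bl; rewrite leNgt; apply/negP => lr.
  (* The plane at [-r / 2] reflects 0 to [-r], where [v] is at most [v 0 - 1]. *)
  have := Bl (- r / 2) _ 0 _; rewrite (_ : 2 * (- r / 2) - 0 = - r); last by field.
  move=> h; have : v 0 <= v (- r) by apply: h; lra.
  have := hr (- r); rewrite normrN ger0_norm; last lra.
  by rewrite lexx => /(_ isT); lra.
have hiB : has_inf B by split; [exists l0|exists (- r)].
pose x0 := inf B.
have above m : x0 < m -> forall x, m < x -> v x <= v (2 * m - x).
  move=> x0m; have e0 : 0 < m - x0 by rewrite subr_gt0.
  have [l Bl] := inf_adherent e0 hiB; rewrite -/x0 addrC subrK => lm.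
  by apply: Bl; exact: ltW.
have at_x0 x : x0 < x -> v x <= v (2 * x0 - x).
  move=> x0x.
  have c1 : v (2 * m - x) @[m --> x0^'+] --> v (2 * x0 - x).
    apply: cvg_at_right_filter.
    apply: (@continuous_comp _ _ _ (fun m => 2 * m - x) v); last exact: cv.
    by apply: cvgB; [apply: cvgM; [exact: cvg_cst|exact: cvg_id]|exact: cvg_cst].
  apply: (cvgr_to_ge c1); near=> m; apply: above.
    by near: m; exact: nbhs_right_gt.
  by near: m; exact: nbhs_right_lt.
have Bx0 : B x0.
  by move=> m; rewrite le_eqVlt => /orP[/eqP <-|/above].
exists x0.
suff sym x : v (2 * x0 - x) = v x.
  split=> // l x0l x lx.
  by have [->|E] := profile_reflection_dichotomy (above _ x0l); last case: (profile_two_centers x0l sym E).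
have [strict|] := profile_reflection_dichotomy at_x0; last exact.
(* The strict alternative is refuted: by minimality of [x0] some plane within [1 / (n + 1)] to its
   left violates the inequality and has factor at least 1, whereas these factors tend to 0. *)
have /choice[l_ hl] n : exists l, [/\ x0 - n.+1%:R^-1 <= l, l < x0 &
    ~ (k * total (excess_weight l) < 1)].
  have : ~ B (x0 - n.+1%:R^-1).
    move=> h; have : x0 <= x0 - n.+1%:R^-1 by apply: ge_inf => //; exists (- r).
    by rewrite lerBrDr gerDl leNgt invr_gt0 ltr0n.
  move=> /existsNP[l] /not_implyP[nl] /existsNP[y] /not_implyP[ly] vy.
  exists l; split => //; last by move=> h; apply: vy; exact: profile_le_reflection h _ ly.
  by rewrite ltNge; apply/negP => x0l; apply: vy; exact: Bx0.
have [n hn] : exists n, k * total (excess_weight (l_ n)) < 1; last by case: (hl n).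
have n1 n : (n.+1%:R^-1 : R) <= 1 by rewrite invf_le1 ?ltr0n// ler1n.
have lcv : l_ n @[n --> \oo] --> x0.
  apply: (@squeeze_cvgr _ _ _ _ (fun n => x0 - n.+1%:R^-1) (fun=> x0)).
  - by near=> n; have [-> /ltW ->] := hl n.
  - rewrite -[X in _ --> X]subr0; apply: cvgB; first exact: cvg_cst.
    exact: cvg_harmonic.
  - exact: cvg_cst.
apply: (@total_excess_cvg0 l_ (`|x0| + 1) x0) => [|n y|y yx0].
- by rewrite addr_ge0.
- apply: le_trans (excess_weight_le _ _) _.
  rewrite ler_wpM2r// ge0_ler_powR ?nnegrE ?(ltW a0) ?mulr_ge0 ?addr_ge0// ler_wpM2l//.
  have [h1 h2 _] := hl n; have h3 := n1 n.
  rewrite (le_trans (ler_normB _ _))// lerD2l.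
  have := ler_normD (l_ n - x0) x0; rewrite subrK.
  move: h1 h3; move: (n.+1%:R^-1) => e h1 h3.
  have : `|l_ n - x0| <= 1 by rewrite ler_norml; apply/andP; split; lra.
  lra.
have [x0y|yx|E] := ltgtP x0 y; last by rewrite E eqxx in yx0.
  (* For [y > x0] the strict inequality at [x0] passes to [l_n] for large [n] by continuity; points
     [y < x0] eventually lie to the left of [l_n]. *)
  have c1 : v (2 * l_ n - y) @[n --> \oo] --> v (2 * x0 - y).
    have c2 : 2 * l_ n - y @[n --> \oo] --> 2 * x0 - y.
      by apply: cvgB; [apply: cvgM; [exact: cvg_cst|exact: lcv]|exact: cvg_cst].
    by apply: (@cvg_comp _ _ _ _ v _ _ _ c2); exact: cv.
  near=> n; rewrite /excess_weight ifF//; apply/negbTE; rewrite negb_and -leNgt; apply/orP; right.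
  rewrite -leNgt; near: n; exact: cvgr_ge c1 _ (strict _ x0y).
near=> n; rewrite /excess_weight ifF//; apply/negbTE; rewrite negb_and; apply/orP; left.
rewrite -leNgt; near: n; exact: cvgr_ge lcv _ yx.
Unshelve. all: by end_near. Qed.

End moving_planes.

(** The function [v] is the continuous representative with which [u] is identified. *)
Theorem theorem1p1 (R : realType) (s : R) (u : R -> R)
    (s_gt : 2^-1 < s) (s_lt : s < 1)
    (u_sol : liouville_solution s u)
    (u_fin : (\int[lebesgue_measure]_x (expR (u x))%:E < +oo)%E) :
  exists v : R -> R,
    {ae lebesgue_measure, forall x : R, v x = u x} /\
    smooth v /\
    (exists M : R, forall x : R, v x <= M) /\
    (exists C M : R, forall x : R, M <= `|x| ->
       `|v x| <= C * `|x| `^ (2 * s - 1)) /\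
    exists (x0 : R) (u0 : R -> R),
      (forall r t : R, 0 <= t -> t < r -> u0 r < u0 t) /\
      (forall x : R, v x = u0 `|x - x0|).
Proof.
have a0 : 0 < 2 * s - 1 by lra.
have a1 : 2 * s - 1 < 1 by lra.
have [v [k [p [k0 uv sv vE]]]] := exists_continuous_representative s_gt s_lt u_sol u_fin.
exists v; split; first exact: uv.
split; first exact: profile_smooth a0 a1 k0 sv vE.
split; first exact: profile_bounded_above a0 a1 k0 sv vE.
split.
  by have [C hC] := profile_growth a0 a1 k0 sv vE; exists C, 1.
have [x0 [sym dec]] := profile_symmetric_decreasing a0 a1 k0 sv vE.
exists x0, (fun r => v (x0 + r)); split => [r t t0 tr|x].
  (* Reflection about the midpoint of [x0 + t] and [x0 + r], which lies to the right of [x0],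
     exchanges these two points. *)
  have h1 : x0 < x0 + (r + t) / 2 by lra.
  have h2 : x0 + (r + t) / 2 < x0 + r by lra.
  have := dec _ h1 _ h2.
  by rewrite (_ : 2 * (x0 + (r + t) / 2) - (x0 + r) = x0 + t)//; field.
have [x0x|xx0] := leP 0 (x - x0); first by rewrite ger0_norm// addrC subrK.
by rewrite ltr0_norm// -sym; congr v; ring.
Qed.
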